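(* Let $d\ge 1$, let $(\Omega,\mathcal F,(\mathcal F_t)_{0\le t\le T},P)$ be a stochastic basis with $\mathcal F=\mathcal F_T$, let the asset prices $S^j_t=S^j_0\exp(H^j_t)$, $0\le t\le T$, $1\le j\le d$, with $S^j_0>0$ be modeled as exponential semimartingales (see context), let $X_T=\Psi(H_t,\,0\le t\le T)$ be an $\mathcal F_T$-measurable $\mathbb R^d$-valued random variable, where $\Psi$ is an $\mathbb R^d$-valued measurable functional, and let $f:\mathbb R^d\to\mathbb R_+$ be measurable. Let $R\in\mathbb R^d$ and let $g(x)=\mathrm e^{-\langle R,x\rangle}f(x)$, $x\in\mathbb R^d$. Assume that 1. $g\in L^1(\mathbb R^d)\cap L^2(\mathbb R^d)$; 2. $M_{X_T}(R)=E[\mathrm e^{\langle R,X_T\rangle}]$ exists (is finite). Then the time-$0$ price function $\mathbb V_f(X;\mathsf s)=E[f(X_T-\mathsf s)]$, $\mathsf s\in\mathbb R^d$, satisfies $$\mathbb V_f(X;\cdot)=\frac{\mathrm e^{-\langle R,\cdot\rangle}}{(2\pi)^d}\;\mathop{L^2\text{-}\lim}_{A\to\infty}\int_{[-A,A]^d}\mathrm e^{-i\langle u,\cdot\rangle}\,\varphi_{X_T}(u-iR)\,\widehat f(iR-u)\,\mathrm du ,$$ where $L^2\text{-}\lim$ denotes the limit in $L^2(\mathbb R^d)$ of functions of the argument $\cdot=\mathsf s$; that is, the functions $\mathsf s\mapsto\frac1{(2\pi)^d}\int_{[-A,A]^d}\mathrm e^{-i\langle u,\mathsf s\rangle}\varphi_{X_T}(u-iR)\widehat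 f(iR-u)\,\mathrm du$ converge in $L^2(\mathbb R^d)$, as $A\to\infty$, to $\mathsf s\mapsto\mathrm e^{\langle R,\mathsf s\rangle}\,\mathbb V_f(X;\mathsf s)$.
   Context: Model. $H=(H^1,\dots,H^d)^\top$ is an $\mathbb R^d$-valued semimartingale on the stochastic basis, each component having canonical representation $H^j=H^j_0+B^j+H^{j,c}+h^j(x)*(\mu-\nu)+(x^j-h^j(x))*\mu$, where $h$ is an $\mathbb R^d$-valued truncation function with components $h^j$, $B^j$ is predictable of bounded variation, $H^{j,c}$ is the continuous martingale part, $\mu$ is the random measure of jumps of $H$ and $\nu$ its predictable compensator; $*$ denotes the (stochastic) integral process with respect to a random measure. $P$ is a martingale measure for the assets (each $S^j$ is a local martingale under $P$), and interest rate and dividend yield are zero. Option. The payoff at maturity $T$ is $f(X_T-\mathsf s)$ with $\mathsf s=(\mathsf s^1,\dots,\mathsf s^d)$, $\mathsf s^j=-\log S^j_0$, and its time-$0$ price, regarded as a function of $\mathsf s\in\mathbb R^d$ (the law of $X_T$ being fixed), is $\mathbb V_f(X;\mathsf s)=E[f(X_T-\mathsf s)]$, the expectation being under $P$. Notation. $\langle u,v\rangle=\sum_k u_kv_k$ for $u,v\in\mathbb C^d$ (bilinear, not Hermitian). $M_{X_T}(z)=E[\mathrm e^{\langle z,X_T\rangle}]$ and $\varphi_{X_T}(z)=E[\mathrm e^{i\langle z,X_T\rangle}]$ for those $z\in\mathbb C^d$ for which they are defined. The (extended) Fourier transform is $\widehat f(z)=\int_{\mathbb R^d}\mathrm e^{i\langle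 z,x\rangle}f(x)\,\mathrm dx$ for those $z\in\mathbb C^d$ for which the integral converges absolutely; thus $\widehat f(iR-u)=\int_{\mathbb R^d}\mathrm e^{-i\langle u,x\rangle}g(x)\,\mathrm dx$ for $u\in\mathbb R^d$. *)

(* Defs.v *)
From HB Require Import structures.
From mathcomp Require Import all_boot all_order all_algebra.
From mathcomp Require Import all_classical all_reals all_analysis.
From mathcomp Require Import complex.

Set Implicit Arguments.
Unset Strict Implicit.
Unset Printing Implicit Defensive.

Import Order.TTheory GRing.Theory Num.Theory.
Import numFieldNormedType.Exports.

Local Open Scope classical_set_scope.
Local Open Scope ring_scope.
Local Open Scope complex_scope.

(** R^d is [d.-tuple R] with the product (= Borel) sigma-algebra. *)

Section vectors.
Context {d : nat}.

(* bilinear also over R[i]: no conjugation *)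
Definition dotp {A : pzSemiRingType} (u v : d.-tuple A) : A :=
  \sum_(j < d) tnth u j * tnth v j.

Definition tsub {A : zmodType} (u v : d.-tuple A) : d.-tuple A :=
  [tuple tnth u j - tnth v j | j < d].

Definition cvec {R : rcfType} (u : d.-tuple R) : d.-tuple R[i] :=
  [tuple (tnth u j)%:C | j < d].

End vectors.

(** d-dimensional Lebesgue measure: the d-fold product of the one-dimensional
    one, transported along (x, y) |-> x :: y. *)

Section lebesgue_cons.
Context {R : realType} {d : nat}.
Variable mu : {sigma_finite_measure set (d.-tuple R) -> \bar R}.

Definition tcons (p : R * d.-tuple R) : d.+1.-tuple R :=
  [the d.+1.-tuple R of p.1 :: p.2].

Lemma measurable_tcons : measurable_fun setT tcons.
Proof. by apply: measurable_cons; [exact: measurable_fst|exact: measurable_snd]. Qed.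

Let tuncons (x : d.+1.-tuple R) : R * d.-tuple R :=
  (tnth x ord0, [tuple of behead x]).

Let measurable_tuncons : measurable_fun setT tuncons.
Proof.
apply/measurable_fun_pairP; split.
  exact: (measurable_tnth ord0).
exact: measurable_behead.
Qed.

Let tconsK : cancel tcons tuncons.
Proof. by case=> x y; congr pair; apply/val_inj. Qed.

Definition lebesgue_cons : set (d.+1.-tuple R) -> \bar R :=
  pushforward (@lebesgue_measure R \x mu)%E tcons.

Let lebesgue_cons0 : lebesgue_cons set0 = 0.
Proof. by rewrite /lebesgue_cons /pushforward preimage_set0 measure0. Qed.

Let lebesgue_cons_ge0 A : (0 <= lebesgue_cons A)%E.
Proof. by apply: integral_ge0 => x _; exact: measure_ge0. Qed.

Let lebesgue_cons_sigma_additive : semi_sigma_additive lebesgue_cons.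
Proof.
move=> F mF tF mUF; rewrite /lebesgue_cons /pushforward preimage_bigcup.
apply: measure_semi_sigma_additive.
- by move=> n; rewrite -[X in measurable X]setTI; exact: measurable_tcons.
- apply/trivIsetP => /= i j _ _ ij; rewrite -preimage_setI.
  by move/trivIsetP : tF => /(_ _ _ _ _ ij) ->//; rewrite preimage_set0.
- by rewrite -preimage_bigcup -[X in measurable X]setTI; exact: measurable_tcons.
Qed.

HB.instance Definition _ := isMeasure.Build _ _ _
  lebesgue_cons lebesgue_cons0 lebesgue_cons_ge0 lebesgue_cons_sigma_additive.

Let lebesgue_cons_sigma_finite : sigma_finite setT lebesgue_cons.
Proof.
have /sigma_finiteP[F [TF ndF Foo]] := sigma_finiteT (@lebesgue_measure R).
have /sigma_finiteP[G [TG ndG Goo]] := sigma_finiteT mu.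
exists (fun n => tuncons @^-1` (F n `*` G n)).
  rewrite -preimage_bigcup; apply/esym; rewrite -subTset => t _.
  have [n _ Fn] : (\bigcup_n F n) (tuncons t).1 by rewrite -TF.
  have [m _ Gm] : (\bigcup_n G n) (tuncons t).2 by rewrite -TG.
  exists (maxn n m) => //; split.
  - by move: Fn; exact/subsetPset/ndF/leq_maxl.
  - by move: Gm; exact/subsetPset/ndG/leq_maxr.
move=> n; have [mF Fn] := Foo n; have [mG Gn] := Goo n; split.
  by rewrite -[X in measurable X]setTI; apply: measurable_tuncons => //;
    exact: measurableX.
rewrite /lebesgue_cons /pushforward -comp_preimage.
rewrite (_ : tuncons \o tcons = id); last by apply/funext => x; exact: tconsK.
by rewrite preimage_id product_measure1E// lte_mul_pinfty// ge0_fin_numE.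
Qed.

HB.instance Definition _ := Measure_isSigmaFinite.Build _ _ _
  lebesgue_cons lebesgue_cons_sigma_finite.

End lebesgue_cons.

Fixpoint lebesgue {R : realType} (d : nat) :
    {sigma_finite_measure set (d.-tuple R) -> \bar R} :=
  if d is d'.+1 then lebesgue_cons (@lebesgue R d') else \d_ [tuple].

Section complex_integration.
Context {R : realType}.

Definition cexp (z : R[i]) : R[i] :=
  (expR (complex.Re z))%:C * (cos (complex.Im z) +i* sin (complex.Im z)).

Context {dT : measure_display} {T : measurableType dT}.
Variable mu : {measure set T -> \bar R}.

Definition cintegral (D : set T) (h : T -> R[i]) : R[i] :=
  (\int[mu]_(x in D) complex.Re (h x)) +i* (\int[mu]_(x in D) complex.Im (h x)).

Definition cLnorm2 (h : T -> R[i]) : \bar R :=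
  Lnorm mu 2%:E (fun x => (Normc.normc (h x))%:E).

Definition cL2 (h : T -> R[i]) : Prop :=
  [/\ measurable_fun setT (fun x => complex.Re (h x)),
      measurable_fun setT (fun x => complex.Im (h x)) &
      (cLnorm2 h < +oo)%E].

(* L^2-lim of F A as A -> +oo is G *)
Definition cL2_cvg (F : R -> T -> R[i]) (G : T -> R[i]) : Prop :=
  [/\ forall A, cL2 (F A), cL2 G &
      cLnorm2 (fun x => F A x - G x) @[A --> +oo] --> 0%E].

End complex_integration.

(** Processes are functions of t : R of which only the values at t in [0, T]
    matter. *)

Section stochastic_basis.
Context {R : realType} {dO : measure_display} {Omega : measurableType dO}.
Variables (P : probability Omega R) (T : R) (F : R -> set (set Omega)).

(* right-continuous, as is every stochastic basis in the sense of Jacod and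
   Shiryaev; the last clause is FF = FF_T *)
Definition stochastic_basis : Prop :=
  [/\ forall t : R, 0 <= t <= T -> sigma_algebra setT (F t),
      forall s t : R, 0 <= s -> s <= t -> t <= T -> F s `<=` F t,
      forall t : R, 0 <= t < T -> F t = \bigcap_(s in `]t, T]) F s &
      F T = measurable].

Definition adapted {d' : measure_display} {V : measurableType d'}
    (X : R -> Omega -> V) : Prop :=
  forall t : R, 0 <= t <= T -> forall B : set V, measurable B -> F t (X t @^-1` B).

Definition cadlag (x : R -> R) : Prop :=
  (forall t : R, 0 <= t < T -> x s @[s --> t^'+] --> x t) /\
  (forall t : R, 0 < t <= T -> cvg (x s @[s --> t^'-])).

(* the last clause, with adaptedness, says that M s is a version of
   the conditional expectation of M t given F s *)
Definition martingale (M : R -> Omega -> R) : Prop :=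
  [/\ adapted M,
      {ae P, forall w, cadlag (M ^~ w)},
      forall t : R, 0 <= t <= T -> P.-integrable setT (EFin \o M t) &
      forall s t : R, 0 <= s -> s <= t -> t <= T -> forall A, F s A ->
        \int[P]_(w in A) M t w = \int[P]_(w in A) M s w].

Definition stopping_time (tau : Omega -> R) : Prop :=
  (forall w, 0 <= tau w) /\
  (forall t : R, 0 <= t <= T -> F t [set w | tau w <= t]).

(* On a finite horizon, a localizing sequence only has to exceed T eventually,
   and a martingale is automatically uniformly integrable. *)
Definition local_martingale (M : R -> Omega -> R) : Prop :=
  adapted M /\
  exists tau : nat -> Omega -> R,
    [/\ forall n, stopping_time (tau n),
        forall w n m, (n <= m)%N -> tau n w <= tau m w,
        {ae P, forall w, exists n, T <= tau n w} &
        forall n, martingale (fun t w => M (Num.min t (tau n w)) w)].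

Definition finite_variation (A : R -> Omega -> R) : Prop :=
  [/\ adapted A, forall w, cadlag (A ^~ w), forall w, A 0 w = 0 &
      forall w, bounded_variation 0 T (A ^~ w)].

Definition semimartingale (X : R -> Omega -> R) : Prop :=
  [/\ adapted X, forall w, cadlag (X ^~ w) &
      exists M A : R -> Omega -> R,
        [/\ local_martingale M, forall w, M 0 w = 0, finite_variation A &
            {ae P, forall w, forall t : R, 0 <= t <= T ->
               X t w = X 0 w + M t w + A t w}]].

End stochastic_basis.

(** The space of cadlag paths from [0, T] to R^d with the sigma-algebra generated
    by the evaluations at times in [0, T], which is the Borel sigma-algebra of
    the Skorokhod topology. The set of cadlag paths is not itself measurable in
    the space of all paths, hence the trace sigma-algebra. *)

Section path_space.
Context {R : realType} {d : nat}.
Variable T : R.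

Definition cadlag_paths : set (R -> d.-tuple R) :=
  [set h | forall j, cadlag T (fun t => tnth (h t) j)].

Definition path_cylinders : set (set (R -> d.-tuple R)) :=
  [set C | exists (t : R) (B : set (d.-tuple R)), [/\ 0 <= t <= T, measurable B &
     C = cadlag_paths `&` [set h | B (h t)]]].

Definition measurable_functional (Psi : (R -> d.-tuple R) -> d.-tuple R) :=
  forall B : set (d.-tuple R), measurable B ->
    <<s cadlag_paths, path_cylinders >> (cadlag_paths `&` Psi @^-1` B).

End path_space.

Section pricing.
Context {R : realType} {d : nat} {dO : measure_display}
  {Omega : measurableType dO}.
Variable P : probability Omega R.

Definition mgf (X : Omega -> d.-tuple R) (r : d.-tuple R) : \bar R :=
  'E_P[(fun w => expR (dotp r (X w)))]%E.

Definition charfun (X : Omega -> d.-tuple R) (z : d.-tuple R[i]) : R[i] :=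
  cintegral P setT (fun w => cexp ('i%C * dotp z (cvec (X w)))).

Definition fourier (f : d.-tuple R -> R) (z : d.-tuple R[i]) : R[i] :=
  cintegral (lebesgue d) setT
    (fun x => cexp ('i%C * dotp z (cvec x)) * (f x)%:C).

(* possibly +oo for s in a Lebesgue-null set *)
Definition price (f : d.-tuple R -> R) (X : Omega -> d.-tuple R)
    (s : d.-tuple R) : \bar R :=
  'E_P[(fun w => f (tsub (X w) s))]%E.

Definition cube (A : R) : set (d.-tuple R) :=
  [set u | forall j : 'I_d, - A <= tnth u j <= A].

(* u - i r and i r - u *)
Definition sub_ir (u r : d.-tuple R) : d.-tuple R[i] :=
  [tuple tnth u j -i* tnth r j | j < d].
Definition ir_sub (r u : d.-tuple R) : d.-tuple R[i] :=
  [tuple - tnth u j +i* tnth r j | j < d].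

Definition truncated_inverse (f : d.-tuple R -> R) (X : Omega -> d.-tuple R)
    (r : d.-tuple R) (A : R) (s : d.-tuple R) : R[i] :=
  ((2 * pi) ^- d)%:C *
  cintegral (lebesgue d) (cube A)
    (fun u => cexp (- 'i%C * (dotp u s)%:C) * charfun X (sub_ir u r)
              * fourier f (ir_sub r u)).

End pricing.

(* Main.v *)
(** With g(x) = e^(-<R,x>) f(x), the function G(s) = e^(<R,s>) V(s) is the average of
    g(X_T - s) under the finite measure e^(<R,X_T>) P. Hence G is nonnegative and lies
    in L^1 and L^2, and its Fourier transform is the product of phi_(X_T)(u - iR) and
    fhat(iR - u), by Fubini. It remains to see that the truncated inverse Fourier
    transforms of G converge to G in L^2. As G is real and the cubes are symmetric,
    they equal (2 pi)^(-d) times H(1_cube H G), with the real Hartley transform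
    H h(u) = int (cos <u,x> + sin <u,x>) h(x) dx.

    Abel summation with the weights prod_j exp(-eps |u_j|) turns int (H h)^2 into the
    quadratic form of the product Poisson kernel. That form is at most (2 pi)^d |h|^2
    by Schur's test, and for h >= 0 it tends to (2 pi)^d |h|^2, since the sets whose
    indicator is approximated by its convolutions form a sigma-algebra that contains
    the half-spaces. This gives Plancherel's identity for H on G. Then
    |F_A - G|^2 <= |G|^2 - (2 pi)^(-d) int_cube (H G)^2, which tends to 0. *)

Require Import Defs.
From mathcomp Require Import all_boot all_order all_algebra.
From mathcomp Require Import all_classical all_reals all_analysis.
From mathcomp Require Import measurable_realfun complex ring lra.

Set Implicit Arguments.
Unset Strict Implicit.
Unset Printing Implicit Defensive.

Import Order.TTheory GRing.Theory Num.Theory.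
Import numFieldNormedType.Exports HBNNSimple.

Local Open Scope classical_set_scope.
Local Open Scope ring_scope.
Local Open Scope complex_scope.

(** The Hartley kernel keeps every integral real; being symmetric and bounded by 2, it lets one
    exchange rule for bounded kernels serve for its uses of Fubini. The Abel weight is a product
    over coordinates because its transform then factors into one-dimensional integrals with
    elementary antiderivatives. The Poisson form is not shown to converge by density of continuous
    functions in L^2. The lower bound only needs to control the mass that the kernel carries out of
    the level sets of a simple function below h. This is where h >= 0 matters: h(x) h(y) is bounded
    below by 0 when x and y lie in different level sets. G qualifies because f >= 0. The cut
    function 1_cube H G changes sign, but for it the upper bound is enough. Writing D = (2 pi)^(-d)
    and b = int_cube (H G)^2, symmetry of the kernel makes the cross term of |F_A - G|^2 exactly -2
    D b, while |F_A|^2 <= D b; the sum is at most |G|^2 - D b. Plancherel's lower bound for G then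
    closes the argument. *)

(** * The one-dimensional Abel weight and Poisson kernel *)

Lemma ge0_integral_reflect1 (R : realType) (x : R) (f : R -> \bar R) :
  measurable_fun [set: R] f -> (forall s, 0 <= f s)%E ->
  (\int[lebesgue_measure]_s f (x - s)%R = \int[lebesgue_measure]_s f s)%E.
Proof.
move=> mf f0.
have mphi : measurable_fun setT (fun s : measurableTypeR R => (x - s)%R : measurableTypeR R).
  by apply: measurable_funB => //; exact: measurable_cst.
have E A : measurable A ->
    lebesgue_measure A = pushforward lebesgue_measure (fun s : measurableTypeR R => (x - s)%R : measurableTypeR R) A.
  move=> mA.
  apply: lebesgue_measure_unique => //= _ [[a b]] _ <-.
  rewrite /pushforward.
  (* Half-open intervals determine Lebesgue measure. The reflection swaps which endpoint is
     included, which does not affect the length. *)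
  have -> : (fun s => x - s) @^-1` `]a, b] = `[x - b, x - a[%classic.
    apply/seteqP; split => s /=; rewrite !in_itv/=; move=> /andP[h1 h2]; apply/andP; split; lra.
  rewrite /= !lebesgue_measure_itv/= !lte_fin.
  have -> : (x - b < x - a) = (a < b) by lra.
  by case: ifP => // _; rewrite -!EFinB; congr EFin; ring.
rewrite [RHS](eq_measure_integral (pushforward lebesgue_measure (fun s : measurableTypeR R => (x - s)%R : measurableTypeR R))); last first.
  by move=> A mA _; exact: E.
by rewrite ge0_integral_pushforward.
Qed.

(* The weight of Abel summation; [pker e], which is [2 pi] times the Poisson kernel,
   is its Fourier transform. *)
Definition expw {R : realType} (e u : R) : R := expR (- (e * `|u|)).

Definition pker {R : realType} (e t : R) : R := 2 * e / (e ^+ 2 + t ^+ 2).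

Lemma expw_ge0 (R : realType) (e u : R) : 0 <= expw e u.
Proof. exact: expR_ge0. Qed.

Lemma expwN (R : realType) (e u : R) : expw e (- u) = expw e u.
Proof. by rewrite /expw normrN. Qed.

Lemma continuous_expw (R : realType) (e : R) : continuous (expw e).
Proof.
move=> u; apply: (@continuous_comp _ _ _ (fun u => - (e * `|u|)) expR); last exact: continuous_expR.
by apply: cvgN; apply: cvgM; [exact: cvg_cst|exact: norm_continuous].
Qed.

Lemma is_derive_lin (R : realType) (a x : R) : is_derive x 1 (fun u => a * u) a.
Proof.
apply: is_derive_eq. by rewrite /GRing.scale/= mulr1.
Qed.
Lemma is_derive_expR_lin (R : realType) (a x : R) :
  is_derive x 1 (fun u => expR (a * u)) (a * expR (a * x)).
Proof.
have := is_derive_lin a x => h.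
rewrite [X in is_derive _ _ X](_ : _ = expR \o (fun u => a * u))//.
apply: is_derive_eq.
rewrite mulrC.
by [].
Qed.
Lemma is_derive_sin_lin (R : realType) (a x : R) :
  is_derive x 1 (fun u => sin (a * u)) (a * cos (a * x)).
Proof.
have := is_derive_lin a x => h.
rewrite [X in is_derive _ _ X](_ : _ = sin \o (fun u => a * u))//.
by apply: is_derive_eq; rewrite mulrC.
Qed.
Lemma is_derive_cos_lin (R : realType) (a x : R) :
  is_derive x 1 (fun u => cos (a * u)) (- (a * sin (a * x))).
Proof.
have := is_derive_lin a x => h.
rewrite [X in is_derive _ _ X](_ : _ = cos \o (fun u => a * u))//.
by apply: is_derive_eq; rewrite mulNr mulrC.
Qed.
(** The fraction is the real part of exp((-e + it)u) / (-e + it), an antiderivative of the damped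
    cosine; the term [- e^-1] accounts for the summand 1. *)
Lemma is_derive_damped_cos (R : realType) (e t x : R) : 0 < e ->
  is_derive x 1
    (fun u => expR ((- e) * u) * ((t * sin (t * u) - e * cos (t * u)) / (e ^+ 2 + t ^+ 2) - e^-1))
    (expR ((- e) * x) * (1 + cos (t * x))).
Proof.
move=> e0.
have ne : e != 0 by rewrite gt_eqF.
have nD : e ^+ 2 + t ^+ 2 != 0 by rewrite gt_eqF// ltr_wpDr ?sqr_ge0// exprn_gt0.
have d1 := is_derive_expR_lin (- e) x.
have d2 := is_derive_cos_lin t x.
have d3 := is_derive_sin_lin t x.
apply: is_derive_eq.
rewrite /GRing.scale /=.
set E := expR _; set C := cos _; set S := sin _.
field.
by rewrite ne nD.
Qed.
Lemma cvg_expR_lin_pinfty (R : realType) (e : R) : 0 < e ->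
  expR ((- e) * u) @[u --> +oo] --> 0.
Proof.
move=> e0.
rewrite [X in X @ _ --> _](_ : _ = (fun x => expR (- x)) \o (fun u => e * u)); last first.
  by apply/funext => u /=; rewrite mulNr.
apply: (@cvg_comp _ _ _ (fun u => e * u) (fun x => expR (- x)) _ +oo); last exact: cvgr_expR.
apply/cvgryPge => A; near=> u.
by rewrite -ler_pdivrMl//; near: u; exact: nbhs_pinfty_ge.
Unshelve. all: by end_near. Qed.

Lemma pkerD_neq0 (R : realType) (e t : R) : 0 < e -> e ^+ 2 + t ^+ 2 != 0.
Proof. by move=> e0; rewrite gt_eqF// ltr_wpDr ?sqr_ge0// exprn_gt0. Qed.

Lemma pker_ge0 (R : realType) (e t : R) : 0 < e -> 0 <= pker e t.
Proof.
by move=> e0; rewrite divr_ge0 ?addr_ge0 ?sqr_ge0// mulr_ge0// ltW.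
Qed.

Lemma pkerN (R : realType) (e t : R) : pker e (- t) = pker e t.
Proof. by rewrite /pker sqrrN. Qed.

(** The summand 1 makes the integrand nonnegative, so evenness and the fundamental theorem on a
    half-line apply in their forms for nonnegative functions. It is removed again once its own
    integral is known. *)
Lemma integral_expw_1Dcos (R : realType) (e t : R) : 0 < e ->
  (\int[lebesgue_measure]_u (expw e u * (1 + cos (t * u)))%:E =
   (2 / e + pker e t)%:E)%E.
Proof.
move=> e0.
have ne : e != 0 by rewrite gt_eqF.
have nD := pkerD_neq0 t e0.
have cf : continuous (fun u : R => expw e u * (1 + cos (t * u))).
  move=> u; apply: cvgM; first exact: continuous_expw.
  apply: cvgD; first exact: cvg_cst.
  apply: (@continuous_comp _ _ _ (fun u => t * u) cos); last exact: continuous_cos.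
  by apply: cvgM; [exact: cvg_cst|exact: cvg_id].
have f0 u : 0 <= expw e u * (1 + cos (t * u)).
  by rewrite mulr_ge0 ?expw_ge0// addrC -lerBlDr sub0r cos_geN1.
rewrite ge0_symfun_integralT//; last first.
  by move=> u /=; rewrite expwN mulrN cosN.
rewrite -set_itvcy.
pose F (u : R) := expR ((- e) * u) * ((t * sin (t * u) - e * cos (t * u)) / (e ^+ 2 + t ^+ 2) - e^-1).
have dF u : is_derive (u : R) 1 F (expR ((- e) * u) * (1 + cos (t * u))).
  exact: is_derive_damped_cos.
rewrite (@ge0_continuous_FTC2y _ _ F 0 0)//.
- rewrite /F !mulr0 expR0 sin0 cos0 -EFinB -EFinM; congr EFin; rewrite /pker.
  by field; rewrite ne nD.
- exact: continuous_subspaceT.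
(* [C] bounds the oscillating factor of [F] uniformly in [u], so the exponential squeezes [F] to 0
   at infinity. *)
- pose C := (`|t| + e) / (e ^+ 2 + t ^+ 2) + e^-1.
  have h u : `|(t * sin (t * u) - e * cos (t * u)) / (e ^+ 2 + t ^+ 2) - e^-1| <= C.
    rewrite (le_trans (ler_normB _ _))// lerD//; last by rewrite gtr0_norm// invr_gt0.
    rewrite normrM [`|_^-1|]gtr0_norm ?invr_gt0 ?ltr_wpDr ?sqr_ge0 ?exprn_gt0//.
    rewrite ler_pM2r ?invr_gt0 ?ltr_wpDr ?sqr_ge0 ?exprn_gt0//.
    rewrite (le_trans (ler_normB _ _))// lerD// normrM.
      by rewrite ler_piMr// ler_norml sin_geN1 sin_le1.
    by rewrite (gtr0_norm e0) ler_piMr ?(ltW e0)// ler_norml cos_geN1 cos_le1.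
  have c1 : expR ((- e) * u) * C @[u --> +oo] --> (0 : R).
    rewrite -(mul0r C); apply: cvgM; [exact: cvg_expR_lin_pinfty|exact: cvg_cst].
  have c2 : - (expR ((- e) * u) * C) @[u --> +oo] --> (0 : R).
    by rewrite -oppr0; exact: cvgN.
  apply: (squeeze_cvgr _ c2 c1); near=> u.
  rewrite -ler_norml /F normrM ger0_norm ?expR_ge0//.
  by rewrite ler_wpM2l ?expR_ge0.
- apply: cvg_at_right_filter.
  by apply/differentiable_continuous/derivable1_diffP; case: (dF 0).
- move=> x; rewrite in_itv/= andbT => x0.
  rewrite derive1E; case: (dF x) => _ ->.
  by rewrite /expw gtr0_norm// mulNr.
Unshelve. all: by end_near. Qed.

Lemma measurable_expw (R : realType) (e : R) : measurable_fun [set: R] (expw e).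
Proof. exact: (continuous_measurable_fun (@continuous_expw R e)). Qed.

Lemma measurable_cos (R : realType) : measurable_fun [set: R] (@cos R).
Proof. exact: (continuous_measurable_fun (@continuous_cos R)). Qed.

Lemma measurable_sin (R : realType) : measurable_fun [set: R] (@sin R).
Proof. exact: (continuous_measurable_fun (@continuous_sin R)). Qed.

(** The case t = 0 of the preceding integral, halved. *)
Lemma integral_expw (R : realType) (e : R) : 0 < e ->
  (\int[lebesgue_measure]_u (expw e u)%:E = (2 / e)%:E)%E.
Proof.
move=> e0; have := @integral_expw_1Dcos _ e 0 e0.
have mw := measurable_expw e.
under eq_integral do rewrite mul0r cos0 mulrC EFinM.
rewrite ge0_integralZl//; last 2 first.
- exact/measurable_EFinP.
- by move=> u _; rewrite lee_fin expw_ge0.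
move=> h; have := congr1 (mule (2^-1)%:E) h.
rewrite muleA -!EFinM (_ : 2^-1 * (1 + 1) = 1 :> R); last by field.
rewrite mul1e => ->; congr EFin; rewrite /pker expr0n addr0.
by field; rewrite gt_eqF.
Qed.


Lemma integrable_expw (R : realType) (e : R) : 0 < e ->
  lebesgue_measure.-integrable [set: R] (EFin \o expw e).
Proof.
move=> e0; apply/integrableP; split.
  by apply/measurable_EFinP; exact: measurable_expw.
under eq_integral do rewrite gee0_abs ?lee_fin ?expw_ge0//.
by rewrite integral_expw// ltry.
Qed.

Lemma integrable_mulr_bounded d (T : measurableType d) (R : realType)
    (mu : {measure set T -> \bar R}) (f k : T -> R) (C : R) :
  mu.-integrable setT (EFin \o f) -> measurable_fun setT k ->
  (forall x, `|k x| <= C) ->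
  mu.-integrable setT (EFin \o (fun x => f x * k x)).
Proof.
move=> intf mk kC.
have intCf : mu.-integrable setT (fun x => C%:E * (f x)%:E)%E by exact: integrableZl.
apply: le_integrable intCf => //.
  by apply/measurable_EFinP; apply: measurable_funM => //; apply/measurable_EFinP; exact: measurable_int intf.
move=> x _ /=; rewrite lee_fin normrM mulrC normrM ler_wpM2r//.
by rewrite (le_trans (kC x))// ler_norm.
Qed.

Lemma integral_expw_cos (R : realType) (e t : R) : 0 < e ->
  (\int[lebesgue_measure]_u (expw e u * cos (t * u))%:E = (pker e t)%:E)%E.
Proof.
move=> e0.
have ic : lebesgue_measure.-integrable [set: R] (EFin \o (fun u => expw e u * cos (t * u))).
  apply: (@integrable_mulr_bounded _ _ _ _ _ _ 1); first exact: integrable_expw.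
    by apply: measurableT_comp; [exact: measurable_cos|exact: measurable_funM].
  by move=> u; rewrite ler_norml cos_geN1 cos_le1.
have := @integral_expw_1Dcos _ e t e0.
under eq_integral do rewrite mulrDr mulr1 EFinD.
rewrite integralD//; last exact: integrable_expw.
rewrite integral_expw// => h.
have fn := integrable_fin_num measurableT ic.
by move: h; rewrite -(fineK fn) -EFinD => -[/addrI ->].
Qed.

Lemma integral_reflect1 (R : realType) (x : R) (f : R -> \bar R) :
  measurable_fun [set: R] f ->
  (\int[lebesgue_measure]_s f (x - s)%R = \int[lebesgue_measure]_s f s)%E.
Proof.
move=> mf; rewrite integralE [RHS]integralE; congr (_ - _)%E.
  rewrite (funepos_comp f (fun s => x - s)%R : (fun s => f (x - s)%R)^\+ = _)%E.
  by rewrite ge0_integral_reflect1//; exact: measurable_funepos.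
rewrite (funeneg_comp f (fun s => x - s)%R : (fun s => f (x - s)%R)^\- = _)%E.
by rewrite ge0_integral_reflect1//; exact: measurable_funeneg.
Qed.

Lemma Rintegral_expw_cos (R : realType) (e t : R) : 0 < e ->
  \int[lebesgue_measure]_u (expw e u * cos (t * u)) = pker e t.
Proof. by move=> e0; rewrite /Rintegral integral_expw_cos. Qed.

(** The integrand is odd: reflection at 0 makes the integral equal to its own negative. *)
Lemma Rintegral_expw_sin (R : realType) (e t : R) : 0 < e ->
  \int[lebesgue_measure]_u (expw e u * sin (t * u)) = 0.
Proof.
move=> e0; set f := fun u : R => expw e u * sin (t * u).
have mf : measurable_fun [set: R] f.
  apply: measurable_funM; first exact: measurable_expw.
  by apply: measurableT_comp; [exact: measurable_sin|exact: measurable_funM].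
have intf : lebesgue_measure.-integrable [set: R] (EFin \o f).
  apply: (@integrable_mulr_bounded _ _ _ _ _ _ 1); first exact: integrable_expw.
    by apply: measurableT_comp; [exact: measurable_sin|exact: measurable_funM].
  by move=> u; rewrite ler_norml sin_geN1 sin_le1.
have h : \int[lebesgue_measure]_u f u = \int[lebesgue_measure]_u (-1 * f u).
  rewrite /Rintegral -(@integral_reflect1 _ 0)/=; last exact/measurable_EFinP.
  congr fine; apply: eq_integral => u _; congr EFin.
  by rewrite /f sub0r expwN mulrN sinN; ring.
by move: h; rewrite RintegralZl// -/f; set I := Rintegral _ _ _; lra.
Qed.

Lemma continuous_pker (R : realType) (e : R) : 0 < e -> continuous (pker e).
Proof.
move=> e0 t; apply: cvgM; first exact: cvg_cst.
apply: cvgV; first exact: pkerD_neq0.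
by apply: cvgD; [exact: cvg_cst|apply: cvgM; exact: cvg_id].
Qed.

Lemma measurable_pker (R : realType) (e : R) : 0 < e -> measurable_fun [set: R] (pker e).
Proof. by move=> e0; exact: (continuous_measurable_fun (continuous_pker e0)). Qed.

Lemma is_derive_atan_lin (R : realType) (a x : R) :
  is_derive x 1 (fun u => 2 * atan (a * u)) (2 * a / (1 + (a * x) ^+ 2)).
Proof.
have := is_derive_lin a x => h.
have h2 : is_derive x 1 (atan \o (fun u => a * u)) ((1 + (a * x) ^+ 2)^-1 * a).
  by apply: is_derive_eq.
rewrite [X in is_derive _ _ X](_ : _ = 2 \*: (atan \o (fun u => a * u)))//.
by apply: is_derive_eq; rewrite /GRing.scale/=; ring.
Qed.

Lemma integral_pker (R : realType) (e : R) : 0 < e ->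
  (\int[lebesgue_measure]_t (pker e t)%:E = (2 * pi)%:E)%E.
Proof.
move=> e0.
rewrite ge0_symfun_integralT//; last 3 first.
- by move=> t; exact: pker_ge0.
- exact: continuous_pker.
- by move=> t; rewrite /= pkerN.
rewrite -set_itvcy.
(* This antiderivative runs from 0 to pi on the half-line; evenness doubles the result. *)
pose F (t : R) : R := 2 * atan (e^-1 * t).
have dF t := is_derive_atan_lin e^-1 t.
rewrite (@ge0_continuous_FTC2y _ _ F 0 pi)//.
- by rewrite /F mulr0 atan0 mulr0 sube0 -EFinM.
- by move=> x _; exact: pker_ge0.
- by apply: continuous_subspaceT; exact: continuous_pker.
- rewrite (_ : pi = 2 * (pi / 2)); last by field.
  apply: cvgM; first exact: cvg_cst.
  apply: (@cvg_comp _ _ _ (fun t => e^-1 * t) atan _ +oo); last exact: cvgy_atan.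
  apply/cvgryPge => A; near=> u.
  by rewrite ler_pdivlMl//; near: u; exact: nbhs_pinfty_ge.
- apply: cvg_at_right_filter.
  by apply/differentiable_continuous/derivable1_diffP; case: (dF 0).
- move=> x; rewrite in_itv/= andbT => x0.
  rewrite derive1E; case: (dF x) => _ ->.
  have := pkerD_neq0 x e0; rewrite /pker => h.
  have ne : e != 0 by rewrite gt_eqF.
  by field; rewrite ne h.
Unshelve. all: by end_near. Qed.

(** Away from the origin the kernel is O(e) times the fixed integrable function [pker 1]: since 1 <=
    t^2 / del^2, one has 1 + t^2 <= (1 + del^-2) (e^2 + t^2). *)
Lemma pker_tail (R : realType) (e del t : R) : 0 < e -> 0 < del -> del <= `|t| ->
  pker e t <= e * (1 + del ^- 2) * pker 1 t.
Proof.
move=> e0 d0 dt.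
have t2 : del ^+ 2 <= t ^+ 2 by rewrite -(real_normK (num_real t)) ler_pXn2r ?nnegrE ?normr_ge0 ?(ltW d0).
have dp : 0 < del ^+ 2 by rewrite exprn_gt0.
have tp : 0 < t ^+ 2 by exact: lt_le_trans t2.
have t1 : 1 + t ^+ 2 != 0 by rewrite gt_eqF// addr_gt0.
have d1 : del != 0 by rewrite gt_eqF.
have ep : 0 < e ^+ 2 by rewrite exprn_gt0.
rewrite /pker expr1n mulr1 ler_pdivrMr ?addr_gt0//.
have -> : e * (1 + del ^- 2) * (2 / (1 + t ^+ 2)) * (e ^+ 2 + t ^+ 2) =
   2 * e * ((1 + del ^- 2) * (e ^+ 2 + t ^+ 2) / (1 + t ^+ 2)).
  by field; rewrite t1 d1.
rewrite ler_pMr ?mulr_gt0//.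
rewrite ler_pdivlMr ?addr_gt0// mul1r.
have h : 1 <= t ^+ 2 / del ^+ 2 by rewrite ler_pdivlMr// mul1r.
have h2 : 0 < e ^+ 2 / del ^+ 2 by rewrite divr_gt0.
set D := (del ^+ 2)^-1 in h h2 *.
by rewrite mulrDl mul1r mulrDr [D * e ^+ 2]mulrC [D * t ^+ 2]mulrC; lra.
Qed.

(** * Integration over tuples: Fubini in the first coordinate, reflections, products *)

Lemma tnth_tcons0 (R : realType) d (a : R) (y : d.-tuple R) : tnth (tcons (a, y)) ord0 = a.
Proof. by []. Qed.

Lemma tnth_tconsS (R : realType) d (a : R) (y : d.-tuple R) (i : 'I_d) :
  tnth (tcons (a, y)) (lift ord0 i) = tnth y i.
Proof. by rewrite tnthS; congr tnth; apply: val_inj. Qed.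

Lemma tsub_tcons (R : realType) d (a b : R) (x y : d.-tuple R) :
  tsub (tcons (a, x)) (tcons (b, y)) = tcons (a - b, tsub x y).
Proof.
apply: eq_from_tnth => i; rewrite tnth_mktuple.
by case: (unliftP ord0 i) => [j ->|->]; rewrite ?tnth_tconsS ?tnth_mktuple.
Qed.

Lemma dotp_tcons (R : realType) d (a b : R) (x y : d.-tuple R) :
  dotp (tcons (a, x)) (tcons (b, y)) = a * b + dotp x y.
Proof.
rewrite /dotp big_ord_recl; congr (_ + _).
by apply: eq_bigr => i _; rewrite !tnth_tconsS.
Qed.

Lemma tconsE (R : realType) d (x : d.+1.-tuple R) :
  x = tcons (tnth x ord0, [tuple of behead x]).
Proof. by rewrite [LHS]tuple_eta; apply: val_inj. Qed.

(** Holds by unfolding [lebesgue_cons]; it exposes the pushforward so that change of variables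
    applies. *)
Lemma integral_lebesgueS_pushforward (R : realType) d (f : d.+1.-tuple R -> \bar R) :
  (\int[lebesgue d.+1]_x f x =
   \int[pushforward (lebesgue_measure \x lebesgue d)%E (@tcons R d)]_x f x)%E.
Proof.
by apply: eq_measure_integral => [|mt A mA _]; first exact: measurable_tcons.
Qed.

Lemma ge0_integral_tcons (R : realType) d (f : d.+1.-tuple R -> \bar R) :
  measurable_fun setT f -> (forall x, 0 <= f x)%E ->
  (\int[lebesgue d.+1]_x f x =
   \int[lebesgue_measure \x lebesgue d]_p f (tcons p))%E.
Proof.
move=> mf f0; rewrite integral_lebesgueS_pushforward.
rewrite ge0_integral_pushforward//; exact: measurable_tcons.
Qed.

Lemma ge0_integral_lebesgueS (R : realType) d (f : d.+1.-tuple R -> \bar R) :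
  measurable_fun setT f -> (forall x, 0 <= f x)%E ->
  (\int[lebesgue d.+1]_x f x =
   \int[lebesgue_measure]_a \int[lebesgue d]_y f (tcons (a, y)))%E.
Proof.
move=> mf f0; rewrite ge0_integral_tcons//.
rewrite fubini_tonelli1//; apply: (measurableT_comp mf); exact: measurable_tcons.
Qed.

Lemma integrable_tcons (R : realType) d (f : d.+1.-tuple R -> \bar R) :
  (lebesgue d.+1).-integrable setT f ->
  (lebesgue_measure \x lebesgue d)%E.-integrable setT (fun p => f (tcons p)).
Proof.
move=> /integrableP[mf fi].
apply/integrableP; split; first by apply: (measurableT_comp mf); exact: measurable_tcons.
by move: fi; rewrite ge0_integral_tcons//; exact: measurableT_comp.
Qed.

Lemma integral_lebesgueS (R : realType) d (f : d.+1.-tuple R -> \bar R) :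
  (lebesgue d.+1).-integrable setT f ->
  (\int[lebesgue d.+1]_x f x =
   \int[lebesgue_measure]_a \int[lebesgue d]_y f (tcons (a, y)))%E.
Proof.
move=> fi; rewrite integral_lebesgueS_pushforward.
rewrite integral_pushforward//; last 3 first.
- exact: measurable_tcons.
- by case/integrableP: fi.
- exact: integrable_tcons.
by rewrite (integral12_prod_meas1 (integrable_tcons fi)).
Qed.

Lemma integral_lebesgue0 (R : realType) (f : 0.-tuple R -> \bar R) :
  measurable_fun setT f -> (\int[lebesgue 0]_x f x = f [tuple])%E.
Proof. by move=> mf; rewrite /= integral_dirac// diracT mul1e. Qed.

Lemma measurable_tsub (d1 : measure_display) (T : measurableType d1) (R : realType) d
    (f g : T -> d.-tuple R) :
  measurable_fun setT f -> measurable_fun setT g ->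
  measurable_fun setT (fun x => tsub (f x) (g x)).
Proof.
move=> mf mg; apply/measurable_fun_tnthP => i.
rewrite (_ : _ \o _ = (fun x => tnth (f x) i - tnth (g x) i)); last first.
  by apply/funext => x /=; rewrite tnth_mktuple.
by apply: measurable_funB; [move/measurable_fun_tnthP : mf|move/measurable_fun_tnthP : mg]; exact.
Qed.

Lemma measurable_dotp (d1 : measure_display) (T : measurableType d1) (R : realType) d
    (f g : T -> d.-tuple R) :
  measurable_fun setT f -> measurable_fun setT g ->
  measurable_fun setT (fun x => dotp (f x) (g x)).
Proof.
move=> mf mg; apply: measurable_sum => i.
by apply: measurable_funM; [move/measurable_fun_tnthP : mf|move/measurable_fun_tnthP : mg]; exact.
Qed.

Lemma measurable_tsubr (R : realType) d (x : d.-tuple R) :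
  measurable_fun setT (fun s => tsub x s).
Proof. by apply: measurable_tsub => //; exact: measurable_cst. Qed.

Lemma measurable_tconsl (R : realType) d (a : R) :
  measurable_fun setT (fun y : d.-tuple R => tcons (a, y)).
Proof.
apply: (measurableT_comp (@measurable_tcons R d)).
exact: pair1_measurable.
Qed.

(** Induction on the dimension: the first coordinate is reflected by the one-dimensional case, the
    others by the induction hypothesis. In dimension 0 there is only one tuple. *)
Lemma ge0_integral_reflect (R : realType) d (x : d.-tuple R) (f : d.-tuple R -> \bar R) :
  measurable_fun setT f -> (forall s, 0 <= f s)%E ->
  (\int[lebesgue d]_s f (tsub x s) = \int[lebesgue d]_s f s)%E.
Proof.
elim: d x f => [|d IH] x f mf f0.
  rewrite !integral_lebesgue0//; last first.
    by apply: (measurableT_comp mf); exact: measurable_tsubr.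
  by congr f; exact: tuple0.
have mfx : measurable_fun setT (fun s => f (tsub x s)).
  by apply: (measurableT_comp mf); exact: measurable_tsubr.
rewrite !ge0_integral_lebesgueS//.
(* The right-hand side is reflected in its outer variable, so that both sides can be compared slice
   by slice. *)
rewrite [RHS](_ : _ = \int[lebesgue_measure]_a (fun a => \int[lebesgue d]_y f (tcons (a, y))) (tnth x ord0 - a)%R)%E; last first.
  rewrite (@integral_reflect1 R (tnth x ord0) (fun a => \int[lebesgue d]_y f (tcons (a, y)))%E)//.
  apply: (@measurable_fun_fubini_tonelli_F _ _ _ _ _ (lebesgue d) (fun p => f (tcons p))) => //.
  by apply: measurableT_comp => //; exact: measurable_tcons.
apply: eq_integral => a _.
rewrite -[RHS](IH [tuple of behead x])//.
  apply: eq_integral => y _; congr f.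
  by rewrite [in LHS](tconsE x) tsub_tcons.
by apply: measurableT_comp => //; exact: measurable_tconsl.
Qed.

Lemma integral_reflect (R : realType) d (x : d.-tuple R) (f : d.-tuple R -> \bar R) :
  measurable_fun setT f ->
  (\int[lebesgue d]_s f (tsub x s) = \int[lebesgue d]_s f s)%E.
Proof.
move=> mf; rewrite integralE [RHS]integralE; congr (_ - _)%E.
  rewrite (funepos_comp f (fun s => tsub x s) : (fun s => f (tsub x s))^\+ = _)%E.
  by rewrite ge0_integral_reflect//; exact: measurable_funepos.
rewrite (funeneg_comp f (fun s => tsub x s) : (fun s => f (tsub x s))^\- = _)%E.
by rewrite ge0_integral_reflect//; exact: measurable_funeneg.
Qed.

Lemma measurable_prod_tnth (R : realType) d (f : 'I_d -> R -> R) :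
  (forall j, measurable_fun [set: R] (f j)) ->
  measurable_fun setT (fun x : d.-tuple R => \prod_(j < d) f j (tnth x j)).
Proof.
move=> mf; apply: measurable_prod => j _.
by apply: (measurableT_comp (mf j)); exact: measurable_tnth.
Qed.

Lemma integral_prod_tnth (R : realType) d (f : 'I_d -> R -> R) :
  (forall j, measurable_fun [set: R] (f j)) -> (forall j x, 0 <= f j x) ->
  (\int[lebesgue d]_x (\prod_(j < d) f j (tnth x j))%:E =
   \prod_(j < d) \int[lebesgue_measure]_t (f j t)%:E)%E.
Proof.
elim: d f => [|d IH] f mf f0.
  rewrite integral_lebesgue0 ?big_ord0//.
  by apply/measurable_EFinP; exact: measurable_prod_tnth.
rewrite ge0_integral_lebesgueS; last 2 first.
- by apply/measurable_EFinP; exact: measurable_prod_tnth.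
- by move=> x; rewrite lee_fin prodr_ge0.
rewrite big_ord_recl -(IH (fun j => f (lift ord0 j)))//.
have mp := @measurable_prod_tnth R d (fun j => f (lift ord0 j)) (fun j => mf (lift ord0 j)).
rewrite muleC -ge0_integralZl//; last 3 first.
- by apply/measurable_EFinP; exact: mf.
- by move=> x _; rewrite lee_fin.
- by apply: integral_ge0 => x _; rewrite lee_fin prodr_ge0.
apply: eq_integral => a _.
rewrite muleC -ge0_integralZl//; last 3 first.
- exact/measurable_EFinP.
- by move=> x _; rewrite lee_fin prodr_ge0.
- by rewrite lee_fin.
apply: eq_integral => y _; rewrite big_ord_recl tnth_tcons0 EFinM; congr (_ * _%:E)%E.
by apply: eq_bigr => j _; rewrite tnth_tconsS.
Qed.

(** * Fubini for real-valued integrals, and integrals against kernels *)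

Lemma measurable_section1 d1 d2 d3 (T1 : measurableType d1) (T2 : measurableType d2)
    (T3 : measurableType d3) (k : T1 * T2 -> T3) (x : T1) :
  measurable_fun setT k -> measurable_fun setT (fun y => k (x, y)).
Proof. by move=> mk; apply: (measurableT_comp mk); exact: pair1_measurable. Qed.

Lemma measurable_section2 d1 d2 d3 (T1 : measurableType d1) (T2 : measurableType d2)
    (T3 : measurableType d3) (k : T1 * T2 -> T3) (y : T2) :
  measurable_fun setT k -> measurable_fun setT (fun x => k (x, y)).
Proof. by move=> mk; apply: (measurableT_comp mk); exact: pair2_measurable. Qed.

(** An integrable function is finite almost everywhere, so [fine] changes it only on a null set.
    This turns the extended-real partial integrals of Fubini into the real ones of [Rintegral]. *)
Lemma integrable_fine d (T : measurableType d) (R : realType)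
    (mu : {measure set T -> \bar R}) (f : T -> \bar R) :
  mu.-integrable setT f ->
  mu.-integrable setT (EFin \o (fun x => fine (f x))) /\
  (\int[mu]_x (fine (f x))%:E = \int[mu]_x f x)%E.
Proof.
move=> intf; have mf := measurable_int _ intf.
have mff : measurable_fun setT (EFin \o (fun x => fine (f x))).
  by apply/measurable_EFinP; exact: measurableT_comp.
split.
  apply: le_integrable intf => // x _ /=.
  by case: (f x) => [r| |] //=; rewrite normr0 leey.
apply: ae_eq_integral => //.
have := integrable_ae measurableT intf; apply: filterS => x /= + _.
by move=> /(_ I) /fineK.
Qed.

(** Tonelli makes the integrals of the positive and negative parts measurable separately; their
    extended difference and then [fine] preserve measurability even where both are infinite. *)
Lemma measurable_Rintegral_section d1 d2 (T1 : measurableType d1) (T2 : measurableType d2)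
    (R : realType) (m2 : {sigma_finite_measure set T2 -> \bar R}) (F : T1 * T2 -> R) :
  measurable_fun setT F ->
  measurable_fun setT (fun x => \int[m2]_y F (x, y)).
Proof.
move=> mF; rewrite /Rintegral; apply: measurableT_comp => //.
under eq_fun do rewrite integralE.
apply: emeasurable_funB.
  rewrite (_ : (fun x => _) = fubini_F m2 ((EFin \o F)^\+)%E); last first.
    apply/funext => x; apply: eq_integral => y _.
    by rewrite (funepos_comp (EFin \o F) (fun y => (x, y))).
  apply: measurable_fun_fubini_tonelli_F => //.
  by apply: measurable_funepos; exact/measurable_EFinP.
rewrite (_ : (fun x => _) = fubini_F m2 ((EFin \o F)^\-)%E); last first.
    apply/funext => x; apply: eq_integral => y _.
    by rewrite (funeneg_comp (EFin \o F) (fun y => (x, y))).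
  apply: measurable_fun_fubini_tonelli_F => //.
by apply: measurable_funeneg; exact/measurable_EFinP.
Qed.

Lemma Rintegral12 d1 d2 (T1 : measurableType d1) (T2 : measurableType d2)
    (R : realType) (m1 : {sigma_finite_measure set T1 -> \bar R})
    (m2 : {sigma_finite_measure set T2 -> \bar R}) (F : T1 * T2 -> R) :
  (m1 \x m2)%E.-integrable setT (EFin \o F) ->
  \int[m1]_x \int[m2]_y F (x, y) = \int[(m1 \x m2)%E]_p F p.
Proof.
move=> iF; rewrite /Rintegral; congr fine.
by rewrite -(integral12_prod_meas1 iF) (integrable_fine (integrable_fubini_F iF)).2.
Qed.

Lemma integrable_fubini_G d1 d2 (T1 : measurableType d1) (T2 : measurableType d2)
    (R : realType) (m1 : {sigma_finite_measure set T1 -> \bar R})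
    (m2 : {sigma_finite_measure set T2 -> \bar R}) (F : T1 * T2 -> \bar R) :
  (m1 \x m2)%E.-integrable setT F -> m2.-integrable setT (fubini_G m1 F).
Proof.
move=> iF; have mF := measurable_int _ iF.
have mA := @measurable_fun_fubini_tonelli_G _ _ _ _ _ m1 (abse \o F)
   (measurableT_comp (@abse_measurable _ _) mF) (fun=> abse_ge0 _).
apply/integrableP; split; first exact: (measurable_fubini_G iF).
have := (integrable21ltyP m1 m2 mF).1 iF; apply: le_lt_trans.
apply: ge0_le_integral => //.
- by apply: measurableT_comp => //; exact: (measurable_fubini_G iF).
- move=> y _; apply: le_abse_integral => //.
  exact: measurable_section2.
Qed.

Lemma Rintegral21 d1 d2 (T1 : measurableType d1) (T2 : measurableType d2)
    (R : realType) (m1 : {sigma_finite_measure set T1 -> \bar R})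
    (m2 : {sigma_finite_measure set T2 -> \bar R}) (F : T1 * T2 -> R) :
  (m1 \x m2)%E.-integrable setT (EFin \o F) ->
  \int[m2]_y \int[m1]_x F (x, y) = \int[(m1 \x m2)%E]_p F p.
Proof.
move=> iF; rewrite /Rintegral; congr fine.
by rewrite -(integral21_prod_meas1 iF) (integrable_fine (integrable_fubini_G iF)).2.
Qed.

Lemma integrable_tensor d1 d2 (T1 : measurableType d1) (T2 : measurableType d2)
    (R : realType) (m1 : {sigma_finite_measure set T1 -> \bar R})
    (m2 : {sigma_finite_measure set T2 -> \bar R}) (a : T1 -> R) (b : T2 -> R) :
  m1.-integrable setT (EFin \o a) -> m2.-integrable setT (EFin \o b) ->
  (m1 \x m2)%E.-integrable setT (EFin \o (fun p => a p.1 * b p.2)).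
Proof.
move=> ia ib.
have ma : measurable_fun setT a by apply/measurable_EFinP; exact: measurable_int ia.
have mb : measurable_fun setT b by apply/measurable_EFinP; exact: measurable_int ib.
have mab : measurable_fun setT (EFin \o (fun p : T1 * T2 => a p.1 * b p.2)).
  apply/measurable_EFinP; apply: measurable_funM.
    by apply: (measurableT_comp ma); exact: measurable_fst.
  by apply: (measurableT_comp mb); exact: measurable_snd.
apply/(integrable12ltyP m1 m2 mab).
under eq_integral.
  move=> x _.
  rewrite (_ : (\int[m2]_y _)%E = (`|a x|%:E * \int[m2]_y `|b y|%:E)%E); last first.
    rewrite -ge0_integralZl//; last by apply/measurable_EFinP; exact: measurableT_comp.
    by apply: eq_integral => y _ /=; rewrite normrM EFinM.
  over.
have /integrableP[_ ib'] := ib; have /integrableP[_ ia'] := ia.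
rewrite ge0_integralZr//; last 2 first.
- by apply/measurable_EFinP; exact: measurableT_comp.
- by apply: integral_ge0.
by rewrite lte_mul_pinfty// ?ge0_fin_numE ?integral_ge0.
Qed.

Lemma integrable_tensor_kernel d1 d2 (T1 : measurableType d1) (T2 : measurableType d2)
    (R : realType) (m1 : {sigma_finite_measure set T1 -> \bar R})
    (m2 : {sigma_finite_measure set T2 -> \bar R}) (a : T1 -> R) (b : T2 -> R)
    (k : T1 * T2 -> R) (C : R) :
  m1.-integrable setT (EFin \o a) -> m2.-integrable setT (EFin \o b) ->
  measurable_fun setT k -> (forall p, `|k p| <= C) ->
  (m1 \x m2)%E.-integrable setT (EFin \o (fun p => a p.1 * b p.2 * k p)).
Proof.
by move=> ia ib mk kC; apply: integrable_mulr_bounded (integrable_tensor ia ib) mk kC.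
Qed.

(** A bounded kernel keeps the integrable product a(x) b(y) integrable, so Fubini applies. With k =
    [cas] this is the symmetry of the Hartley transform. *)
Lemma Rintegral_kernel_swap d1 d2 (T1 : measurableType d1) (T2 : measurableType d2)
    (R : realType) (m1 : {sigma_finite_measure set T1 -> \bar R})
    (m2 : {sigma_finite_measure set T2 -> \bar R}) (a : T1 -> R) (b : T2 -> R)
    (k : T1 * T2 -> R) (C : R) :
  m1.-integrable setT (EFin \o a) -> m2.-integrable setT (EFin \o b) ->
  measurable_fun setT k -> (forall p, `|k p| <= C) ->
  \int[m1]_x (a x * \int[m2]_y (b y * k (x, y))) =
  \int[m2]_y (b y * \int[m1]_x (a x * k (x, y))).
Proof.
move=> ia ib mk kC.
have iF := integrable_tensor_kernel ia ib mk kC.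
transitivity (\int[m1]_x \int[m2]_y (a x * b y * k (x, y))).
  apply: eq_Rintegral => x _; rewrite -RintegralZl//.
    by apply: eq_Rintegral => y _; rewrite mulrA.
  by apply: (integrable_mulr_bounded (C := C)) => //; exact: measurable_section1.
rewrite (Rintegral12 iF) -(Rintegral21 iF).
apply: eq_Rintegral => y _; rewrite -RintegralZl//.
  by apply: eq_Rintegral => x _ /=; ring.
by apply: (integrable_mulr_bounded (C := C)) => //; exact: measurable_section2.
Qed.

(* Schur's test in its AM-GM form. *)
Lemma integral_kernel_AMGM d1 d2 (T1 : measurableType d1) (T2 : measurableType d2)
    (R : realType) (m1 : {sigma_finite_measure set T1 -> \bar R})
    (m2 : {sigma_finite_measure set T2 -> \bar R}) (a : T1 -> R) (b : T2 -> R)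
    (k : T1 * T2 -> R) :
  measurable_fun setT a -> measurable_fun setT b -> measurable_fun setT k ->
  (forall x, 0 <= a x) -> (forall y, 0 <= b y) -> (forall p, 0 <= k p) ->
  (2%:E * \int[m1]_x \int[m2]_y (a x * b y * k (x, y))%:E <=
   \int[m1]_x ((a x ^+ 2)%:E * \int[m2]_y (k (x, y))%:E) +
   \int[m2]_y ((b y ^+ 2)%:E * \int[m1]_x (k (x, y))%:E))%E.
Proof.
move=> ma mb mk a0 b0 k0.
have ma2 : measurable_fun setT (fun p : T1 * T2 => a p.1).
  by apply: (measurableT_comp ma); exact: measurable_fst.
have mb2 : measurable_fun setT (fun p : T1 * T2 => b p.2).
  by apply: (measurableT_comp mb); exact: measurable_snd.
have mF1 : measurable_fun setT (fun p => (a p.1 * b p.2 * k p)%:E).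
  by apply/measurable_EFinP; do 2 apply: measurable_funM => //.
have mF2 : measurable_fun setT (fun p => (a p.1 ^+ 2 * k p)%:E).
  by apply/measurable_EFinP; apply: measurable_funM => //; exact: measurable_funX.
have mF3 : measurable_fun setT (fun p => (b p.2 ^+ 2 * k p)%:E).
  by apply/measurable_EFinP; apply: measurable_funM => //; exact: measurable_funX.
have F10 p : (0 <= (a p.1 * b p.2 * k p)%:E)%E by rewrite lee_fin !mulr_ge0.
have F20 p : (0 <= (a p.1 ^+ 2 * k p)%:E)%E by rewrite lee_fin !mulr_ge0.
have F30 p : (0 <= (b p.2 ^+ 2 * k p)%:E)%E by rewrite lee_fin !mulr_ge0.
have -> : (\int[m1]_x ((a x ^+ 2)%:E * \int[m2]_y (k (x, y))%:E) =
    \int[(m1 \x m2)%E]_p (a p.1 ^+ 2 * k p)%:E)%E.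
  rewrite (fubini_tonelli1 _ mF2)//; apply: eq_integral => x _.
  rewrite -ge0_integralZl//; last 3 first.
  - by apply/measurable_EFinP; exact: measurable_section1.
  - by move=> y _; rewrite lee_fin.
  - by rewrite lee_fin sqr_ge0.
have -> : (\int[m2]_y ((b y ^+ 2)%:E * \int[m1]_x (k (x, y))%:E) =
    \int[(m1 \x m2)%E]_p (b p.2 ^+ 2 * k p)%:E)%E.
  rewrite (fubini_tonelli1 _ mF3)// (fubini_tonelli _ mF3)//; apply: eq_integral => y _.
  rewrite -ge0_integralZl//; last 3 first.
  - by apply/measurable_EFinP; exact: measurable_section2.
  - by move=> x _; rewrite lee_fin.
  - by rewrite lee_fin sqr_ge0.
have -> : (\int[m1]_x \int[m2]_y (a x * b y * k (x, y))%:E =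
    \int[(m1 \x m2)%E]_p (a p.1 * b p.2 * k p)%:E)%E.
  by rewrite (fubini_tonelli1 _ mF1).
rewrite -ge0_integralZl//.
rewrite -ge0_integralD//.
apply: ge0_le_integral => //.
- by move=> p _; rewrite mule_ge0// lee_fin.
- by apply: measurable_funeM.
- exact: emeasurable_funD.
- move=> p _; rewrite -EFinM -EFinD lee_fin.
  have := k0 p; have := sqr_ge0 (a p.1 - b p.2).
  set A := a _; set B := b _; set K := k _ => h1 h2.
  have := mulr_ge0 h2 h1; lra.
Qed.

(** * Product weights, product Poisson kernels and the Hartley kernel *)

Lemma dotpDtsubr (R : realType) d (u x y : d.-tuple R) :
  dotp u (tsub x y) = dotp u x - dotp u y.
Proof.
rewrite /dotp -sumrB; apply: eq_bigr => j _.
by rewrite tnth_mktuple mulrBr.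
Qed.

(** Negation is written as a reflection at 0, so that [integral_reflect] applies to it directly. *)
Definition topp {R : realType} {d} (x : d.-tuple R) : d.-tuple R := tsub [tuple 0 | _ < d] x.

Lemma tnth_topp (R : realType) d (x : d.-tuple R) j : tnth (topp x) j = - tnth x j.
Proof. by rewrite !tnth_mktuple sub0r. Qed.

Lemma dotpNr (R : realType) d (u x : d.-tuple R) : dotp u (topp x) = - dotp u x.
Proof. by rewrite /dotp -sumrN; apply: eq_bigr => j _; rewrite tnth_topp mulrN. Qed.

Lemma dotpC (R : realType) d (u x : d.-tuple R) : dotp u x = dotp x u.
Proof. by apply: eq_bigr => j _; rewrite mulrC. Qed.

(** The exponent is the l^1 norm rather than the Euclidean one, which is what makes the transform a
    product. [kern] below is accordingly not the radial Poisson kernel. *)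
Definition wt {R : realType} {d} (e : R) (u : d.-tuple R) : R := \prod_(j < d) expw e (tnth u j).

Definition kern {R : realType} {d} (e : R) (t : d.-tuple R) : R := \prod_(j < d) pker e (tnth t j).

Lemma wt_ge0 (R : realType) d (e : R) (u : d.-tuple R) : 0 <= wt e u.
Proof. by apply: prodr_ge0 => j _; exact: expw_ge0. Qed.

Lemma kern_ge0 (R : realType) d (e : R) (t : d.-tuple R) : 0 < e -> 0 <= kern e t.
Proof. by move=> e0; apply: prodr_ge0 => j _; exact: pker_ge0. Qed.

Lemma measurable_wt (R : realType) d (e : R) : measurable_fun setT (@wt R d e).
Proof. by apply: (@measurable_prod_tnth R d (fun=> expw e)) => j; exact: measurable_expw. Qed.

Lemma measurable_kern (R : realType) d (e : R) : 0 < e -> measurable_fun setT (@kern R d e).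
Proof. by move=> e0; apply: (@measurable_prod_tnth R d (fun=> pker e)) => j; exact: measurable_pker. Qed.

Lemma kern_tsubC (R : realType) d (e : R) (x y : d.-tuple R) : kern e (tsub x y) = kern e (tsub y x).
Proof. by apply: eq_bigr => j _; rewrite !tnth_mktuple -pkerN opprB. Qed.

Lemma pker_le (R : realType) (e t : R) : 0 < e -> pker e t <= 2 / e.
Proof.
move=> e0; rewrite /pker ler_pdivrMr ?ltr_wpDr ?sqr_ge0 ?exprn_gt0//.
rewrite mulrDr -[leLHS]addr0 lerD//.
  by rewrite expr2 mulrA divfK ?gt_eqF.
by rewrite mulr_ge0 ?sqr_ge0// divr_ge0// ltW.
Qed.

Lemma kern_le (R : realType) d (e : R) (t : d.-tuple R) : 0 < e -> `|kern e t| <= (2 / e) ^+ d.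
Proof.
move=> e0; rewrite ger0_norm ?kern_ge0//.
rewrite -[X in _ ^+ X]card_ord -prodr_const; apply: ler_prod => j _.
by rewrite pker_ge0// pker_le.
Qed.

Lemma integral_kern (R : realType) d (e : R) : 0 < e ->
  (\int[lebesgue d]_t (kern e t)%:E = ((2 * pi) ^+ d)%:E)%E.
Proof.
move=> e0; rewrite (@integral_prod_tnth R d (fun=> pker e))//; last 2 first.
- by move=> _; exact: measurable_pker.
- by move=> _ t; exact: pker_ge0.
under eq_bigr do rewrite integral_pker//.
by rewrite prodEFin prodr_const card_ord.
Qed.

Lemma integral_kern_tsub (R : realType) d (e : R) (x : d.-tuple R) : 0 < e ->
  (\int[lebesgue d]_y (kern e (tsub x y))%:E = ((2 * pi) ^+ d)%:E)%E.
Proof.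
move=> e0; rewrite (ge0_integral_reflect x (f := fun t => (kern e t)%:E)) ?integral_kern//.
  by apply/measurable_EFinP; exact: measurable_kern.
by move=> t; rewrite lee_fin kern_ge0.
Qed.

Lemma integrable_wt (R : realType) d (e : R) : 0 < e ->
  (lebesgue d).-integrable setT (EFin \o @wt R d e).
Proof.
move=> e0; apply/integrableP; split; first by apply/measurable_EFinP; exact: measurable_wt.
under eq_integral do rewrite gee0_abs ?lee_fin ?wt_ge0//.
rewrite (@integral_prod_tnth R d (fun=> expw e))//; last 2 first.
- by move=> _; exact: measurable_expw.
- by move=> _ t; exact: expw_ge0.
under eq_bigr do rewrite integral_expw//.
by rewrite prodEFin ltry.
Qed.

Lemma wt_tcons (R : realType) d (e a : R) (y : d.-tuple R) : wt e (tcons (a, y)) = expw e a * wt e y.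
Proof. by rewrite /wt big_ord_recl; congr (_ * _); apply: eq_bigr => j _; rewrite tnth_tconsS. Qed.

Lemma kern_tcons (R : realType) d (e a : R) (y : d.-tuple R) : kern e (tcons (a, y)) = pker e a * kern e y.
Proof. by rewrite /kern big_ord_recl; congr (_ * _); apply: eq_bigr => j _; rewrite tnth_tconsS. Qed.

Lemma normr_cos_le1 (R : realType) (x : R) : `|cos x| <= 1.
Proof. by rewrite ler_norml cos_geN1 cos_le1. Qed.

Lemma normr_sin_le1 (R : realType) (x : R) : `|sin x| <= 1.
Proof. by rewrite ler_norml sin_geN1 sin_le1. Qed.

Lemma measurable_cos_dotp (R : realType) d (t : d.-tuple R) :
  measurable_fun setT (fun u : d.-tuple R => cos (dotp u t)).
Proof.
by apply: (measurableT_comp (@measurable_cos R)); apply: measurable_dotp => //; exact: measurable_cst.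
Qed.

Lemma measurable_sin_dotp (R : realType) d (t : d.-tuple R) :
  measurable_fun setT (fun u : d.-tuple R => sin (dotp u t)).
Proof.
by apply: (measurableT_comp (@measurable_sin R)); apply: measurable_dotp => //; exact: measurable_cst.
Qed.

Lemma Rintegral_lebesgueS (R : realType) d (f : d.+1.-tuple R -> R) :
  (lebesgue d.+1).-integrable setT (EFin \o f) ->
  \int[lebesgue d.+1]_x f x = \int[lebesgue_measure]_a \int[lebesgue d]_y f (tcons (a, y)).
Proof.
move=> fi; rewrite (Rintegral12 (integrable_tcons fi)) /Rintegral; congr fine.
by rewrite (integral_lebesgueS fi) (integral12_prod_meas1 (integrable_tcons fi)).
Qed.

(** These are the real and imaginary parts of the Fourier transform of [wt e]. They are proved
    together because the addition formulas mix them in the induction; the sine of a single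
    coordinate integrates to 0. *)
Lemma Rintegral_wt_trig (R : realType) d (e : R) (t : d.-tuple R) : 0 < e ->
  \int[lebesgue d]_u (wt e u * cos (dotp u t)) = kern e t /\
  \int[lebesgue d]_u (wt e u * sin (dotp u t)) = 0.
Proof.
move=> e0.
have ic n (s : n.-tuple R) : (lebesgue n).-integrable setT (EFin \o (fun u => wt e u * cos (dotp u s))).
  apply: (integrable_mulr_bounded (C := 1)); first exact: integrable_wt.
    exact: measurable_cos_dotp.
  by move=> u; exact: normr_cos_le1.
have isn n (s : n.-tuple R) : (lebesgue n).-integrable setT (EFin \o (fun u => wt e u * sin (dotp u s))).
  apply: (integrable_mulr_bounded (C := 1)); first exact: integrable_wt.
    exact: measurable_sin_dotp.
  by move=> u; exact: normr_sin_le1.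
have ic1 (s : R) : lebesgue_measure.-integrable setT (EFin \o (fun u => expw e u * cos (s * u))).
  apply: (integrable_mulr_bounded (C := 1)); first exact: integrable_expw.
    by apply: measurableT_comp; [exact: measurable_cos|exact: measurable_funM].
  by move=> u; exact: normr_cos_le1.
have is1 (s : R) : lebesgue_measure.-integrable setT (EFin \o (fun u => expw e u * sin (s * u))).
  apply: (integrable_mulr_bounded (C := 1)); first exact: integrable_expw.
    by apply: measurableT_comp; [exact: measurable_sin|exact: measurable_funM].
  by move=> u; exact: normr_sin_le1.
elim: d t => [|d IH] t.
  rewrite /Rintegral !integral_lebesgue0; last 2 first.
  - by have := isn 0%N t; exact: measurable_int.
  - by have := ic 0%N t; exact: measurable_int.
  by rewrite /wt /kern /dotp !big_ord0 cos0 sin0 mulr1 mulr0.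
have [IHc IHs] := IH [tuple of behead t].
rewrite (Rintegral_lebesgueS (ic _ t)) (Rintegral_lebesgueS (isn _ t)).
have E u (y : d.-tuple R) : dotp (tcons (u, y)) t = tnth t ord0 * u + dotp y [tuple of behead t].
  by rewrite [in LHS](tconsE t) dotp_tcons mulrC.
split.
  transitivity (\int[lebesgue_measure]_a (expw e a * cos (tnth t ord0 * a) * kern e [tuple of behead t])).
    apply: eq_Rintegral => a _.
    transitivity (\int[lebesgue d]_y (expw e a * cos (tnth t ord0 * a) * (wt e y * cos (dotp y [tuple of behead t]))
        - expw e a * sin (tnth t ord0 * a) * (wt e y * sin (dotp y [tuple of behead t])))).
      by apply: eq_Rintegral => y _; rewrite E wt_tcons cosD; ring.
    rewrite RintegralB//; last 2 first.
    - exact: (integrableZl measurableT _ (ic _ _)).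
    - exact: (integrableZl measurableT _ (isn _ _)).
    by rewrite !RintegralZl// IHc IHs mulr0 subr0.
  by rewrite RintegralZr// Rintegral_expw_cos// -kern_tcons -tconsE.
transitivity (\int[lebesgue_measure]_a (expw e a * sin (tnth t ord0 * a) * kern e [tuple of behead t])).
  apply: eq_Rintegral => a _.
  transitivity (\int[lebesgue d]_y (expw e a * sin (tnth t ord0 * a) * (wt e y * cos (dotp y [tuple of behead t]))
      + expw e a * cos (tnth t ord0 * a) * (wt e y * sin (dotp y [tuple of behead t])))).
    by apply: eq_Rintegral => y _; rewrite E wt_tcons sinD; ring.
  rewrite RintegralD//; last 2 first.
  - exact: (integrableZl measurableT _ (ic _ _)).
  - exact: (integrableZl measurableT _ (isn _ _)).
  by rewrite !RintegralZl// IHc IHs mulr0 addr0.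
by rewrite RintegralZr// Rintegral_expw_sin// mul0r.
Qed.

(* The Hartley kernel, a real substitute for the Fourier kernel. *)
Definition cas {R : realType} {d} (u x : d.-tuple R) : R := cos (dotp u x) + sin (dotp u x).

Lemma casC (R : realType) d (u x : d.-tuple R) : cas u x = cas x u.
Proof. by rewrite /cas dotpC. Qed.

Lemma normr_cas_le2 (R : realType) d (u x : d.-tuple R) : `|cas u x| <= 2.
Proof.
by rewrite (le_trans (ler_normD _ _))// (_ : 2 = 1 + 1)// lerD ?normr_cos_le1 ?normr_sin_le1.
Qed.

Lemma measurable_cas (R : realType) d :
  measurable_fun setT (fun p : d.-tuple R * d.-tuple R => cas p.1 p.2).
Proof.
have md : measurable_fun setT (fun p : d.-tuple R * d.-tuple R => dotp p.1 p.2).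
  by apply: measurable_dotp; [exact: measurable_fst|exact: measurable_snd].
apply: measurable_funD.
  exact: (measurableT_comp (@measurable_cos R)).
exact: (measurableT_comp (@measurable_sin R)).
Qed.

(** cas(a) cas(b) = cos(a - b) + sin(a + b), and the sine part integrates to 0. The sum x + y
    appears as [tsub x (topp y)]. *)
Lemma Rintegral_wt_cas_cas (R : realType) d (e : R) (x y : d.-tuple R) : 0 < e ->
  \int[lebesgue d]_u (wt e u * cas u x * cas u y) = kern e (tsub x y).
Proof.
move=> e0.
transitivity (\int[lebesgue d]_u (wt e u * cos (dotp u (tsub x y)) + wt e u * sin (dotp u (tsub x (topp y))))).
  apply: eq_Rintegral => u _; rewrite 2!dotpDtsubr dotpNr cosB opprK sinD /cas; ring.
rewrite RintegralD//; last 2 first.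
- apply: (integrable_mulr_bounded (C := 1)); first exact: integrable_wt.
    exact: measurable_cos_dotp.
  by move=> u; exact: normr_cos_le1.
- apply: (integrable_mulr_bounded (C := 1)); first exact: integrable_wt.
    exact: measurable_sin_dotp.
  by move=> u; exact: normr_sin_le1.
by rewrite (Rintegral_wt_trig _ e0).1 (Rintegral_wt_trig _ e0).2 addr0.
Qed.

(** * Mass carried by the Poisson kernel out of an interval *)

Lemma indic_ge0 (R : realType) (T : Type) (A : set T) (x : T) : 0 <= \1_A x :> R.
Proof. by rewrite indicE. Qed.

Lemma indic_le1 (R : realType) (T : Type) (A : set T) (x : T) : \1_A x <= 1 :> R.
Proof. by rewrite indicE; case: (_ \in _). Qed.

Lemma measurable_pker_sub (R : realType) (e : R) : 0 < e ->
  measurable_fun setT (fun p : R * R => pker e (p.1 - p.2)).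
Proof.
move=> e0; apply: (measurableT_comp (measurable_pker e0)).
by apply: measurable_funB; [exact: measurable_fst|exact: measurable_snd].
Qed.

Lemma integral_pker_sub (R : realType) (e x : R) : 0 < e ->
  (\int[lebesgue_measure]_y (pker e (x - y))%:E = (2 * pi)%:E)%E.
Proof.
move=> e0; rewrite -(integral_pker e0) -[RHS](@integral_reflect1 R x (fun t => (pker e t)%:E))//.
by apply/measurable_EFinP; exact: measurable_pker.
Qed.

Lemma measurable_pker_subr (R : realType) (e x : R) : 0 < e ->
  measurable_fun [set: R] (fun y => pker e (x - y)).
Proof.
move=> e0; apply: (measurableT_comp (measurable_pker e0)).
exact: measurable_funB.
Qed.

(** For indicators this is the mass that the kernel carries between two sets. *)
Definition Kint1 {R : realType} (e : R) (f g : R -> R) : \bar R :=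
  (\int[lebesgue_measure]_a \int[lebesgue_measure]_b (f a * g b * pker e (a - b))%:E)%E.

(** If x lies in the interval and y outside, then either |x - y| >= del and the tail bound applies,
    or x is within del of the endpoint that separates it from y. The two end intervals pay for the
    second case. *)
Lemma interval_kernel_le (R : realType) (a b e del x y : R) : 0 < e -> 0 < del ->
  \1_`[a, b[ x * \1_(~` `[a, b[) y * pker e (x - y) <=
  (\1_`[a, a + del] x + \1_`[b - del, b] x) * pker e (x - y) +
  (\1_`[a, b[ x * (e * (1 + del ^- 2))) * pker 1 (x - y).
Proof.
move=> e0 d0; have k0 := pker_ge0 (x - y) e0; have k10 := pker_ge0 (x - y) (@ltr01 R).
have E0 : 0 <= e * (1 + del ^- 2) by rewrite mulr_ge0 ?(ltW e0)// addr_ge0// invr_ge0 sqr_ge0.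
have rhs0 : 0 <= (\1_`[a, a + del] x + \1_`[b - del, b] x) * pker e (x - y) +
  (\1_`[a, b[ x * (e * (1 + del ^- 2))) * pker 1 (x - y).
  by rewrite addr_ge0// mulr_ge0// ?addr_ge0 ?indic_ge0// mulr_ge0// indic_ge0.
have [xI|xI] := boolP (x \in `[a, b[%classic); last first.
  by rewrite [X in X * _ * _ <= _]indicE (negbTE xI) !mul0r.
have [yI|yI] := boolP (y \in ~` `[a, b[%classic); last first.
  by rewrite [X in _ * X * _ <= _]indicE (negbTE yI) mulr0 mul0r.
have [xya|xya] := leP del `|x - y|.
  have := pker_tail e0 d0 xya => h.
  rewrite [X in _ <= _ + X * _ * _]indicE [X in X * _ * _ <= _]indicE [X in _ * X * _ <= _]indicE xI yI !mul1r.
  apply: (le_trans h); rewrite lerDr mulr_ge0// addr_ge0 ?indic_ge0//.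
have hJ : 1 <= \1_`[a, a + del] x + \1_`[b - del, b] x :> R.
  move: xI yI xya; rewrite !inE/= !in_itv/= ltr_norml => /andP[ax xb] yI /andP[h1 h2].
  have [ya|ya] := ltP y a.
    rewrite -[leLHS]addr0 lerD ?indic_ge0// indicE mem_set//= in_itv/=.
    by apply/andP; split => //; lra.
  have by_ : b <= y by rewrite leNgt; apply/negP => yb; apply: yI; rewrite ya yb.
  rewrite -[leLHS]add0r lerD ?indic_ge0//.
  rewrite [leRHS]indicE mem_set//= in_itv/=.
  by apply/andP; split; lra.
apply: (@le_trans _ _ (1 * pker e (x - y))).
  by rewrite ler_wpM2r// mulr_ile1 ?indic_ge0 ?indic_le1.
apply: (@le_trans _ _ ((\1_`[a, a + del] x + \1_`[b - del, b] x) * pker e (x - y))).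
  by rewrite ler_wpM2r.
by rewrite lerDl mulr_ge0// mulr_ge0// indic_ge0.
Qed.

(** The absolute value also covers b < a, where the interval is empty. *)
Lemma integral_indic_itv (R : realType) (a b c : R) (b0 b1 : bool) : 0 <= c ->
  (\int[lebesgue_measure]_x (\1_[set` Interval (BSide b0 a) (BSide b1 b)] x * c)%:E <= (`|b - a| * c)%:E)%E.
Proof.
move=> c0; under eq_integral do rewrite EFinM.
rewrite ge0_integralZr//; last by apply/measurable_EFinP; exact: measurable_indic.
rewrite integral_indic// setIT EFinM lee_pmul//.
apply: (@le_trans _ _ (lebesgue_measure [set` Interval (BSide b0 a) (BSide b1 b)])) => //.
rewrite lebesgue_measure_itv/=; case: ifP => _; last by rewrite lee_fin.
by rewrite -EFinB lee_fin ler_norm.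
Qed.

(** The two end intervals have length [del] each, and the kernels [pker e] and [pker 1] both have
    total mass 2 pi. The second summand vanishes with [e], after which [del] may be taken small. *)
Lemma Kint1_interval (R : realType) (a b e del : R) : 0 < e -> 0 < del ->
  (Kint1 e \1_`[a, b[ \1_(~` `[a, b[) <=
   ((2 * del + `|b - a| * (e * (1 + del ^- 2))) * (2 * pi))%:E)%E.
Proof.
move=> e0 d0.
have E0 : 0 <= e * (1 + del ^- 2) by rewrite mulr_ge0 ?(ltW e0)// addr_ge0// invr_ge0 sqr_ge0.
have p0 : 0 <= 2 * pi :> R by rewrite mulr_ge0// pi_ge0.
have mI (A : set R) : measurable A -> measurable_fun [set: R] (\1_A : R -> R) by move=> mA; exact: measurable_indic.
pose c1 (x : R) : R := \1_`[a, a + del] x + \1_`[b - del, b] x.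
pose c2 (x : R) : R := \1_`[a, b[ x * (e * (1 + del ^- 2)).
have c10 x : 0 <= c1 x by rewrite addr_ge0 ?indic_ge0.
have c20 x : 0 <= c2 x by rewrite mulr_ge0 ?indic_ge0.
have mc1 : measurable_fun [set: R] c1 by apply: measurable_funD; exact: mI.
have mc2 : measurable_fun [set: R] c2 by apply: measurable_funM => //; exact: mI.
have inner x : (\int[lebesgue_measure]_y (\1_`[a, b[ x * \1_(~` `[a, b[) y * pker e (x - y))%:E <=
    ((c1 x + c2 x) * (2 * pi))%:E)%E.
  apply: (@le_trans _ _ (\int[lebesgue_measure]_y ((c1 x)%:E * (pker e (x - y))%:E + (c2 x)%:E * (pker 1 (x - y))%:E))%E).
    apply: ge0_le_integral => //.
    - by move=> y _; rewrite lee_fin; apply: mulr_ge0; [apply: mulr_ge0; exact: indic_ge0|exact: pker_ge0].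
    - apply/measurable_EFinP; apply: measurable_funM; last exact: measurable_pker_subr.
      by apply: measurable_funM => //; apply: mI; exact: measurableC.
    - apply: emeasurable_funD; apply: measurable_funeM; apply/measurable_EFinP;
      exact: measurable_pker_subr.
    - by move=> y _; rewrite -!EFinM -EFinD lee_fin; exact: interval_kernel_le.
  rewrite ge0_integralD//; last 4 first.
  - by move=> y _; rewrite -EFinM lee_fin mulr_ge0 ?pker_ge0.
  - by apply: measurable_funeM; apply/measurable_EFinP; exact: measurable_pker_subr.
  - by move=> y _; rewrite -EFinM lee_fin mulr_ge0 ?pker_ge0.
  - by apply: measurable_funeM; apply/measurable_EFinP; exact: measurable_pker_subr.
  rewrite !ge0_integralZl ?lee_fin//; last 4 first.
  - by apply/measurable_EFinP; exact: measurable_pker_subr.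
  - by move=> y _; rewrite lee_fin pker_ge0.
  - by apply/measurable_EFinP; exact: measurable_pker_subr.
  - by move=> y _; rewrite lee_fin pker_ge0.
  rewrite (integral_pker_sub x e0).
  rewrite (integral_pker_sub x ltr01).
  rewrite -!EFinM -EFinD lee_fin.
  by rewrite -mulrDl.
apply: (@le_trans _ _ (\int[lebesgue_measure]_x ((c1 x + c2 x) * (2 * pi))%:E)%E).
  apply: ge0_le_integral => //.
  - by move=> x _; apply: integral_ge0 => y _; rewrite lee_fin; apply: mulr_ge0; [apply: mulr_ge0; exact: indic_ge0|exact: pker_ge0].
  - apply: (@measurable_fun_fubini_tonelli_F _ _ _ _ _ lebesgue_measure (fun p => (\1_`[a, b[ p.1 * \1_(~` `[a, b[) p.2 * pker e (p.1 - p.2))%:E)).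
      apply/measurable_EFinP; apply: measurable_funM; last exact: measurable_pker_sub.
      apply: measurable_funM; first by apply: (measurableT_comp (mI _ _)) => //; exact: measurable_fst.
      by apply: (measurableT_comp (mI _ _)); [exact: measurableC|exact: measurable_snd].
    by move=> p; rewrite lee_fin; apply: mulr_ge0; [apply: mulr_ge0; exact: indic_ge0|exact: pker_ge0].
  - by apply/measurable_EFinP; apply: measurable_funM => //; exact: measurable_funD.
clear inner; move: (2 * pi) p0 => tp p0.
under eq_integral do rewrite !mulrDl !EFinD -mulrA.
rewrite ge0_integralD//; last 4 first.
- by move=> x _; rewrite -EFinD lee_fin addr_ge0// mulr_ge0 ?indic_ge0.
- by apply: emeasurable_funD; apply/measurable_EFinP; apply: measurable_funM => //; exact: mI.
- by move=> x _; rewrite lee_fin; apply: mulr_ge0; [exact: indic_ge0|exact: mulr_ge0].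
- by apply/measurable_EFinP; apply: measurable_funM => //; exact: mI.
rewrite ge0_integralD//; last 4 first.
- by move=> x _; rewrite lee_fin !mulr_ge0 ?indic_ge0.
- by apply/measurable_EFinP; apply: measurable_funM => //; exact: mI.
- by move=> x _; rewrite lee_fin !mulr_ge0 ?indic_ge0.
- by apply/measurable_EFinP; apply: measurable_funM => //; exact: mI.
have -> : (2 * del + `|b - a| * (e * (1 + del ^- 2))) * tp =
  `|a + del - a| * tp + `|b - (b - del)| * tp + `|b - a| * (e * (1 + del ^- 2) * tp).
  rewrite (_ : a + del - a = del); last by ring.
  rewrite (_ : b - (b - del) = del); last by ring.
  by rewrite (gtr0_norm d0); ring.
rewrite !EFinD; apply: leeD; first apply: leeD.
- exact: integral_indic_itv.
- exact: integral_indic_itv.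
- by apply: integral_indic_itv; rewrite mulr_ge0.
Qed.

(** A crude bound for the coordinates in which no escape is tracked: as g <= 1, the inner integral
    is at most the full mass 2 pi of the kernel. *)
Lemma Kint1_le (R : realType) (a b e : R) (g : R -> R) : 0 < e ->
  measurable_fun [set: R] g -> (forall x, 0 <= g x <= 1) ->
  (Kint1 e \1_`[a, b[ g <= (`|b - a| * (2 * pi))%:E)%E.
Proof.
move=> e0 mg g01.
have p0 : 0 <= 2 * pi :> R by rewrite mulr_ge0// pi_ge0.
have mI : measurable_fun [set: R] (\1_`[a, b[ : R -> R) by exact: measurable_indic.
have mF : measurable_fun setT (fun p : R * R => (\1_`[a, b[ p.1 * g p.2 * pker e (p.1 - p.2))%:E).
  apply/measurable_EFinP; apply: measurable_funM; last exact: measurable_pker_sub.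
  apply: measurable_funM; first by apply: (measurableT_comp mI); exact: measurable_fst.
  by apply: (measurableT_comp mg); exact: measurable_snd.
have g0 x : 0 <= g x by case/andP: (g01 x).
have F0 x y : (0 <= (\1_`[a, b[ x * g y * pker e (x - y))%:E)%E.
  by rewrite lee_fin; apply: mulr_ge0; [apply: mulr_ge0; [exact: indic_ge0|exact: g0]|exact: pker_ge0].
apply: le_trans (integral_indic_itv a b true true p0).
apply: ge0_le_integral => //.
- by move=> x _; apply: integral_ge0 => y _.
- by apply: (@measurable_fun_fubini_tonelli_F _ _ _ _ _ lebesgue_measure _ mF) => -[x y]; exact: F0.
- by apply/measurable_EFinP; exact: measurable_funM.
move=> x _; rewrite EFinM -(integral_pker_sub x e0) -ge0_integralZl//; last 2 first.
- by apply/measurable_EFinP; exact: measurable_pker_subr.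
- by move=> y _; rewrite lee_fin pker_ge0.
apply: ge0_le_integral => //.
- exact: (measurable_section1 x mF).
- by apply: measurable_funeM; apply/measurable_EFinP; exact: measurable_pker_subr.
- move=> y _; rewrite -EFinM lee_fin ler_wpM2r ?pker_ge0// ler_piMr ?indic_ge0//.
  by case/andP: (g01 y).
Qed.

(** * The quadratic form of the product Poisson kernel *)

(** The weight is a function of the pair, not just a product f(x) g(y), because later estimates
    dominate one weight pointwise by a sum of others. *)
Definition Kint {R : realType} {d} (e : R) (F : d.-tuple R * d.-tuple R -> R) : \bar R :=
  (\int[lebesgue d \x lebesgue d]_p (F p * kern e (tsub p.1 p.2))%:E)%E.

Definition nneg_meas {R : realType} {d} (F : d.-tuple R * d.-tuple R -> R) :=
  measurable_fun setT F /\ forall p, 0 <= F p.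

Lemma measurable_kern_tsub (R : realType) d (e : R) : 0 < e ->
  measurable_fun setT (fun p : d.-tuple R * d.-tuple R => kern e (tsub p.1 p.2)).
Proof.
move=> e0; apply: (measurableT_comp (@measurable_kern R d e e0)).
by apply: measurable_tsub; [exact: measurable_fst|exact: measurable_snd].
Qed.

Lemma nneg_meas_kern (R : realType) d (e : R) (F : d.-tuple R * d.-tuple R -> R) : 0 < e ->
  nneg_meas F -> nneg_meas (fun p => F p * kern e (tsub p.1 p.2)).
Proof.
move=> e0 [mF F0]; split; last by move=> p; rewrite mulr_ge0// kern_ge0.
by apply: measurable_funM => //; exact: measurable_kern_tsub.
Qed.

Lemma nneg_measD (R : realType) d (F G : d.-tuple R * d.-tuple R -> R) :
  nneg_meas F -> nneg_meas G -> nneg_meas (F \+ G).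
Proof.
move=> [mF F0] [mG G0]; split; first exact: measurable_funD.
by move=> p; rewrite addr_ge0.
Qed.

Lemma nneg_measM (R : realType) d (F G : d.-tuple R * d.-tuple R -> R) :
  nneg_meas F -> nneg_meas G -> nneg_meas (fun p => F p * G p).
Proof.
move=> [mF F0] [mG G0]; split; first exact: measurable_funM.
by move=> p; rewrite mulr_ge0.
Qed.

Lemma nneg_meas_fst (R : realType) d (f : d.-tuple R -> R) :
  measurable_fun setT f -> (forall x, 0 <= f x) -> nneg_meas (fun p : d.-tuple R * d.-tuple R => f p.1).
Proof.
by move=> mf f0; split => // ; apply: (measurableT_comp mf); exact: measurable_fst.
Qed.

Lemma nneg_meas_snd (R : realType) d (f : d.-tuple R -> R) :
  measurable_fun setT f -> (forall x, 0 <= f x) -> nneg_meas (fun p : d.-tuple R * d.-tuple R => f p.2).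
Proof.
by move=> mf f0; split => // ; apply: (measurableT_comp mf); exact: measurable_snd.
Qed.

Lemma nneg_meas_indic (R : realType) d (A B : set (d.-tuple R)) : measurable A -> measurable B ->
  nneg_meas (fun p : d.-tuple R * d.-tuple R => \1_A p.1 * \1_B p.2).
Proof.
move=> mA mB; apply: nneg_measM.
  by apply: nneg_meas_fst => [|x]; [exact: measurable_indic|exact: indic_ge0].
by apply: nneg_meas_snd => [|x]; [exact: measurable_indic|exact: indic_ge0].
Qed.

Lemma Kint_le (R : realType) d (e : R) (F G : d.-tuple R * d.-tuple R -> R) : 0 < e ->
  nneg_meas F -> nneg_meas G -> (forall p, F p <= G p) -> (Kint e F <= Kint e G)%E.
Proof.
move=> e0 nF nG FG; have [mF F0] := nneg_meas_kern e0 nF; have [mG G0] := nneg_meas_kern e0 nG.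
apply: ge0_le_integral => //.
- by move=> p _; rewrite lee_fin.
- exact/measurable_EFinP.
- exact/measurable_EFinP.
- by move=> p _; rewrite lee_fin ler_wpM2r// kern_ge0.
Qed.

Lemma KintD (R : realType) d (e : R) (F G : d.-tuple R * d.-tuple R -> R) : 0 < e ->
  nneg_meas F -> nneg_meas G -> (Kint e (F \+ G)%R = Kint e F + Kint e G)%E.
Proof.
move=> e0 nF nG; have [mF F0] := nneg_meas_kern e0 nF; have [mG G0] := nneg_meas_kern e0 nG.
rewrite -ge0_integralD//; last 4 first.
- by move=> p _; rewrite lee_fin.
- exact/measurable_EFinP.
- by move=> p _; rewrite lee_fin.
- exact/measurable_EFinP.
by apply: eq_integral => p _; rewrite /= mulrDl.
Qed.

Lemma KintZ (R : realType) d (e c : R) (F : d.-tuple R * d.-tuple R -> R) : 0 < e -> 0 <= c ->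
  nneg_meas F -> (Kint e (fun p => c * F p)%R = c%:E * Kint e F)%E.
Proof.
move=> e0 c0 nF; have [mF F0] := nneg_meas_kern e0 nF.
rewrite -ge0_integralZl//; last 2 first.
- exact/measurable_EFinP.
- by move=> p _; rewrite lee_fin.
by apply: eq_integral => p _; rewrite -mulrA.
Qed.

Lemma Kint_iter (R : realType) d (e : R) (F : d.-tuple R * d.-tuple R -> R) : 0 < e -> nneg_meas F ->
  Kint e F = (\int[lebesgue d]_x \int[lebesgue d]_y (F (x, y) * kern e (tsub x y))%:E)%E.
Proof.
move=> e0 nF; have [mF F0] := nneg_meas_kern e0 nF.
rewrite /Kint fubini_tonelli1//; exact/measurable_EFinP.
Qed.

Lemma Kint_swap (R : realType) d (e : R) (F : d.-tuple R * d.-tuple R -> R) : 0 < e ->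
  nneg_meas F -> Kint e (fun p => F (p.2, p.1)) = Kint e F.
Proof.
move=> e0 nF; have [mF F0] := nneg_meas_kern e0 nF.
have nF' : nneg_meas (fun p : d.-tuple R * d.-tuple R => F (p.2, p.1)).
  case: nF => mF1 F10; split => //.
  apply: (measurableT_comp mF1); apply/measurable_fun_pairP; split; [exact: measurable_snd|exact: measurable_fst].
rewrite Kint_iter// Kint_iter//.
have mE : measurable_fun setT (fun p => (F p * kern e (tsub p.1 p.2))%:E) by exact/measurable_EFinP.
have FE0 p : (0 <= (F p * kern e (tsub p.1 p.2))%:E)%E by rewrite lee_fin.
transitivity (\int[lebesgue d]_y fubini_G (lebesgue d) (fun p => (F p * kern e (tsub p.1 p.2))%:E) y)%E.
  by apply: eq_integral => x _; apply: eq_integral => y _; rewrite kern_tsubC.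
by rewrite -(fubini_tonelli _ mE FE0).
Qed.

(** A weight that ignores the second point lets the kernel integrate out to (2 pi)^d. The value is
    therefore independent of [e], which is how limits of the form get evaluated. *)
Lemma Kint_fst (R : realType) d (e : R) (f : d.-tuple R -> R) : 0 < e ->
  measurable_fun setT f -> (forall x, 0 <= f x) ->
  (Kint e (fun p => f p.1) = ((2 * pi) ^+ d)%:E * \int[lebesgue d]_x (f x)%:E)%E.
Proof.
move=> e0 mf f0; rewrite Kint_iter//; last exact: nneg_meas_fst.
rewrite -ge0_integralZl//; last 3 first.
- exact/measurable_EFinP.
- by move=> x _; rewrite lee_fin.
- by rewrite lee_fin exprn_ge0// mulr_ge0// pi_ge0.
apply: eq_integral => x _; rewrite /= -(integral_kern_tsub x e0) muleC -ge0_integralZl//; last 3 first.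
- by apply/measurable_EFinP; apply: (measurableT_comp (@measurable_kern R d e e0)); exact: measurable_tsubr.
- by move=> y _; rewrite lee_fin kern_ge0.
- by rewrite lee_fin.
Qed.

(** Kernel and weight both factor over the coordinates. The bound g <= 1 makes each inner integral
    finite, so the partial integrals [phi j] are real functions and their product can be integrated
    coordinatewise. *)
Lemma Kint_prod (R : realType) d (e : R) (f g : 'I_d -> R -> R) : 0 < e ->
  (forall j, measurable_fun [set: R] (f j)) -> (forall j, measurable_fun [set: R] (g j)) ->
  (forall j x, 0 <= f j x) -> (forall j x, 0 <= g j x <= 1) ->
  (Kint e (fun p => \prod_(j < d) (f j (tnth p.1 j) * g j (tnth p.2 j)))%R =
   \prod_(j < d) Kint1 e (f j) (g j))%E.
Proof.
move=> e0 mf mg f0 g01.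
have g0 j x : 0 <= g j x by case/andP: (g01 j x).
have mF j : measurable_fun setT (fun p : R * R => f j p.1 * g j p.2 * pker e (p.1 - p.2)).
  apply: measurable_funM; last exact: measurable_pker_sub.
  apply: measurable_funM; first by apply: (measurableT_comp (mf j)); exact: measurable_fst.
  by apply: (measurableT_comp (mg j)); exact: measurable_snd.
have F0 j x y : 0 <= f j x * g j y * pker e (x - y).
  by apply: mulr_ge0; [apply: mulr_ge0; [exact: f0|exact: g0]|exact: pker_ge0].
pose phi j (a : R) : R := \int[lebesgue_measure]_b (f j a * g j b * pker e (a - b)).
have phiE j a : (\int[lebesgue_measure]_b (f j a * g j b * pker e (a - b))%:E = (phi j a)%:E)%E.
  rewrite /phi /Rintegral fineK// ge0_fin_numE; last first.
    by apply: integral_ge0 => b _; rewrite lee_fin.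
  apply: (@le_lt_trans _ _ (\int[lebesgue_measure]_b ((f j a)%:E * (pker e (a - b))%:E))%E).
    apply: ge0_le_integral => //.
    - by move=> b _; rewrite lee_fin.
    - by apply/measurable_EFinP; exact: (measurable_section1 a (mF j)).
    - by apply: measurable_funeM; apply/measurable_EFinP; exact: measurable_pker_subr.
    - move=> b _; rewrite -EFinM lee_fin ler_wpM2r ?pker_ge0// ler_piMr//.
      by case/andP: (g01 j b).
  rewrite ge0_integralZl//; last 3 first.
  - by apply/measurable_EFinP; exact: measurable_pker_subr.
  - by move=> b _; rewrite lee_fin pker_ge0.
  - by rewrite lee_fin.
  by rewrite (integral_pker_sub a e0) -EFinM ltry.
have mphi j : measurable_fun [set: R] (phi j).
  exact: (measurable_Rintegral_section lebesgue_measure (mF j)).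
have phi0 j a : 0 <= phi j a by apply: Rintegral_ge0 => b _.
rewrite Kint_iter//; last first.
  split; last by move=> p; apply: prodr_ge0 => j _; rewrite mulr_ge0.
  apply: measurable_prod => j _; apply: measurable_funM.
    by apply: (measurableT_comp (mf j)); apply: (measurableT_comp (measurable_tnth j)); exact: measurable_fst.
  by apply: (measurableT_comp (mg j)); apply: (measurableT_comp (measurable_tnth j)); exact: measurable_snd.
transitivity (\int[lebesgue d]_x (\prod_(j < d) phi j (tnth x j))%:E)%E.
  apply: eq_integral => x _.
  transitivity (\int[lebesgue d]_y (\prod_(j < d) (f j (tnth x j) * g j (tnth y j) * pker e (tnth x j - tnth y j)))%:E)%E.
    apply: eq_integral => y _; congr EFin; rewrite /kern -big_split/=; apply: eq_bigr => j _.
    by rewrite tnth_mktuple.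
  rewrite (@integral_prod_tnth R d (fun j b => f j (tnth x j) * g j b * pker e (tnth x j - b)))//; last first.
    by move=> j; exact: (measurable_section1 _ (mF j)).
  by under eq_bigr do rewrite phiE; rewrite prodEFin.
rewrite integral_prod_tnth//; apply: eq_bigr => j _; rewrite /Kint1.
by apply: eq_integral => a _; rewrite phiE.
Qed.

(** * Weights with vanishing form, and sets whose boundary the kernel does not cross *)

(** A decreasing sequence, so that the weights [wt (vareps n)] increase with n and monotone
    convergence can remove them. *)
Definition vareps {R : realType} (n : nat) : R := n.+1%:R^-1.

Lemma vareps_gt0 (R : realType) n : 0 < vareps n :> R.
Proof. by rewrite invr_gt0. Qed.

Lemma near_vareps_le (R : realType) (c : R) : 0 < c -> \forall n \near \oo, vareps n <= c.
Proof.
move=> c0; have := near_infty_natSinv_lt (PosNum c0); apply: filterS => n /= h.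
exact: ltW.
Qed.

(** The form is nonnegative, so this says that it tends to 0; upper bounds combine directly with
    domination and finite sums. *)
Definition vanish {R : realType} {d} (F : d.-tuple R * d.-tuple R -> R) :=
  nneg_meas F /\ forall eta, 0 < eta -> \forall n \near \oo, (Kint (vareps n) F <= eta%:E)%E.

Lemma vanish_le (R : realType) d (F G : d.-tuple R * d.-tuple R -> R) :
  nneg_meas F -> (forall p, F p <= G p) -> vanish G -> vanish F.
Proof.
move=> nF FG [nG vG]; split => // eta eta0.
have := vG _ eta0; apply: filterS => n; apply: le_trans.
by apply: Kint_le => //; exact: vareps_gt0.
Qed.

Lemma vanishD (R : realType) d (F G : d.-tuple R * d.-tuple R -> R) :
  vanish F -> vanish G -> vanish (F \+ G).
Proof.
move=> [nF vF] [nG vG]; split; first exact: nneg_measD.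
move=> eta eta0; have h : 0 < eta / 2 by rewrite divr_gt0.
near=> n; rewrite KintD//; last exact: vareps_gt0.
rewrite [eta]splitr EFinD leeD//; near: n; [exact: vF|exact: vG].
Unshelve. all: by end_near. Qed.

Lemma vanishZ (R : realType) d (c : R) (F : d.-tuple R * d.-tuple R -> R) : 0 <= c ->
  vanish F -> vanish (fun p => c * F p).
Proof.
move=> c0 [[mF F0] vF]; split.
  by split; [exact: measurable_funM|move=> p; exact: mulr_ge0].
move=> eta eta0; have h : 0 < eta / (c + 1) by rewrite divr_gt0// ltr_wpDl.
near=> n; rewrite KintZ//; last exact: vareps_gt0.
apply: (@le_trans _ _ (c%:E * (eta / (c + 1))%:E)%E).
  by rewrite lee_wpmul2l ?lee_fin//; near: n; exact: vF.
rewrite -EFinM lee_fin mulrCA ler_piMr ?(ltW eta0)//.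
by rewrite ler_pdivrMr ?ltr_wpDl// mul1r lerDl.
Unshelve. all: by end_near. Qed.

Lemma vanish_swap (R : realType) d (F : d.-tuple R * d.-tuple R -> R) :
  vanish F -> vanish (fun p => F (p.2, p.1)).
Proof.
move=> [[mF F0] vF]; split.
  split => //; apply: (measurableT_comp mF); apply/measurable_fun_pairP.
  by split; [exact: measurable_snd|exact: measurable_fst].
move=> eta /vF; apply: filterS => n; rewrite Kint_swap//; exact: vareps_gt0.
Qed.

Lemma vanish0 (R : realType) d : vanish (fun _ : d.-tuple R * d.-tuple R => 0).
Proof.
split; first by split => //; exact: measurable_cst.
move=> eta eta0; near=> n; rewrite /Kint.
under eq_integral do rewrite mul0r.
by rewrite integral0 lee_fin ltW.
Unshelve. all: by end_near. Qed.

Lemma vanish_sum (R : realType) d I (s : seq I) (F : I -> d.-tuple R * d.-tuple R -> R) :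
  (forall i, vanish (F i)) -> vanish (fun p => \sum_(i <- s) F i p).
Proof.
move=> vF; elim: s => [|i s IH].
  under eq_fun do rewrite big_nil; exact: vanish0.
under eq_fun do rewrite big_cons; exact: vanishD.
Qed.

(** An error term f(x) contributes (2 pi)^d int f for every n, hence an error small in L^1 is
    harmless uniformly in n. *)
Lemma vanish_approx (R : realType) d (F : d.-tuple R * d.-tuple R -> R) : nneg_meas F ->
  (forall eta : R, 0 < eta -> exists (G : d.-tuple R * d.-tuple R -> R) (f : d.-tuple R -> R), [/\ vanish G, measurable_fun setT f, (forall x, 0 <= f x),
     (forall p, F p <= G p + f p.1) &
     (((2 * pi) ^+ d)%:E * \int[lebesgue d]_x (f x)%:E <= eta%:E)%E]) ->
  vanish F.
Proof.
move=> nF h; split => // eta eta0; have h2 : 0 < eta / 2 by rewrite divr_gt0.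
have [G [f [[nG vG] mf f0 FGf fe]]] := h _ h2.
near=> n; apply: (@le_trans _ _ (Kint (vareps n) (G \+ (fun p => f p.1))%R)).
  apply: Kint_le => //; first exact: vareps_gt0.
  by apply: nneg_measD => //; exact: nneg_meas_fst.
rewrite KintD//; [|exact: vareps_gt0|exact: nneg_meas_fst].
rewrite [eta]splitr EFinD leeD//; first by near: n; exact: vG.
by rewrite Kint_fst//; exact: vareps_gt0.
Unshelve. all: by end_near. Qed.

(* The convolution of [\1_A] with the approximate identity [kern (vareps n)] tends
   to [\1_A] in L^2: [kern] does not transport mass across the boundary of [A]. *)
Definition vanish_set {R : realType} {d} (A : set (d.-tuple R)) :=
  measurable A /\ vanish (fun p : d.-tuple R * d.-tuple R => \1_A p.1 * \1_(~` A) p.2).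

(** Half-open sides keep the class stable under intersection with the open half-spaces x_i < c that
    generate the Borel sets. *)
Definition box {R : realType} {d} (a b : 'I_d -> R) : set (d.-tuple R) :=
  [set x | forall j, a j <= tnth x j < b j].

Lemma indic_box (R : realType) d (a b : 'I_d -> R) (x : d.-tuple R) :
  \1_(box a b) x = \prod_(j < d) \1_`[a j, b j[ (tnth x j) :> R.
Proof.
have [xB|xB] := pselect (box a b x).
  rewrite indicE mem_set// big1// => j _; rewrite indicE mem_set//=.
  by rewrite in_itv/= xB.
rewrite indicE memNset//.
move/existsNP : (xB) => [j hj]; rewrite (bigD1 j)//= [X in X * _]indicE memNset ?mul0r//=.
Qed.

Lemma measurable_box (R : realType) d (a b : 'I_d -> R) : measurable (box a b).
Proof.
have mp : measurable_fun setT (fun x : d.-tuple R => \prod_(j < d) (\1_`[a j, b j[ (tnth x j) : R)).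
  by apply: (@measurable_prod_tnth R d (fun j => \1_`[a j, b j[)) => j; exact: measurable_indic.
rewrite (_ : box a b = setT `&` (fun x : d.-tuple R => \prod_(j < d) (\1_`[a j, b j[ (tnth x j) : R)) @^-1` [set 1]).
  exact: mp.
rewrite setTI; apply/seteqP; split => x /=; rewrite -indic_box indicE.
  by move=> /mem_set ->.
by case: (boolP (x \in box a b)) => [/set_mem//|_ /esym/eqP]; rewrite oner_eq0.
Qed.

Lemma lee_prod_ge0 (R : realType) (I : Type) (s : seq I) (P : pred I) (f g : I -> \bar R) :
  (forall i, 0 <= f i)%E -> (forall i, f i <= g i)%E ->
  (0 <= \prod_(i <- s | P i) f i <= \prod_(i <- s | P i) g i)%E.
Proof.
move=> f0 fg; apply: (big_ind2 (fun x y : \bar R => (0 <= x <= y)%E)).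
- by rewrite lexx lee_fin ler01.
- move=> x1 x2 y1 y2 /andP[a1 a2] /andP[b1 b2].
  by rewrite mule_ge0//= lee_pmul.
- by move=> i _; rewrite f0 fg.
Qed.

Lemma Kint1_ge0 (R : realType) (e : R) (f g : R -> R) : 0 < e -> (forall x, 0 <= f x) ->
  (forall x, 0 <= g x) -> (0 <= Kint1 e f g)%E.
Proof.
move=> e0 f0 g0; apply: integral_ge0 => a _; apply: integral_ge0 => b _.
by rewrite lee_fin; apply: mulr_ge0; [exact: mulr_ge0|exact: pker_ge0].
Qed.

Lemma near_Kint1_interval (R : realType) (a b eta : R) : 0 < eta ->
  \forall n \near \oo, (Kint1 (vareps n) \1_`[a, b[ \1_(~` `[a, b[) <= eta%:E)%E.
Proof.
move=> eta0; have p0 : 0 < 2 * pi :> R by rewrite mulr_gt0// pi_gt0.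
(* Chosen so that the two end intervals contribute exactly eta / 2; [q] is then the coefficient of
   [vareps n] in the remaining term. *)
pose del := eta / (4 * (2 * pi)).
have d0 : 0 < del by rewrite divr_gt0// mulr_gt0.
pose q := `|b - a| * (1 + del ^- 2) * (2 * pi).
have q0 : 0 <= q.
  by rewrite mulr_ge0 ?(ltW p0)// mulr_ge0// addr_ge0// invr_ge0 sqr_ge0.
(* Dividing by q + 1 avoids a zero denominator when a = b. *)
have c0 : 0 < eta / (2 * (q + 1)) by rewrite divr_gt0// mulr_gt0// ltr_wpDl.
have := near_vareps_le c0; apply: filterS => n hn.
apply: (le_trans (Kint1_interval a b (vareps_gt0 R n) d0)); rewrite lee_fin.
have -> : (2 * del + `|b - a| * (vareps n * (1 + del ^- 2))) * (2 * pi) = eta / 2 + vareps n * q.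
  have kn : 2 * pi != 0 :> R by rewrite gt_eqF.
  rewrite /q mulrDl; congr (_ + _); last by ring.
  by rewrite /del; move: (2 * pi) kn => k kn; field; rewrite ?kn.
rewrite [leRHS]splitr lerD2l.
apply: (@le_trans _ _ (eta / (2 * (q + 1)) * q)); first by rewrite ler_wpM2r.
have q1 : 0 < q + 1 by rewrite ltr_wpDl.
have qn : q + 1 != 0 by rewrite gt_eqF.
have -> : eta / (2 * (q + 1)) * q = eta / 2 * (q / (q + 1)) by field; rewrite ?qn.
rewrite ler_piMr ?divr_ge0 ?(ltW eta0)//.
by rewrite ler_pdivrMr// mul1r lerDl.
Qed.

(** A point outside the box violates the constraint in some coordinate j. A union bound over j
    leaves products in which the j-th factor tends to 0 and the others stay bounded. *)
Lemma vanish_set_box (R : realType) d (a b : 'I_d -> R) : vanish_set (box a b).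
Proof.
have mC := measurable_box a b; split => //.
pose f (i : 'I_d) : R -> R := \1_`[a i, b i[.
(* The weight [G j] demands escape in coordinate j alone and leaves the other coordinates of the
   second point free. *)
pose g (j i : 'I_d) : R -> R := if i == j then \1_(~` `[a i, b i[) else (fun=> 1).
have mf i : measurable_fun [set: R] (f i) by exact: measurable_indic.
have mg j i : measurable_fun [set: R] (g j i).
  by rewrite /g; case: ifP => _; [apply: measurable_indic; exact: measurableC|exact: measurable_cst].
have f0 i x : 0 <= f i x by exact: indic_ge0.
have g01 j i x : 0 <= g j i x <= 1.
  by rewrite /g; case: ifP => _; rewrite ?indic_ge0 ?indic_le1// ler01 lexx.
have g0 j i x : 0 <= g j i x by case/andP: (g01 j i x).
pose G (j : 'I_d) (p : d.-tuple R * d.-tuple R) := \prod_(i < d) (f i (tnth p.1 i) * g j i (tnth p.2 i)).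
have nG j : nneg_meas (G j).
  split; last by move=> p; apply: prodr_ge0 => i _; exact: mulr_ge0.
  apply: measurable_prod => i _; apply: measurable_funM.
    by apply: (measurableT_comp (mf i)); apply: (measurableT_comp (measurable_tnth i)); exact: measurable_fst.
  by apply: (measurableT_comp (mg j i)); apply: (measurableT_comp (measurable_tnth i)); exact: measurable_snd.
apply: (@vanish_le _ _ _ (fun p => \sum_(j <- index_enum 'I_d) G j p)).
- by apply: nneg_meas_indic => //; exact: measurableC.
- move=> -[x y] /=.
  have S0 : 0 <= \sum_(j <- index_enum 'I_d) G j (x, y).
    by apply: sumr_ge0 => j _; case: (nG j).
  have [yB|yB] := pselect (box a b y).
    by rewrite [X in _ * X]indicE memNset ?mulr0//; exact.
  move/existsNP : (yB) => [j hj].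
  apply: (@le_trans _ _ (G j (x, y))); last first.
    rewrite (bigD1 j)//= lerDl; apply: sumr_ge0 => i _; by case: (nG i).
  rewrite [X in _ * X]indicE mem_set// mulr1 indic_box /G.
  apply: ler_prod => i _; rewrite indic_ge0/= /f /g.
  case: eqP => [->|_]; last by rewrite mulr1.
  by rewrite [X in _ <= _ * X]indicE mem_set ?mulr1//= in_itv.
apply: vanish_sum => j; split => // eta eta0.
pose D := \prod_(i < d | i != j) (`|b i - a i| * (2 * pi)).
have D0 : 0 <= D by apply: prodr_ge0 => i _; rewrite mulr_ge0// mulr_ge0// pi_ge0.
have c0 : 0 < eta / (D + 1) by rewrite divr_gt0// ltr_wpDl.
have := near_Kint1_interval (a j) (b j) c0; apply: filterS => n hn.
have e0 := vareps_gt0 R n.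
rewrite (Kint_prod e0 mf (mg j) f0 (g01 j)) (bigD1 j)//=.
apply: (@le_trans _ _ ((eta / (D + 1))%:E * D%:E)%E).
  have /andP[h1 h2] := @lee_prod_ge0 R 'I_d (index_enum 'I_d) (fun i => i != j)
     (fun i => Kint1 (vareps n) (f i) (g j i)) (fun i => (`|b i - a i| * (2 * pi))%:E)
     (fun i => Kint1_ge0 e0 (f0 i) (g0 j i)) (fun i => Kint1_le (a i) (b i) e0 (mg j i) (g01 j i)).
  rewrite prodEFin in h2.
  apply: lee_pmul => //; first by apply: Kint1_ge0.
  by rewrite /f /g eqxx.
rewrite -EFinM lee_fin -mulrA ler_piMr ?(ltW eta0)//.
by rewrite mulrC ler_pdivrMr ?ltr_wpDl// mul1r lerDl.
Qed.

(** The half-open variant of [cube], hence a [box]. It supplies the finite measure needed to pass to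
    countable unions. *)
Definition cubeco {R : realType} {d} (M : R) : set (d.-tuple R) :=
  box (fun=> - M) (fun=> M).

Lemma measurable_cubeco (R : realType) d (M : R) : measurable (@cubeco R d M).
Proof. exact: measurable_box. Qed.

Lemma lebesgue_box_lty (R : realType) d (a b : 'I_d -> R) : (lebesgue d (box a b) < +oo)%E.
Proof.
rewrite -[box a b]setIT -integral_indic//; last exact: measurable_box.
under eq_integral do rewrite indic_box.
rewrite (@integral_prod_tnth R d (fun j => \1_`[a j, b j[)); last 2 first.
- by move=> j; exact: measurable_indic.
- by move=> j x; exact: indic_ge0.
set Z := (X in (X < +oo)%E); suff : (Z < +oo)%E /\ (0 <= Z)%E by case.
rewrite /Z; apply: (big_ind (fun x : \bar R => (x < +oo)%E /\ (0 <= x)%E)) => //.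
- by rewrite ltry lee_fin.
- move=> x y [x1 x2] [y1 y2]; split; last exact: mule_ge0.
  by apply: lte_mul_pinfty => //; rewrite ge0_fin_numE.
- move=> j _; split; last by apply: integral_ge0 => x _; rewrite lee_fin indic_ge0.
  have := @integral_indic_itv R (a j) (b j) 1 true true ler01.
  under eq_integral do rewrite mulr1.
  by move=> /le_lt_trans; apply; rewrite ltry.
Qed.

Lemma vset0 (R : realType) d : vanish_set (@set0 (d.-tuple R)).
Proof.
split => //; apply: (vanish_le _ _ (vanish0 R d)).
  by apply: nneg_meas_indic => //; exact: measurableC.
by move=> p; rewrite indic0 mul0r.
Qed.

(** If x is in B but not in A and y is not in that difference, then y is outside B, or y lies in A
    and B while x does not lie in both. The second case is an escape from the intersection with the
    points exchanged, whence [vanish_swap]. *)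
Lemma vanish_set_setD (R : realType) d (A B : set (d.-tuple R)) :
  vanish_set B -> vanish_set (A `&` B) -> vanish_set (~` A `&` B).
Proof.
move=> [mB vB] [mAB vAB].
have E : ~` A `&` B = B `\` (A `&` B) by apply/seteqP; split => x /=; tauto.
have mD : measurable (~` A `&` B) by rewrite E; exact: measurableD.
split => //.
apply: (vanish_le _ _ (vanishD (vanish_swap vAB) vB)).
  by apply: nneg_meas_indic => //; exact: measurableC.
move=> p /=; rewrite !indicE !(in_setI, in_setC).
by case: (p.1 \in A); case: (p.1 \in B); case: (p.2 \in A); case: (p.2 \in B) => /=; lra.
Qed.

Lemma vanish_set_setU (R : realType) d (A A' : set (d.-tuple R)) :
  vanish_set A -> vanish_set A' -> vanish_set (A `|` A').
Proof.
move=> [mA vA] [mA' vA']; split; first exact: measurableU.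
apply: (vanish_le _ _ (vanishD vA vA')).
  by apply: nneg_meas_indic; [|apply: measurableC]; exact: measurableU.
move=> p /=; rewrite !indicE !(in_setU, in_setC).
by case: (p.1 \in A); case: (p.1 \in A'); case: (p.2 \in A); case: (p.2 \in A') => /=; lra.
Qed.

(** Finite unions are handled by induction. The part [D N] of the union that the first N sets miss
    decreases to the empty set inside B, so its measure tends to 0 by continuity from above;
    [vanish_approx] absorbs it. *)
Lemma vanish_set_bigcup (R : realType) d (A : (set (d.-tuple R))^nat) (B : set (d.-tuple R)) :
  measurable B -> (lebesgue d B < +oo)%E ->
  (forall k, measurable (A k)) -> (forall k, vanish_set (A k `&` B)) ->
  vanish_set ((\bigcup_k A k) `&` B).
Proof.
move=> mB Boo mA vA.
pose U N := \bigcup_(k < N) A k.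
have mU N : measurable (U N) by apply: bigcup_measurable.
have mUo : measurable (\bigcup_k A k) by exact: bigcupT_measurable.
have mC : measurable ((\bigcup_k A k) `&` B) by exact: measurableI.
have vU N : vanish_set (U N `&` B).
  elim: N => [|N IH]; first by rewrite /U bigcup_mkord big_ord0 set0I; exact: vset0.
  rewrite (_ : U N.+1 `&` B = (U N `&` B) `|` (A N `&` B)); first exact: vanish_set_setU.
  by rewrite /U !bigcup_mkord big_ord_recr/= setIUl.
pose D N := ((\bigcup_k A k) `\` U N) `&` B.
have mD N : measurable (D N) by apply: measurableI => //; exact: measurableD.
have Dcvg : lebesgue d (D N) @[N --> \oo] --> 0%E.
  have D0 : \bigcap_N D N = set0.
    rewrite -subset0 => x Dx; have [[[k _ Akx] _] _] := Dx 0%N I.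
    by have [[_ nU] _] := Dx k.+1 I; apply: nU; exists k => /=.
  rewrite -(measure0 (lebesgue d)) -D0.
  apply: nonincreasing_cvg_mu => //.
  - apply: le_lt_trans Boo; apply: le_measure; rewrite ?inE//.
    by move=> x [].
  - by rewrite D0.
  - move=> m n mn; apply/subsetPset => x [[x1 x2] x3]; split => //; split => //.
    by move=> [k /= km Ak]; apply: x2; exists k => //=; exact: leq_trans mn.
split => //; apply: vanish_approx; first by apply: nneg_meas_indic => //; exact: measurableC.
move=> eta eta0.
have p0 : 0 < (2 * pi) ^+ d :> R by rewrite exprn_gt0// mulr_gt0// pi_gt0.
have [N hN] : exists N, (lebesgue d (D N) <= (eta / (2 * pi) ^+ d)%:E)%E.
  have c0 : 0 < eta / (2 * pi) ^+ d by rewrite divr_gt0.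
  have [N _ hN] := Dcvg _ (@nbhs_open_ereal_lt R 0 (fun=> eta / (2 * pi) ^+ d) c0).
  by exists N; apply/ltW/hN => /=.
exists (fun p => \1_(U N `&` B) p.1 * \1_(~` (U N `&` B)) p.2), \1_(D N); split.
- exact: (vU N).2.
- exact: measurable_indic.
- by move=> x; exact: indic_ge0.
- move=> p.
  (* This inclusion rules out the impossible membership patterns in the case analysis below. *)
  have UA x : x \in U N -> x \in \bigcup_k A k.
    by rewrite !inE => -[k _ Ak]; exists k.
  rewrite !indicE !(in_setI, in_setC, in_setD).
  move: (UA p.1) (UA p.2).
  by case: (p.1 \in U N); case: (p.1 \in \bigcup_k A k); case: (p.1 \in B);
    case: (p.2 \in U N); case: (p.2 \in \bigcup_k A k); case: (p.2 \in B) => /= h1 h2;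
    first [by have := h1 isT|by have := h2 isT|lra].
- rewrite integral_indic// setIT.
  apply: (@le_trans _ _ (((2 * pi) ^+ d)%:E * (eta / (2 * pi) ^+ d)%:E)%E).
    by rewrite lee_wpmul2l// lee_fin ltW.
  by rewrite -EFinM lee_fin mulrC divfK// gt_eqF.
Qed.

Lemma measurable_vanish_set (R : realType) d (M : R) (A : set (d.-tuple R)) :
  measurable A -> vanish_set (A `&` cubeco M).
Proof.
have vB : vanish_set (@cubeco R d M) by exact: vanish_set_box.
have mB := @measurable_cubeco R d M.
pose G := [set A : set (d.-tuple R) | measurable A /\ vanish_set (A `&` cubeco M)].
have sG : sigma_algebra setT G.
  split.
  - by split => //; rewrite set0I; exact: vset0.
  - move=> C [mC vC]; rewrite setTD; split; first exact: measurableC.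
    exact: vanish_set_setD.
  - move=> C GC; split.
      by apply: bigcupT_measurable => k; case: (GC k).
    apply: vanish_set_bigcup => //; first exact: lebesgue_box_lty.
      by move=> k; case: (GC k).
    by move=> k; case: (GC k).
move=> mA; suff : G A by case.
(* The sigma-algebra on tuples is generated by preimages of Borel sets under the coordinates, so it
   suffices to treat one coordinate i at a time. *)
move: A mA; apply: smallest_sub => //.
apply: (big_ind (fun S : set (set (d.-tuple R)) => S `<=` G)) => //.
  by move=> S1 S2 h1 h2 C [/h1|/h2].
move=> i _ C [C1 mC1 <-{C}].
(* Borel sets of the line are in turn generated by the open left half-lines; sets with good preimage
   again form a sigma-algebra. *)
have mC1' : (@RGenInftyO.G R).-sigma.-measurable C1 by rewrite -RGenInftyO.measurableE.
move: C1 {mC1} mC1'; apply: smallest_sub.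
  case: sG => s0 sC sU; split => /=.
  - by rewrite preimage_set0 setI0.
  - move=> C GC; rewrite setTI setTD preimage_setC -setTD; apply: sC.
    by rewrite setTI in GC.
  - move=> C GC; rewrite setTI preimage_bigcup; apply: sU => n.
    by have := GC n; rewrite setTI.
move=> _ [c ->]; rewrite /= setTI; split.
  by rewrite -[X in measurable X]setTI; exact: measurable_tnth.
(* The half-space x_i < c cuts the cube down to a box, which only lowers the i-th upper side to min
   M c. *)
rewrite (_ : _ `&` _ = box (fun=> - M) (fun j => if j == i then Num.min M c else M)); first exact: vanish_set_box.
apply/seteqP; split => x /=.
  move=> [+ xM] j; rewrite in_itv/= => xc; have /andP[h1 h2] := xM j.
  by rewrite h1/=; case: eqP => [->|//]; rewrite lt_min xc andbT; have /andP[] := xM i.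
move=> xB; split.
  by rewrite in_itv/=; have := xB i; rewrite eqxx lt_min => /andP[_ /andP[]].
move=> j; have /andP[-> ] := xB j; case: eqP => // -> .
by rewrite lt_min => /andP[].
Qed.

(* On a level set of [phi] the two factors agree, so [phi ^+ 2] is dominated by
   [h p.1 * h p.2] up to mass transported out of the level set. *)
Lemma Kint_nnsfun_le (R : realType) d (h : d.-tuple R -> R) (phi : {nnsfun d.-tuple R >-> R})
    (M : R) (L : \bar R) :
  measurable_fun setT h -> (forall x, 0 <= h x) -> (forall x, phi x <= h x) ->
  (forall n, (Kint (vareps n) (fun p => h p.1 * h p.2)%R <= L)%E) ->
  (((2 * pi) ^+ d)%:E * \int[lebesgue d]_x (phi x ^+ 2 * \1_(cubeco M) x)%:E <= L)%E.
Proof.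
move=> mh h0 phih hL.
have mB := @measurable_cubeco R d M.
have mphi : measurable_fun setT phi by [].
have p0 x : 0 <= phi x by [].
pose C (a : R) := (phi @^-1` [set a]) `&` cubeco M.
have vC a : vanish_set (C a) by apply: measurable_vanish_set; exact: measurable_funPTI.
have /finite_seqP[s sE] := fimfunP phi.
have phis x : phi x \in s.
  by have : range phi (phi x) by [exists x]; rewrite sE.
pose F (a : R) (p : d.-tuple R * d.-tuple R) : R := a ^+ 2 * (\1_(C a) p.1 * \1_(~` C a) p.2).
have F0 a p : 0 <= F a p by rewrite mulr_ge0 ?sqr_ge0// mulr_ge0// indic_ge0.
have vF : vanish (fun p => \sum_(a <- s) F a p).
  by apply: vanish_sum => a; apply: vanishZ; [exact: sqr_ge0|exact: (vC a).2].
have mq : measurable_fun setT (fun x => phi x ^+ 2 * \1_(cubeco M) x).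
  by apply: measurable_funM; [exact: measurable_funX|exact: measurable_indic].
have q0 x : 0 <= phi x ^+ 2 * \1_(cubeco M) x by rewrite mulr_ge0 ?sqr_ge0 ?indic_ge0.
have nhh : nneg_meas (fun p : d.-tuple R * d.-tuple R => h p.1 * h p.2).
  by apply: nneg_measM; [exact: nneg_meas_fst|exact: nneg_meas_snd].
have pw (p : d.-tuple R * d.-tuple R) :
    phi p.1 ^+ 2 * \1_(cubeco M) p.1 <= h p.1 * h p.2 + \sum_(a <- s) F a p.
  case: p => x y /=.
  have S0 : 0 <= \sum_(a <- s) F a (x, y) by apply: sumr_ge0.
  have [xB|xB] := boolP (x \in cubeco M); last first.
    by rewrite indicE (negbTE xB) mulr0 addr_ge0// mulr_ge0.
  rewrite [X in _ * X]indicE xB mulr1.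
  have [yC|yC] := boolP (y \in C (phi x)).
    move: yC; rewrite inE => -[/= yx _].
    rewrite -[leLHS]addr0 lerD// expr2 -{2}yx ler_pM//.
  rewrite (big_rem _ (phis x))/=.
  have -> : F (phi x) (x, y) = phi x ^+ 2.
    have xC : x \in C (phi x) by rewrite mem_set//; split => //; exact: set_mem.
    by rewrite /F/= !indicE in_setC yC xC !mulr1.
  rewrite addrCA lerDl addr_ge0// ?mulr_ge0//.
  exact: sumr_ge0.
(* [L] bounds the form for every n, so one n with transport error at most eta suffices. The
   left-hand side is itself a form, by [Kint_fst]. *)
apply/lee_addgt0Pr => eta eta0.
have [n _ hn] := vF.2 _ eta0; have {}hn := hn n (leqnn n).
have e0 := vareps_gt0 R n.
rewrite -(Kint_fst e0 mq q0).
apply: (@le_trans _ _ (Kint (vareps n) ((fun p => h p.1 * h p.2) \+ (fun p => \sum_(a <- s) F a p))%R)).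
  apply: Kint_le => //; first exact: (nneg_meas_fst mq q0).
  by apply: nneg_measD => //; case: vF.
by rewrite KintD//; [exact: leeD|case: vF].
Qed.

(** Simple functions increasing to h, cut off to cubes of half-side k, exhaust h^2 by monotone
    convergence; each stage is bounded by the preceding lemma. *)
Lemma integral_sqr_le_Kint (R : realType) d (h : d.-tuple R -> R) (L : \bar R) :
  measurable_fun setT h -> (forall x, 0 <= h x) ->
  (forall n, (Kint (vareps n) (fun p => h p.1 * h p.2)%R <= L)%E) ->
  (((2 * pi) ^+ d)%:E * \int[lebesgue d]_x (h x ^+ 2)%:E <= L)%E.
Proof.
move=> mh h0 hL.
have mhE : measurable_fun setT (EFin \o h) by exact/measurable_EFinP.
pose phi := nnsfun_approx measurableT mhE.
have h0E x : setT x -> (0 <= (EFin \o h) x)%E by move=> _; rewrite lee_fin.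
have cphi x : (fun k => phi k x) @ \oo --> h x.
  have := cvg_nnsfun_approx measurableT mhE h0E (x := x) I.
  exact: fine_cvg.
have ndphi : nondecreasing_seq (phi : nat -> d.-tuple R -> R) by exact: nd_nnsfun_approx.
have ndx x : nondecreasing_seq (fun k => phi k x) by move=> m n mn; exact/lefP/ndphi.
have phih k x : phi k x <= h x.
  rewrite -(cvg_lim _ (cphi x))//; apply: nondecreasing_cvgn_le => //.
  by apply/cvg_ex; exists (h x).
pose psi (k : nat) (x : d.-tuple R) : \bar R := (phi k x ^+ 2 * \1_(cubeco k%:R) x)%:E.
have psi0 k x : (0 <= psi k x)%E by rewrite lee_fin mulr_ge0 ?sqr_ge0 ?indic_ge0.
have mpsi k : measurable_fun setT (psi k).
  apply/measurable_EFinP; apply: measurable_funM; first by apply: measurable_funX.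
  by apply: measurable_indic; exact: measurable_cubeco.
have ndpsi x : nondecreasing_seq (psi ^~ x).
  move=> m n mn; rewrite lee_fin; apply: ler_pM; rewrite ?sqr_ge0 ?indic_ge0//.
    by rewrite ler_pXn2r ?nnegrE//; exact: ndx.
  rewrite !indicE ler_nat; case: (boolP (x \in cubeco m%:R)) => // /set_mem xm.
  rewrite mem_set// => j; have /andP[h1 h2] := xm j.
  have mn' : m%:R <= n%:R :> R by rewrite ler_nat.
  by rewrite (le_trans _ h1) ?lerN2//= (lt_le_trans h2).
have lpsi x : psi k x @[k --> \oo] --> (h x ^+ 2)%:E.
  apply/fine_cvgP; split; first by near=> k.
  have E : \forall k \near \oo, phi k x ^+ 2 = fine (psi k x).
    near=> k; rewrite /psi/= indicE mem_set ?mulr1// => j.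
    (* The l^1 norm dominates all coordinates at once, so a single threshold for k puts x into the
       cube. *)
    have : \sum_(i < d) `|tnth x i| < k%:R by near: k; exact: nbhs_infty_gtr.
    move=> xk; have : `|tnth x j| < k%:R.
      apply: le_lt_trans xk; rewrite (bigD1 j)//= lerDl; exact: sumr_ge0.
    by rewrite ltr_norml => /andP[/ltW -> ->].
  apply: cvg_trans (near_eq_cvg E) _.
  exact: (cvgM (cphi x) (cphi x)).
have := cvg_monotone_convergence (mu := lebesgue d) measurableT mpsi (fun k x _ => psi0 k x) (fun x _ => ndpsi x).
under eq_integral do rewrite (cvg_lim _ (lpsi _))//.
move=> cI.
have p0 : 0 <= (2 * pi) ^+ d :> R by rewrite exprn_ge0// mulr_ge0// pi_ge0.
have cI2 : (((2 * pi) ^+ d)%:E * \int[lebesgue d]_x psi n x)%E @[n --> \oo] -->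
    (((2 * pi) ^+ d)%:E * \int[lebesgue d]_x (h x ^+ 2)%:E)%E by exact: cvgeZl.
rewrite -(cvg_lim _ cI2)//.
apply: lime_le; first by apply/cvg_ex; eexists; exact: cI2.
near=> k; exact: (Kint_nnsfun_le k%:R mh h0 (phih k) hL).
Unshelve. all: by end_near. Qed.

(** * The Hartley transform and Plancherel's inequalities *)

Lemma wtE (R : realType) d (e : R) (u : d.-tuple R) : wt e u = expR (- (e * \sum_(j < d) `|tnth u j|)).
Proof. by rewrite /wt mulr_sumr -sumrN expR_sum. Qed.

(** The weights increase to 1, so monotone convergence turns a uniform bound on the Abel sums into a
    bound on the integral itself. *)
Lemma integral_le_wt (R : realType) d (q : d.-tuple R -> R) (L : \bar R) :
  measurable_fun setT q -> (forall u, 0 <= q u) ->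
  (forall n, (\int[lebesgue d]_u (wt (vareps n) u * q u)%:E <= L)%E) ->
  (\int[lebesgue d]_u (q u)%:E <= L)%E.
Proof.
move=> mq q0 hL.
pose psi (n : nat) (u : d.-tuple R) : \bar R := (wt (vareps n) u * q u)%:E.
have psi0 k x : (0 <= psi k x)%E by rewrite lee_fin mulr_ge0 ?wt_ge0.
have mpsi k : measurable_fun setT (psi k).
  by apply/measurable_EFinP; apply: measurable_funM => //; exact: measurable_wt.
have ndpsi x : nondecreasing_seq (psi ^~ x).
  move=> m n mn; rewrite lee_fin ler_wpM2r// !wtE ler_expR lerN2.
  rewrite ler_wpM2r ?sumr_ge0// lef_pV2 ?posrE// ler_nat ltnS//.
have lpsi x : psi k x @[k --> \oo] --> (q x)%:E.
  apply/fine_cvgP; split; first by near=> k.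
  rewrite -[q x]mul1r; apply: cvgM; last exact: cvg_cst.
  under eq_fun do rewrite wtE.
  have c0 : vareps k * \sum_(j < d) `|tnth x j| @[k --> \oo] --> 0 * \sum_(j < d) `|tnth x j|.
    by apply: cvgM; [exact: cvg_harmonic|exact: cvg_cst].
  have c : - (vareps k * \sum_(j < d) `|tnth x j|) @[k --> \oo] --> - (0 * \sum_(j < d) `|tnth x j|).
    exact: cvgN.
  have E0 : expR (- (0 * \sum_(j < d) `|tnth x j|)) = 1 by rewrite mul0r oppr0 expR0.
  by have := cvg_comp _ _ c (@continuous_expR R _); rewrite E0; exact.
have := cvg_monotone_convergence (mu := lebesgue d) measurableT mpsi (fun k x _ => psi0 k x) (fun x _ => ndpsi x).
under eq_integral do rewrite (cvg_lim _ (lpsi _))//.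
move=> cI; rewrite -(cvg_lim _ cI)//.
apply: lime_le; first by apply/cvg_ex; eexists; exact: cI.
by near=> k; exact: hL.
Unshelve. all: by end_near. Qed.

Definition hartley {R : realType} {d} (h : d.-tuple R -> R) (u : d.-tuple R) : R :=
  \int[lebesgue d]_x (h x * cas u x).

Lemma measurable_hartley (R : realType) d (h : d.-tuple R -> R) :
  measurable_fun setT h -> measurable_fun setT (hartley h).
Proof.
move=> mh.
apply: (@measurable_Rintegral_section _ _ _ _ _ (lebesgue d) (fun p => h p.2 * cas p.1 p.2)).
apply: measurable_funM; last exact: measurable_cas.
by apply: (measurableT_comp mh); exact: measurable_snd.
Qed.

Lemma measurable_casr (R : realType) d (x : d.-tuple R) : measurable_fun setT (cas ^~ x).
Proof. exact: (measurable_section2 x (@measurable_cas R d)). Qed.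

Lemma measurable_casl (R : realType) d (x : d.-tuple R) : measurable_fun setT (cas x).
Proof. exact: (measurable_section1 x (@measurable_cas R d)). Qed.

Lemma normr_Rintegral_kernel_le d (T : measurableType d) (R : realType)
    (mu : {measure set T -> \bar R}) (h k : T -> R) (C : R) :
  mu.-integrable setT (EFin \o h) -> measurable_fun setT k -> (forall x, `|k x| <= C) ->
  `|\int[mu]_x (h x * k x)| <= (\int[mu]_x `|h x|) * C.
Proof.
move=> ih mk kC.
have ihk := integrable_mulr_bounded ih mk kC.
apply: (le_trans (le_normr_Rintegral measurableT ihk)).
rewrite -RintegralZr//; last exact: integrable_norm.
apply: le_Rintegral => //.
- exact: (integrable_norm ihk).
- exact: (integrableZr measurableT C (integrable_norm ih)).
- by move=> x _; rewrite normrM ler_wpM2l.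
Qed.

(** The two factors of (H h)^2 are expanded one after the other, each followed by an exchange of
    integrals, until only the kernel integral in u is left. H h is merely bounded, so it is the
    weight that makes these exchanges legitimate. *)
Lemma hartley_wt (R : realType) d (e : R) (h : d.-tuple R -> R) : 0 < e ->
  (lebesgue d).-integrable setT (EFin \o h) ->
  (lebesgue d).-integrable setT (EFin \o (fun u => wt e u * hartley h u ^+ 2)) /\
  \int[lebesgue d]_u (wt e u * hartley h u ^+ 2) =
  \int[lebesgue d]_x (h x * \int[lebesgue d]_y (h y * kern e (tsub x y))).
Proof.
move=> e0 ih.
have mh : measurable_fun setT h by apply/measurable_EFinP; exact: measurable_int ih.
have mH := measurable_hartley mh.
pose B := (\int[lebesgue d]_x `|h x|) * 2.
have HB u : `|hartley h u| <= B.
  by apply: normr_Rintegral_kernel_le => //; [exact: measurable_casl|move=> x; exact: normr_cas_le2].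
have iwH : (lebesgue d).-integrable setT (EFin \o (fun u => wt e u * hartley h u)).
  by apply: (integrable_mulr_bounded (C := B)) => //; exact: integrable_wt.
split.
  apply: (integrable_mulr_bounded (C := B ^+ 2)); first exact: integrable_wt.
    exact: measurable_funX.
  by move=> u; rewrite normrX ler_pXn2r ?nnegrE//; exact: le_trans (HB u).
transitivity (\int[lebesgue d]_u (wt e u * hartley h u * \int[lebesgue d]_x (h x * cas u x))).
  by apply: eq_Rintegral => u _; rewrite expr2 mulrA.
rewrite (@Rintegral_kernel_swap _ _ _ _ _ (lebesgue d) (lebesgue d) _ h (fun p => cas p.1 p.2) 2)//; last 2 first.
- exact: measurable_cas.
- by move=> p; exact: normr_cas_le2.
apply: eq_Rintegral => x _; congr (_ * _).
transitivity (\int[lebesgue d]_u (wt e u * cas u x * \int[lebesgue d]_y (h y * cas u y))).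
  by apply: eq_Rintegral => u _ /=; rewrite -/(hartley h u); ring.
rewrite (@Rintegral_kernel_swap _ _ _ _ _ (lebesgue d) (lebesgue d) _ h (fun p => cas p.1 p.2) 2)//; last 3 first.
- apply: (integrable_mulr_bounded (C := 2)); first exact: integrable_wt.
    exact: measurable_casr.
  by move=> u; exact: normr_cas_le2.
- exact: measurable_cas.
- by move=> p; exact: normr_cas_le2.
apply: eq_Rintegral => y _; congr (_ * _).
exact: Rintegral_wt_cas_cas.
Qed.

Lemma integrable_mul_kern (R : realType) d (e : R) (h : d.-tuple R -> R) (x : d.-tuple R) : 0 < e ->
  (lebesgue d).-integrable setT (EFin \o h) ->
  (lebesgue d).-integrable setT (EFin \o (fun y => h y * kern e (tsub x y))).
Proof.
move=> e0 ih; apply: (integrable_mulr_bounded (C := (2 / e) ^+ d)) => //.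
  by apply: (measurableT_comp (measurable_kern e0)); exact: measurable_tsubr.
by move=> y; exact: kern_le.
Qed.

Lemma Kint_mul (R : realType) d (e : R) (h : d.-tuple R -> R) : 0 < e ->
  (lebesgue d).-integrable setT (EFin \o h) -> (forall x, 0 <= h x) ->
  Kint e (fun p => h p.1 * h p.2) =
  (\int[lebesgue d]_x (h x * \int[lebesgue d]_y (h y * kern e (tsub x y)))%:E)%E.
Proof.
move=> e0 ih h0; have mh : measurable_fun setT h by apply/measurable_EFinP; exact: measurable_int ih.
rewrite Kint_iter//; last by apply: nneg_measM; [exact: nneg_meas_fst|exact: nneg_meas_snd].
apply: eq_integral => x _ /=.
rewrite EFinM /Rintegral fineK; last exact: (integrable_fin_num measurableT (integrable_mul_kern x e0 ih)).
rewrite -ge0_integralZl//; last 3 first.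
- by case/integrableP: (integrable_mul_kern x e0 ih).
- by move=> y _; rewrite lee_fin mulr_ge0// kern_ge0.
- by rewrite lee_fin.
by apply: eq_integral => y _; rewrite -EFinM mulrA.
Qed.

(** h(x) h(y) is at most half the sum of the squares. The halves have equal forms because the kernel
    is symmetric, and integrating out one point gives (2 pi)^d. *)
Lemma Kint_mul_le (R : realType) d (e : R) (h : d.-tuple R -> R) : 0 < e ->
  measurable_fun setT h -> (forall x, 0 <= h x) ->
  (Kint e (fun p => h p.1 * h p.2)%R <= ((2 * pi) ^+ d)%:E * \int[lebesgue d]_x (h x ^+ 2)%:E)%E.
Proof.
move=> e0 mh h0.
pose q x := 2^-1 * h x ^+ 2.
have mq : measurable_fun setT q by apply: measurable_funM => //; exact: measurable_funX.
have q0 x : 0 <= q x by rewrite mulr_ge0// sqr_ge0.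
have n1 : nneg_meas (fun p : d.-tuple R * d.-tuple R => q p.1) by exact: nneg_meas_fst.
have n2 : nneg_meas (fun p : d.-tuple R * d.-tuple R => q p.2) by exact: nneg_meas_snd.
apply: (@le_trans _ _ (Kint e ((fun p => q p.1) \+ (fun p => q p.2))%R)).
  apply: Kint_le => //; [by apply: nneg_measM; [exact: nneg_meas_fst|exact: nneg_meas_snd]|exact: nneg_measD|].
  move=> [x y] /=; rewrite /q; have := sqr_ge0 (h x - h y); nra.
rewrite KintD// (Kint_swap e0 n1) (Kint_fst e0 mq q0).
set I := (\int[lebesgue d]_x (h x ^+ 2)%:E)%E.
have I0 : (0 <= I)%E by apply: integral_ge0 => x _; rewrite lee_fin sqr_ge0.
have -> : (\int[lebesgue d]_x (q x)%:E = (2^-1)%:E * I)%E.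
  rewrite /I -ge0_integralZl_EFin//; first by move=> x _; rewrite lee_fin sqr_ge0.
  by apply/measurable_EFinP; exact: measurable_funX.
rewrite -ge0_muleDr ?mule_ge0 ?lee_fin//.
by rewrite -ge0_muleDl ?lee_fin// -EFinD (_ : 2^-1 + 2^-1 = 1) ?mul1e//; field.
Qed.

Lemma EFin_Rintegral d (T : measurableType d) (R : realType)
    (mu : {measure set T -> \bar R}) (f : T -> R) :
  mu.-integrable setT (EFin \o f) -> ((\int[mu]_x f x)%:E = \int[mu]_x (f x)%:E)%E.
Proof. by move=> fi; rewrite /Rintegral fineK//; exact: integrable_fin_num. Qed.

Lemma integrable_kern_form (R : realType) d (e : R) (h : d.-tuple R -> R) : 0 < e ->
  (lebesgue d).-integrable setT (EFin \o h) ->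
  (lebesgue d).-integrable setT (EFin \o (fun x => h x * \int[lebesgue d]_y (h y * kern e (tsub x y)))).
Proof.
move=> e0 ih; have mh : measurable_fun setT h by apply/measurable_EFinP; exact: measurable_int ih.
apply: (integrable_mulr_bounded (C := (\int[lebesgue d]_x `|h x|) * (2 / e) ^+ d)) => //.
  apply: (@measurable_Rintegral_section _ _ _ _ _ (lebesgue d) (fun p : d.-tuple R * d.-tuple R => h p.2 * kern e (tsub p.1 p.2))).
  apply: measurable_funM; last exact: measurable_kern_tsub.
  by apply: (measurableT_comp mh); exact: measurable_snd.
move=> x; apply: normr_Rintegral_kernel_le => //.
  by apply: (measurableT_comp (measurable_kern e0)); exact: measurable_tsubr.
by move=> y; exact: kern_le.
Qed.

(** Signed functions must be covered, as the bound is applied to the cut transform. The kernel is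
    nonnegative, so replacing h by |h| only increases the form. *)
Lemma hartley_Plancherel_le (R : realType) d (h : d.-tuple R -> R) :
  (lebesgue d).-integrable setT (EFin \o h) ->
  (\int[lebesgue d]_u (hartley h u ^+ 2)%:E <=
   ((2 * pi) ^+ d)%:E * \int[lebesgue d]_x (h x ^+ 2)%:E)%E.
Proof.
move=> ih; have mh : measurable_fun setT h by apply/measurable_EFinP; exact: measurable_int ih.
have mH := measurable_hartley mh.
apply: integral_le_wt; [exact: measurable_funX|by move=> u; exact: sqr_ge0|move=> n].
have e0 := vareps_gt0 R n.
have [iwH wH] := hartley_wt e0 ih.
have ia : (lebesgue d).-integrable setT (EFin \o (fun x => `|h x|)) by exact: (integrable_norm ih).
have ma : measurable_fun setT (fun x => `|h x|) by exact: measurableT_comp.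
rewrite -(EFin_Rintegral iwH) wH.
under [in X in (_ <= X)%E]eq_integral do rewrite -real_normK ?num_real//.
apply: le_trans (Kint_mul_le e0 ma (fun x => normr_ge0 _)).
rewrite (Kint_mul e0 ia)// -(EFin_Rintegral (integrable_kern_form e0 ia)) lee_fin.
apply: le_Rintegral => //; [exact: integrable_kern_form|exact: integrable_kern_form|].
move=> x _; rewrite (le_trans (ler_norm _))// normrM ler_wpM2l//.
apply: (le_trans (le_normr_Rintegral measurableT (integrable_mul_kern x e0 ih))).
apply: le_Rintegral => //.
- exact: (integrable_norm (integrable_mul_kern x e0 ih)).
- exact: integrable_mul_kern.
- by move=> y _; rewrite normrM [`|kern _ _|]ger0_norm// kern_ge0.
Qed.

(** The weight is at most 1, so the full integral bounds the Abel sums for all n; for h >= 0 these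
    are the forms that [integral_sqr_le_Kint] takes. *)
Lemma hartley_Plancherel_ge (R : realType) d (h : d.-tuple R -> R) :
  (lebesgue d).-integrable setT (EFin \o h) -> (forall x, 0 <= h x) ->
  (((2 * pi) ^+ d)%:E * \int[lebesgue d]_x (h x ^+ 2)%:E <=
   \int[lebesgue d]_u (hartley h u ^+ 2)%:E)%E.
Proof.
move=> ih h0; have mh : measurable_fun setT h by apply/measurable_EFinP; exact: measurable_int ih.
have mH := measurable_hartley mh.
apply: integral_sqr_le_Kint => // n; have e0 := vareps_gt0 R n.
have [iwH wH] := hartley_wt e0 ih.
rewrite (Kint_mul e0 ih h0) -(EFin_Rintegral (integrable_kern_form e0 ih)) -wH (EFin_Rintegral iwH).
apply: ge0_le_integral => //.
- by move=> u _; rewrite lee_fin mulr_ge0 ?wt_ge0 ?sqr_ge0.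
- by case/integrableP: iwH.
- by apply/measurable_EFinP; exact: measurable_funX.
- move=> u _; rewrite lee_fin ler_piMl ?sqr_ge0// wtE -expR0 ler_expR oppr_le0.
  by rewrite mulr_ge0 ?(ltW e0)// sumr_ge0.
Qed.

(** * Truncated inversion on cubes and its L^2 error *)

Lemma indic_cube (R : realType) d (A : R) (x : d.-tuple R) :
  \1_(cube A) x = \prod_(j < d) \1_`[- A, A] (tnth x j) :> R.
Proof.
have [xB|xB] := pselect (cube A x).
  rewrite indicE mem_set// big1// => j _; rewrite indicE mem_set//=.
  by rewrite in_itv/= xB.
rewrite indicE memNset//.
move/existsNP : (xB) => [j hj]; rewrite (bigD1 j)//= [X in X * _]indicE memNset ?mul0r//=.
Qed.

Lemma measurable_cube (R : realType) d (A : R) : measurable (@cube R d A).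
Proof.
have mp : measurable_fun setT (fun x : d.-tuple R => \prod_(j < d) (\1_`[- A, A] (tnth x j) : R)).
  by apply: (@measurable_prod_tnth R d (fun=> \1_`[- A, A])) => j; exact: measurable_indic.
rewrite (_ : cube A = setT `&` (fun x : d.-tuple R => \prod_(j < d) (\1_`[- A, A] (tnth x j) : R)) @^-1` [set 1]).
  exact: mp.
rewrite setTI; apply/seteqP; split => x /=; rewrite -indic_cube indicE.
  by move=> /mem_set ->.
by case: (boolP (x \in cube A)) => [/set_mem//|_ /esym/eqP]; rewrite oner_eq0.
Qed.

Lemma lebesgue_cube_lty (R : realType) d (A : R) : (lebesgue d (cube A) < +oo)%E.
Proof.
apply: le_lt_trans (lebesgue_box_lty (fun=> - A) (fun=> A + 1)).
apply: le_measure; rewrite ?inE; [exact: measurable_cube|exact: measurable_box|].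
by move=> x xA j; have /andP[-> h] := xA j; rewrite (le_lt_trans h)// ltrDl.
Qed.

Lemma subset_cube (R : realType) d (A B : R) : A <= B -> @cube R d A `<=` cube B.
Proof.
move=> AB x xA j; have /andP[h1 h2] := xA j.
by rewrite (le_trans _ h1) ?lerN2//= (le_trans h2).
Qed.

Lemma integrable_indic_mul d (T : measurableType d) (R : realType)
    (mu : {measure set T -> \bar R}) (A : set T) (f : T -> R) (C : R) :
  measurable A -> (mu A < +oo)%E -> measurable_fun setT f -> (forall x, `|f x| <= C) ->
  mu.-integrable setT (EFin \o (fun x => \1_A x * f x)).
Proof.
move=> mA Aoo mf fC; apply: (integrable_mulr_bounded (C := C)) => //.
apply/integrableP; split; first by apply/measurable_EFinP; exact: measurable_indic.
under eq_integral do rewrite /= ger0_norm ?indic_ge0//.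
by rewrite integral_indic// setIT.
Qed.

Definition hartley_cut {R : realType} {d} (A : R) (G : d.-tuple R -> R) (u : d.-tuple R) : R :=
  \1_(cube A) u * hartley G u.

(** The Hartley transform is its own inverse up to the factor (2 pi)^d, so the same kernel is used
    to invert. *)
Definition trunc {R : realType} {d} (A : R) (G : d.-tuple R -> R) (s : d.-tuple R) : R :=
  (2 * pi) ^- d * hartley (hartley_cut A G) s.

Lemma hartley_bound (R : realType) d (G : d.-tuple R -> R) (u : d.-tuple R) :
  (lebesgue d).-integrable setT (EFin \o G) ->
  `|hartley G u| <= (\int[lebesgue d]_x `|G x|) * 2.
Proof.
move=> iG; apply: normr_Rintegral_kernel_le => //.
  exact: measurable_casl.
by move=> x; exact: normr_cas_le2.
Qed.

Lemma integrable_hartley_cut (R : realType) d (A : R) (G : d.-tuple R -> R) :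
  (lebesgue d).-integrable setT (EFin \o G) ->
  (lebesgue d).-integrable setT (EFin \o hartley_cut A G).
Proof.
move=> iG; have mG : measurable_fun setT G by apply/measurable_EFinP; exact: measurable_int iG.
apply: (integrable_indic_mul (C := (\int[lebesgue d]_x `|G x|) * 2)).
- exact: measurable_cube.
- exact: lebesgue_cube_lty.
- exact: measurable_hartley.
- by move=> u; exact: hartley_bound.
Qed.

Lemma integrable_sqr_EFin d (T : measurableType d) (R : realType)
    (mu : {measure set T -> \bar R}) (f : T -> R) :
  measurable_fun setT f -> (\int[mu]_x (f x ^+ 2)%:E < +oo)%E ->
  mu.-integrable setT (EFin \o (fun x => f x ^+ 2)).
Proof.
move=> mf foo; apply/integrableP; split; first by apply/measurable_EFinP; exact: measurable_funX.
by under eq_integral do rewrite /= ger0_norm ?sqr_ge0//.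
Qed.

Lemma integrable_sqr_hartley (R : realType) d (G : d.-tuple R -> R) :
  (lebesgue d).-integrable setT (EFin \o G) ->
  (lebesgue d).-integrable setT (EFin \o (fun x => G x ^+ 2)) ->
  (lebesgue d).-integrable setT (EFin \o (fun u => hartley G u ^+ 2)).
Proof.
move=> iG iG2; have mG : measurable_fun setT G by apply/measurable_EFinP; exact: measurable_int iG.
apply: integrable_sqr_EFin; first exact: measurable_hartley.
apply: (le_lt_trans (hartley_Plancherel_le iG)).
by rewrite -(EFin_Rintegral iG2) -EFinM ltry.
Qed.

Lemma Rintegral_hartley_le (R : realType) d (G : d.-tuple R -> R) :
  (lebesgue d).-integrable setT (EFin \o G) ->
  (lebesgue d).-integrable setT (EFin \o (fun x => G x ^+ 2)) ->
  \int[lebesgue d]_u (hartley G u ^+ 2) <= (2 * pi) ^+ d * \int[lebesgue d]_x (G x ^+ 2).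
Proof.
move=> iG iG2; have := hartley_Plancherel_le iG.
by rewrite -(EFin_Rintegral iG2) -(EFin_Rintegral (integrable_sqr_hartley iG iG2)) -EFinM lee_fin.
Qed.

Lemma integrable_sqr_hartley_cut (R : realType) d (A : R) (G : d.-tuple R -> R) :
  (lebesgue d).-integrable setT (EFin \o G) ->
  (lebesgue d).-integrable setT (EFin \o (fun x => G x ^+ 2)) ->
  (lebesgue d).-integrable setT (EFin \o (fun u => hartley_cut A G u ^+ 2)).
Proof.
move=> iG iG2; have mG : measurable_fun setT G by apply/measurable_EFinP; exact: measurable_int iG.
apply: le_integrable (integrable_sqr_hartley iG iG2) => //.
  by apply/measurable_EFinP; apply: measurable_funX; apply/measurable_EFinP; exact: measurable_int (integrable_hartley_cut A iG).
move=> u _ /=; rewrite lee_fin !ger0_norm ?sqr_ge0// /hartley_cut exprMn ler_piMl ?sqr_ge0//.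
Qed.

(** The square is expanded. In the cross term, symmetry of [cas] moves the transform onto G, and an
    indicator equals its square, so the integral of the squared cut transform appears. The square of
    [trunc] is bounded by the upper Plancherel inequality for the cut transform, which cancels half
    of the cross term. *)
Lemma trunc_error (R : realType) d (A : R) (G : d.-tuple R -> R) :
  (lebesgue d).-integrable setT (EFin \o G) ->
  (lebesgue d).-integrable setT (EFin \o (fun x => G x ^+ 2)) ->
  (lebesgue d).-integrable setT (EFin \o (fun s => trunc A G s ^+ 2)) /\
  (lebesgue d).-integrable setT (EFin \o (fun s => (trunc A G s - G s) ^+ 2)) /\
  \int[lebesgue d]_s ((trunc A G s - G s) ^+ 2) <=
  \int[lebesgue d]_s (G s ^+ 2) - (2 * pi) ^- d * \int[lebesgue d]_u (hartley_cut A G u ^+ 2).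
Proof.
move=> iG iG2; have mG : measurable_fun setT G by apply/measurable_EFinP; exact: measurable_int iG.
have ih := integrable_hartley_cut A iG; have ih2 := integrable_sqr_hartley_cut A iG iG2.
have mh : measurable_fun setT (hartley_cut A G) by apply/measurable_EFinP; exact: measurable_int ih.
have p0 : 0 < (2 * pi) ^+ d :> R by rewrite exprn_gt0// mulr_gt0// pi_gt0.
set D := (2 * pi) ^- d.
have D0 : 0 <= D by rewrite invr_ge0 ltW.
have iH2 := integrable_sqr_hartley ih ih2.
have E1 : (fun s => trunc A G s ^+ 2) = (fun s => D ^+ 2 * hartley (hartley_cut A G) s ^+ 2).
  by apply/funext => s; rewrite /trunc exprMn.
have iF2 : (lebesgue d).-integrable setT (EFin \o (fun s => trunc A G s ^+ 2)).
  by rewrite E1; exact: (integrableZl measurableT (D ^+ 2) iH2).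
have iGH : (lebesgue d).-integrable setT (EFin \o (fun s => G s * hartley (hartley_cut A G) s)).
  apply: (integrable_mulr_bounded (C := (\int[lebesgue d]_x `|hartley_cut A G x|) * 2)) => //.
    exact: measurable_hartley.
  by move=> s; exact: hartley_bound.
have EE : (fun s => (trunc A G s - G s) ^+ 2) =
    (fun s => trunc A G s ^+ 2 - 2 * D * (G s * hartley (hartley_cut A G) s) + G s ^+ 2).
  by apply/funext => s; rewrite /trunc -/D; ring.
have iM := integrableZl measurableT (2 * D) iGH.
have iB : (lebesgue d).-integrable setT (EFin \o (fun s => trunc A G s ^+ 2 - 2 * D * (G s * hartley (hartley_cut A G) s))).
  exact: (integrableB measurableT iF2 iM).
split => //; split; first by rewrite EE; exact: (integrableD measurableT iB iG2).
rewrite EE RintegralD// RintegralB// RintegralZl//.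
have -> : \int[lebesgue d]_s (G s * hartley (hartley_cut A G) s) = \int[lebesgue d]_u (hartley_cut A G u ^+ 2).
  rewrite (@Rintegral_kernel_swap _ _ _ _ _ (lebesgue d) (lebesgue d) G (hartley_cut A G) (fun p => cas p.1 p.2) 2)//; last 2 first.
  - exact: measurable_cas.
  - by move=> p; exact: normr_cas_le2.
  apply: eq_Rintegral => u _.
  transitivity (hartley_cut A G u * hartley G u).
    by congr (_ * _); apply: eq_Rintegral => x _; rewrite /= casC.
  rewrite /hartley_cut indicE; case: (_ \in _); rewrite ?mul1r ?expr2//.
  by rewrite !mul0r.
rewrite E1 RintegralZl//.
have := Rintegral_hartley_le ih ih2.
set a := \int[_]_s (hartley _ s ^+ 2); set b := \int[_]_u (hartley_cut A G u ^+ 2); set c := \int[_]_s (G s ^+ 2).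
move=> ab.
have : D ^+ 2 * a <= D * b.
  rewrite expr2 -mulrA ler_wpM2l//.
  apply: (@le_trans _ _ (D * ((2 * pi) ^+ d * b))); first by rewrite ler_wpM2l.
  by rewrite mulrA /D mulVf ?mul1r// gt_eqF.
lra.
Qed.

(** Monotone convergence along integer cubes brings the truncated energy up to that of the whole
    transform, which dominates (2 pi)^d |G|^2 by the lower Plancherel inequality. Real A follow
    because the energy grows with the cube. *)
Lemma near_trunc_error (R : realType) d (G : d.-tuple R -> R) (eta : R) : 0 < eta ->
  (lebesgue d).-integrable setT (EFin \o G) ->
  (lebesgue d).-integrable setT (EFin \o (fun x => G x ^+ 2)) ->
  (forall x, 0 <= G x) ->
  \forall A \near +oo, \int[lebesgue d]_s ((trunc A G s - G s) ^+ 2) <= eta.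
Proof.
move=> eta0 iG iG2 G0; have mG : measurable_fun setT G by apply/measurable_EFinP; exact: measurable_int iG.
have p0 : 0 < (2 * pi) ^+ d :> R by rewrite exprn_gt0// mulr_gt0// pi_gt0.
have mH := measurable_hartley mG.
pose psi (n : nat) (u : d.-tuple R) : \bar R := (hartley_cut n%:R G u ^+ 2)%:E.
have psi0 k x : (0 <= psi k x)%E by rewrite lee_fin sqr_ge0.
have mpsi k : measurable_fun setT (psi k).
  by apply/measurable_EFinP; apply: measurable_funX; apply/measurable_EFinP; exact: measurable_int (integrable_hartley_cut _ iG).
have cutmono (A B : R) x : A <= B -> hartley_cut A G x ^+ 2 <= hartley_cut B G x ^+ 2.
  move=> AB; rewrite /hartley_cut !exprMn ler_wpM2r ?sqr_ge0// !indicE.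
  case: (boolP (x \in cube A)) => [/set_mem xA|_]; last by rewrite expr0n sqr_ge0.
  by rewrite mem_set//; exact: (subset_cube AB).
have ndpsi x : nondecreasing_seq (psi ^~ x).
  by move=> m n mn; rewrite lee_fin cutmono// ler_nat.
have lpsi x : psi k x @[k --> \oo] --> (hartley G x ^+ 2)%:E.
  apply: cvg_near_cst; near=> k; rewrite /psi /hartley_cut indicE mem_set ?mul1r// => j.
  have : \sum_(i < d) `|tnth x i| < k%:R by near: k; exact: nbhs_infty_gtr.
  move=> xk; have : `|tnth x j| < k%:R.
    apply: le_lt_trans xk; rewrite (bigD1 j)//= lerDl; exact: sumr_ge0.
  by rewrite ltr_norml => /andP[/ltW -> /ltW ->].
have := cvg_monotone_convergence (mu := lebesgue d) measurableT mpsi (fun k x _ => psi0 k x) (fun x _ => ndpsi x).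
under eq_integral do rewrite (cvg_lim _ (lpsi _))//.
have iH2 := integrable_sqr_hartley iG iG2.
rewrite -(EFin_Rintegral iH2).
under eq_fun do rewrite -(EFin_Rintegral (integrable_sqr_hartley_cut _ iG iG2)).
move=> /fine_cvg /= cI.
have ge : (2 * pi) ^+ d * \int[lebesgue d]_x (G x ^+ 2) <= \int[lebesgue d]_u (hartley G u ^+ 2).
  have := hartley_Plancherel_ge iG G0.
  by rewrite -(EFin_Rintegral iG2) -(EFin_Rintegral iH2) -EFinM lee_fin.
(* The deficit of energy is divided by (2 pi)^d in the error bound, hence this tolerance. *)
have e1 : 0 < eta * (2 * pi) ^+ d by rewrite mulr_gt0.
have /cvgrPdist_le /(_ _ e1) [N _ hN] := cI.
near=> A.
have NA : N%:R <= A by near: A; exact: nbhs_pinfty_ge.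
have [_ [_ /le_trans]] := trunc_error A iG iG2; apply.
have b1 : \int[lebesgue d]_u (hartley_cut N%:R G u ^+ 2) <= \int[lebesgue d]_u (hartley_cut A G u ^+ 2).
  by apply: le_Rintegral => //; [exact: integrable_sqr_hartley_cut|exact: integrable_sqr_hartley_cut|move=> x _; exact: cutmono].
have := hN N (leqnn N); rewrite /= ler_norml => /andP[_ h2].
move: b1 h2 ge; set a := \int[_]_x (G x ^+ 2); set b := \int[_]_u (hartley_cut A _ _ ^+ 2).
set c := \int[_]_u (hartley _ _ ^+ 2); set b' := \int[_]_u _ => b1 h2 ge.
clear cI hN e1; move: ((2 * pi) ^+ d) p0 h2 ge => q p0 h2 ge.
have h3 : a <= (b + eta * q) / q by rewrite ler_pdivlMr// mulrC; lra.
by move: h3; rewrite mulrDl mulfK ?gt_eqF// [b / _]mulrC; lra.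
Unshelve. all: by end_near. Qed.

(* No integrability is needed: [fine] sends an infinite integral to [0] on both sides. *)
Lemma ge0_RintegralZr d (T : measurableType d) (R : realType)
    (mu : {measure set T -> \bar R}) (f : T -> R) (c : R) :
  measurable_fun setT f -> (forall x, 0 <= f x) ->
  \int[mu]_x (f x * c) = (\int[mu]_x f x) * c.
Proof.
move=> mf f0.
have mfE : measurable_fun setT (EFin \o f) by exact/measurable_EFinP.
have [foo|] := boolP (\int[mu]_x (f x)%:E < +oo)%E.
  rewrite RintegralZr//; apply/integrableP; split => //.
  by under eq_integral do rewrite /= ger0_norm//.
rewrite -leNgt leye_eq => /eqP foo.
have pos (c' : R) : 0 < c' -> (\int[mu]_x (f x * c')%:E = +oo)%E.
  move=> c0; under eq_integral do rewrite EFinM.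
  rewrite ge0_integralZr//; last 2 first.
  - by move=> x _; rewrite lee_fin.
  - by rewrite lee_fin ltW.
  by rewrite foo gt0_mulye// lte_fin.
rewrite /Rintegral foo/= mul0r.
have [c0|c0|->] := ltgtP c 0.
- have -> : (\int[mu]_x (f x * c)%:E = - \int[mu]_x (f x * (- c))%:E)%E.
    rewrite -integral_ge0N; last by move=> x _; rewrite lee_fin mulr_ge0// oppr_ge0 ltW.
    by apply: eq_integral => x _; rewrite -EFinN mulrN opprK.
  by rewrite pos ?oppr_gt0.
- by rewrite pos.
- by under eq_integral do rewrite mulr0; rewrite integral0.
Qed.

(** * Averages of translates under a finite measure with density [kap] *)

Section smear.
Context {R : realType} {d : nat} {dO : measure_display} {Omega : measurableType dO}.
Variables (P : {sigma_finite_measure set Omega -> \bar R}) (X : Omega -> d.-tuple R) (kap : Omega -> R).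
Hypotheses (mX : measurable_fun setT X) (mkap : measurable_fun setT kap)
  (kap0 : forall w, 0 <= kap w) (ikap : P.-integrable setT (EFin \o kap)).

(** [kap] stands for exp <R, X_T>. At points s where the integral is infinite the value is 0. *)
Definition smear (g : d.-tuple R -> R) (s : d.-tuple R) : R :=
  \int[P]_w (kap w * g (tsub (X w) s)).

Lemma measurable_smear_fun (g : d.-tuple R -> R) : measurable_fun setT g ->
  measurable_fun setT (fun p : Omega * d.-tuple R => kap p.1 * g (tsub (X p.1) p.2)).
Proof.
move=> mg; apply: measurable_funM; first by apply: (measurableT_comp mkap); exact: measurable_fst.
apply: (measurableT_comp mg); apply: measurable_tsub; last exact: measurable_snd.
by apply: (measurableT_comp mX); exact: measurable_fst.
Qed.

(** For each w the integral over s equals int g by reflection, whatever X w is. *)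
Lemma smear_tonelli (g : d.-tuple R -> R) : measurable_fun setT g -> (forall x, 0 <= g x) ->
  (\int[P]_w \int[lebesgue d]_s (kap w * g (tsub (X w) s))%:E =
   (\int[P]_w kap w)%:E * \int[lebesgue d]_x (g x)%:E)%E.
Proof.
move=> mg g0; rewrite (EFin_Rintegral ikap) -ge0_integralZr//; last 3 first.
- exact/measurable_EFinP.
- by move=> w _; rewrite lee_fin.
- by apply: integral_ge0 => x _; rewrite lee_fin.
apply: eq_integral => w _.
rewrite -(ge0_integral_reflect (X w) (f := fun x => (g x)%:E)); last 2 first.
- exact/measurable_EFinP.
- by move=> x; rewrite lee_fin.
rewrite -ge0_integralZl//; last 3 first.
- by apply/measurable_EFinP; apply: (measurableT_comp mg); exact: measurable_tsubr.
- by move=> s _; rewrite lee_fin.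
- by rewrite lee_fin.
Qed.

Lemma integrable_smear_fun (g : d.-tuple R -> R) : (forall x, 0 <= g x) ->
  (lebesgue d).-integrable setT (EFin \o g) ->
  (P \x lebesgue d)%E.-integrable setT (EFin \o (fun p => kap p.1 * g (tsub (X p.1) p.2))).
Proof.
move=> g0 ig; have mg : measurable_fun setT g by apply/measurable_EFinP; exact: measurable_int ig.
have mF : measurable_fun setT (EFin \o (fun p : Omega * d.-tuple R => kap p.1 * g (tsub (X p.1) p.2))).
  by apply/measurable_EFinP; exact: measurable_smear_fun.
apply/(integrable12ltyP P (lebesgue d) mF).
under eq_integral => w _.
  under eq_integral => s _ do rewrite /= ger0_norm ?mulr_ge0//.
  over.
by rewrite smear_tonelli// -(EFin_Rintegral ig) -EFinM ltry.
Qed.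

Lemma integrable_smear (g : d.-tuple R -> R) : (forall x, 0 <= g x) ->
  (lebesgue d).-integrable setT (EFin \o g) ->
  (lebesgue d).-integrable setT (EFin \o smear g).
Proof.
move=> g0 ig.
exact: (integrable_fine (integrable_fubini_G (integrable_smear_fun g0 ig))).1.
Qed.

Lemma ae_smear_lty (g : d.-tuple R -> R) : (forall x, 0 <= g x) ->
  (lebesgue d).-integrable setT (EFin \o g) ->
  {ae lebesgue d, forall s, (\int[P]_w (kap w * g (tsub (X w) s))%:E < +oo)%E}.
Proof.
move=> g0 ig.
have := integrable_ae measurableT (integrable_fubini_G (integrable_smear_fun g0 ig)).
apply: filterS => s /(_ I); rewrite ge0_fin_numE//.
by apply: integral_ge0 => w _; rewrite lee_fin mulr_ge0.
Qed.

(** Cauchy-Schwarz for the measure with density [kap], read off from the AM-GM inequality with the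
    kernel kap(x) kap(y) and both functions equal. *)
Lemma smear_sqr_le (g : d.-tuple R -> R) (s : d.-tuple R) : measurable_fun setT g -> (forall x, 0 <= g x) ->
  ((smear g s ^+ 2)%:E <=
   (\int[P]_w kap w)%:E * \int[P]_w (kap w * g (tsub (X w) s) ^+ 2)%:E)%E.
Proof.
move=> mg g0; set m := \int[P]_w kap w.
have m0 : 0 <= m by apply: Rintegral_ge0.
have ma : measurable_fun setT (fun w => g (tsub (X w) s)).
  by apply: (measurableT_comp mg); apply: measurable_tsub => //; exact: measurable_cst.
have ma2 : measurable_fun setT (fun w => g (tsub (X w) s) ^+ 2) by exact: measurable_funX.
have rhs0 : (0 <= m%:E * \int[P]_w (kap w * g (tsub (X w) s) ^+ 2)%:E)%E.
  by rewrite mule_ge0 ?lee_fin// integral_ge0// => w _; rewrite lee_fin mulr_ge0// sqr_ge0.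
have mkg : measurable_fun setT (fun w => (kap w * g (tsub (X w) s))%:E).
  by apply/measurable_EFinP; exact: measurable_funM.
have kg0 w : (0 <= (kap w * g (tsub (X w) s))%:E)%E by rewrite lee_fin mulr_ge0.
(* If the integral is infinite, [smear] is 0 at this point and the bound is trivial. *)
have [foo|] := boolP (\int[P]_w (kap w * g (tsub (X w) s))%:E < +oo)%E; last first.
  by rewrite -leNgt leye_eq /smear /Rintegral => /eqP -> /=; rewrite expr0n.
have sE : ((smear g s)%:E = \int[P]_w (kap w * g (tsub (X w) s))%:E)%E.
  by rewrite /smear /Rintegral fineK// ge0_fin_numE// integral_ge0.
have mk : measurable_fun setT (fun p : Omega * Omega => kap p.1 * kap p.2).
  by apply: measurable_funM; [apply: (measurableT_comp mkap); exact: measurable_fst|apply: (measurableT_comp mkap); exact: measurable_snd].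
have k0 (p : Omega * Omega) : 0 <= kap p.1 * kap p.2 by rewrite mulr_ge0.
have := @integral_kernel_AMGM _ _ _ _ _ P P _ _ (fun p => kap p.1 * kap p.2) ma ma mk
  (fun w => g0 _) (fun w => g0 _) k0.
have -> : (\int[P]_x \int[P]_y (g (tsub (X x) s) * g (tsub (X y) s) * (kap (x, y).1 * kap (x, y).2))%:E =
    (smear g s ^+ 2)%:E)%E.
  rewrite expr2 EFinM {1}sE -ge0_integralZr//; last by rewrite lee_fin; apply: Rintegral_ge0 => w _; rewrite mulr_ge0.
  apply: eq_integral => x _; rewrite sE -ge0_integralZl//.
  by apply: eq_integral => y _; rewrite -EFinM /=; congr EFin; ring.
have E (F : Omega -> Omega -> \bar R) : (forall x y, F x y = (kap x * kap y)%:E) ->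
    (\int[P]_x ((g (tsub (X x) s) ^+ 2)%:E * \int[P]_y F x y) =
     m%:E * \int[P]_w (kap w * g (tsub (X w) s) ^+ 2)%:E)%E.
  move=> FE; rewrite -ge0_integralZl//; last 2 first.
  - by apply/measurable_EFinP; exact: measurable_funM.
  - by move=> w _; rewrite lee_fin mulr_ge0// sqr_ge0.
  apply: eq_integral => x _.
  under eq_integral do rewrite FE EFinM.
  rewrite ge0_integralZl//; last 3 first.
  - exact/measurable_EFinP.
  - by move=> y _; rewrite lee_fin.
  - by rewrite lee_fin.
  by rewrite -(EFin_Rintegral ikap) -!EFinM; congr EFin; rewrite /m; ring.
rewrite (E (fun x y => (kap (x, y).1 * kap (x, y).2)%:E))//.
rewrite (E (fun x y => (kap (y, x).1 * kap (y, x).2)%:E)); last by move=> x y /=; rewrite mulrC.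
rewrite -mule2n -mule_natl lee_pmul2l//.
Qed.

(** Integrating the pointwise bound over s leaves the total mass times the integral of the averaged
    g^2, which is finite by Tonelli. *)
Lemma integrable_smear_sqr (g : d.-tuple R -> R) : (forall x, 0 <= g x) ->
  (lebesgue d).-integrable setT (EFin \o g) ->
  (lebesgue d).-integrable setT (EFin \o (fun x => g x ^+ 2)) ->
  (lebesgue d).-integrable setT (EFin \o (fun s => smear g s ^+ 2)).
Proof.
move=> g0 ig ig2; have mg : measurable_fun setT g by apply/measurable_EFinP; exact: measurable_int ig.
have ms : measurable_fun setT (smear g).
  by apply/measurable_EFinP; exact: measurable_int (integrable_smear g0 ig).
have mg2 : measurable_fun setT (fun x => g x ^+ 2) by exact: measurable_funX.
have g20 x : 0 <= g x ^+ 2 by exact: sqr_ge0.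
have iF := integrable_smear_fun g20 ig2.
have iG := integrable_fubini_G iF.
apply: integrable_sqr_EFin => //.
set m := \int[P]_w kap w.
have m0 : 0 <= m by apply: Rintegral_ge0.
apply: (@le_lt_trans _ _ (\int[lebesgue d]_s (m%:E * fubini_G P (EFin \o (fun p => (kap p.1 * g (tsub (X p.1) p.2) ^+ 2)%R)) s))%E).
  apply: ge0_le_integral => //.
  - by move=> s _; rewrite lee_fin sqr_ge0.
  - by apply/measurable_EFinP; exact: measurable_funX.
  - by apply: measurable_funeM; exact: measurable_int iG.
  - by move=> s _; exact: smear_sqr_le.
rewrite integralZl//; have := integrable_fin_num measurableT iG.
by move=> /fineK <-; rewrite -EFinM ltry.
Qed.

Lemma Rintegral_reflect_kernel (x : d.-tuple R) (h k : d.-tuple R -> R) :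
  measurable_fun setT h -> measurable_fun setT k ->
  \int[lebesgue d]_s (h (tsub x s) * k s) = \int[lebesgue d]_y (h y * k (tsub x y)).
Proof.
move=> mh mk; rewrite /Rintegral; congr fine.
rewrite -(integral_reflect x (f := fun y => (h y * k (tsub x y))%:E)).
  apply: eq_integral => s _; congr (_ * k _)%:E.
  by apply: eq_from_tnth => j; rewrite !tnth_mktuple opprB addrC subrK.
apply/measurable_EFinP; apply: measurable_funM => //.
by apply: (measurableT_comp mk); exact: measurable_tsubr.
Qed.

(** The convolution theorem in real form: the transform of the average is (kc + i ks)(gc - i gs),
    because s = X - y turns e^(i<u,s>) into e^(i<u,X>) e^(-i<u,y>). *)
Lemma smear_trig (g : d.-tuple R -> R) (u : d.-tuple R) : (forall x, 0 <= g x) ->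
  (lebesgue d).-integrable setT (EFin \o g) ->
  let kc := \int[P]_w (kap w * cos (dotp u (X w))) in
  let ks := \int[P]_w (kap w * sin (dotp u (X w))) in
  let gc := \int[lebesgue d]_x (g x * cos (dotp u x)) in
  let gs := \int[lebesgue d]_x (g x * sin (dotp u x)) in
  \int[lebesgue d]_s (smear g s * cos (dotp u s)) = kc * gc + ks * gs /\
  \int[lebesgue d]_s (smear g s * sin (dotp u s)) = ks * gc - kc * gs.
Proof.
move=> g0 ig kc ks gc gs.
have mg : measurable_fun setT g by apply/measurable_EFinP; exact: measurable_int ig.
have mdot : measurable_fun setT (fun x : d.-tuple R => dotp u x).
  by apply: measurable_dotp => //; exact: measurable_cst.
have mc : measurable_fun setT (fun x : d.-tuple R => cos (dotp u x)).
  exact: (measurableT_comp (@measurable_cos R)).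
have ms : measurable_fun setT (fun x : d.-tuple R => sin (dotp u x)).
  exact: (measurableT_comp (@measurable_sin R)).
have igc : (lebesgue d).-integrable setT (EFin \o (fun x => g x * cos (dotp u x))).
  by apply: (integrable_mulr_bounded (C := 1)) => // x; exact: normr_cos_le1.
have igs : (lebesgue d).-integrable setT (EFin \o (fun x => g x * sin (dotp u x))).
  by apply: (integrable_mulr_bounded (C := 1)) => // x; exact: normr_sin_le1.
have ikc : P.-integrable setT (EFin \o (fun w => kap w * cos (dotp u (X w)))).
  apply: (integrable_mulr_bounded (C := 1)) => //; first exact: (measurableT_comp mc).
  by move=> x; exact: normr_cos_le1.
have iks : P.-integrable setT (EFin \o (fun w => kap w * sin (dotp u (X w)))).
  apply: (integrable_mulr_bounded (C := 1)) => //; first exact: (measurableT_comp ms).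
  by move=> x; exact: normr_sin_le1.
have swap (k : d.-tuple R -> R) : measurable_fun setT k -> (forall x, `|k x| <= 1) ->
    \int[lebesgue d]_s (smear g s * k s) =
    \int[P]_w (kap w * \int[lebesgue d]_y (g y * k (tsub (X w) y))).
  move=> mk Kint1.
  have iF : (P \x lebesgue d)%E.-integrable setT (EFin \o (fun p => kap p.1 * g (tsub (X p.1) p.2) * k p.2)).
    apply: (integrable_mulr_bounded (C := 1)) => //; first exact: integrable_smear_fun.
    by apply: (measurableT_comp mk); exact: measurable_snd.
  transitivity (\int[lebesgue d]_s \int[P]_w (kap w * g (tsub (X w) s) * k s)).
    (* The factor k(s) enters the integral at every s, including those where the integral is
       infinite and both sides are 0. *)
    apply: eq_Rintegral => s _; rewrite ge0_RintegralZr//.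
      exact: (measurable_section2 s (measurable_smear_fun mg)).
    by move=> w; rewrite mulr_ge0.
  rewrite (Rintegral21 iF) -(Rintegral12 iF); apply: eq_Rintegral => w _ /=.
  rewrite -Rintegral_reflect_kernel// -RintegralZl//.
    by apply: eq_Rintegral => s _; rewrite mulrA.
  apply: (integrable_mulr_bounded (C := 1)) => //.
  apply/integrableP; split.
    by apply/measurable_EFinP; apply: (measurableT_comp mg); exact: measurable_tsubr.
  rewrite (ge0_integral_reflect (X w) (f := fun x => `|(g x)%:E|%E))//; first by case/integrableP: ig.
  by apply: measurableT_comp => //; exact/measurable_EFinP.
split.
  rewrite swap//; last by move=> x; exact: normr_cos_le1.
  transitivity (\int[P]_w (kap w * cos (dotp u (X w)) * gc + kap w * sin (dotp u (X w)) * gs)).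
    apply: eq_Rintegral => w _.
    rewrite -!mulrA -mulrDr; congr (_ * _).
    rewrite -!RintegralZl// -RintegralD//; last 2 first.
    - exact: (integrableZl measurableT _ igc).
    - exact: (integrableZl measurableT _ igs).
    by apply: eq_Rintegral => y _; rewrite dotpDtsubr cosB; ring.
  rewrite RintegralD//; last 2 first.
  - exact: (integrableZr measurableT _ ikc).
  - exact: (integrableZr measurableT _ iks).
  by rewrite !RintegralZr.
rewrite swap//; last by move=> x; exact: normr_sin_le1.
transitivity (\int[P]_w (kap w * sin (dotp u (X w)) * gc - kap w * cos (dotp u (X w)) * gs)).
  apply: eq_Rintegral => w _.
  rewrite -!mulrA -mulrBr; congr (_ * _).
  rewrite -!RintegralZl// -RintegralB//; last 2 first.
  - exact: (integrableZl measurableT _ igc).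
  - exact: (integrableZl measurableT _ igs).
  by apply: eq_Rintegral => y _; rewrite dotpDtsubr sinB; ring.
rewrite RintegralB//; last 2 first.
- exact: (integrableZr measurableT _ iks).
- exact: (integrableZr measurableT _ ikc).
by rewrite !RintegralZr.
Qed.

End smear.

(** * From the complex truncated inverse to its real Hartley form *)

Lemma sum_complex (R : realType) (I : finType) (a b : I -> R) :
  \sum_i (a i +i* b i) = (\sum_i a i) +i* (\sum_i b i).
Proof.
apply: esym; apply: (big_rec3 (fun x y z => x +i* y = z)) => // i x y z _ <-.
by [].
Qed.

Lemma cexp_sub_ir (R : realType) d (u r x : d.-tuple R) :
  cexp ('i%C * dotp (sub_ir u r) (cvec x)) =
  (expR (dotp r x) * cos (dotp u x)) +i* (expR (dotp r x) * sin (dotp u x)).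
Proof.
have -> : dotp (sub_ir u r) (cvec x) = dotp u x -i* dotp r x.
  rewrite /dotp -sumrN -sum_complex; apply: eq_bigr => j _.
  by rewrite !tnth_mktuple; apply/eqP; rewrite eq_complex/=; apply/andP; split; apply/eqP; ring.
rewrite /cexp /=.
rewrite (_ : 0 * dotp u x - 1 * - dotp r x = dotp r x); last by ring.
rewrite (_ : 0 * - dotp r x + 1 * dotp u x = dotp u x); last by ring.
by apply/eqP; rewrite eq_complex/=; apply/andP; split; apply/eqP; ring.
Qed.

Lemma cexp_ir_sub (R : realType) d (u r x : d.-tuple R) :
  cexp ('i%C * dotp (ir_sub r u) (cvec x)) =
  (expR (- dotp r x) * cos (dotp u x)) -i* (expR (- dotp r x) * sin (dotp u x)).
Proof.
have -> : dotp (ir_sub r u) (cvec x) = (- dotp u x) +i* dotp r x.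
  rewrite /dotp -sumrN -sum_complex; apply: eq_bigr => j _.
  by rewrite !tnth_mktuple; apply/eqP; rewrite eq_complex/=; apply/andP; split; apply/eqP; ring.
rewrite /cexp /=.
rewrite (_ : 0 * - dotp u x - 1 * dotp r x = - dotp r x); last by ring.
rewrite (_ : 0 * dotp r x + 1 * - dotp u x = - dotp u x); last by ring.
rewrite cosN sinN.
by apply/eqP; rewrite eq_complex/=; apply/andP; split; apply/eqP; ring.
Qed.

Lemma cexp_Ni (R : realType) (a : R) : cexp (- 'i%C * a%:C) = cos a -i* sin a.
Proof.
rewrite /cexp /=.
rewrite (_ : - 0 * a - - 1 * 0 = 0); last by ring.
rewrite (_ : - 0 * 0 + - 1 * a = - a); last by ring.
rewrite expR0 cosN sinN.
by apply/eqP; rewrite eq_complex/=; apply/andP; split; apply/eqP; ring.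
Qed.

Lemma Rintegral_cube (R : realType) d (A : R) (h : d.-tuple R -> R) :
  \int[lebesgue d]_(u in cube A) h u = \int[lebesgue d]_u (\1_(cube A) u * h u).
Proof.
rewrite Rintegral_mkcond; apply: eq_Rintegral => u _.
by rewrite patchE indicE; case: (_ \in _); rewrite ?mul1r ?mul0r.
Qed.

Lemma cube_topp (R : realType) d (A : R) (u : d.-tuple R) : \1_(cube A) (topp u) = \1_(cube A) u :> R.
Proof.
rewrite !indic_cube; apply: eq_bigr => j _; rewrite tnth_topp !indicE; congr (_%:R).
by congr nat_of_bool; apply/idP/idP; rewrite !inE/= !in_itv/= => /andP[h1 h2]; apply/andP; split; lra.
Qed.

(** The cube is invariant under negation, so the integral equals its own negative; boundedness makes
    it finite. *)
Lemma Rintegral_cube_odd (R : realType) d (A : R) (h : d.-tuple R -> R) (C : R) :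
  measurable_fun setT h -> (forall u, `|h u| <= C) -> (forall u, h (topp u) = - h u) ->
  \int[lebesgue d]_(u in cube A) h u = 0.
Proof.
move=> mh hC hodd; rewrite Rintegral_cube.
have ih : (lebesgue d).-integrable setT (EFin \o (fun u => \1_(cube A) u * h u)).
  apply: (integrable_indic_mul (C := C)) => //; [exact: measurable_cube|exact: lebesgue_cube_lty].
have mih : measurable_fun setT (fun u => (\1_(cube A) u * h u)%:E) by case/integrableP: ih.
have : \int[lebesgue d]_u (\1_(cube A) u * h u) = \int[lebesgue d]_u (-1 * (\1_(cube A) u * h u)).
  rewrite {1}/Rintegral -(integral_reflect [tuple 0 | _ < d] (f := fun u => (\1_(cube A) u * h u)%:E))//.
  congr fine; apply: eq_integral => u _; rewrite -/(topp u) cube_topp hodd; congr EFin; ring.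
by rewrite RintegralZl//; set I := \int[_]_u _; lra.
Qed.

Lemma dotpNl (R : realType) d (u x : d.-tuple R) : dotp (topp u) x = - dotp u x.
Proof. by rewrite dotpC dotpNr dotpC. Qed.

(** The Hartley transform of G is its even part C plus its odd part S. Multiplied by cos + sin it
    yields cos C + sin S and the odd terms cos S + sin C, which cancel over the symmetric cube. The
    second identity holds by the same parity. *)
Lemma trunc_trig (R : realType) d (A : R) (G : d.-tuple R -> R) (s : d.-tuple R) :
  (lebesgue d).-integrable setT (EFin \o G) ->
  let C u := \int[lebesgue d]_x (G x * cos (dotp u x)) in
  let S u := \int[lebesgue d]_x (G x * sin (dotp u x)) in
  trunc A G s = (2 * pi) ^- d *
    \int[lebesgue d]_(u in cube A) (cos (dotp u s) * C u + sin (dotp u s) * S u) /\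
  \int[lebesgue d]_(u in cube A) (cos (dotp u s) * S u - sin (dotp u s) * C u) = 0.
Proof.
move=> iG C S; have mG : measurable_fun setT G by apply/measurable_EFinP; exact: measurable_int iG.
pose B := \int[lebesgue d]_x `|G x| * 1.
have md2 : measurable_fun setT (fun p : d.-tuple R * d.-tuple R => dotp p.1 p.2).
  by apply: measurable_dotp; [exact: measurable_fst|exact: measurable_snd].
have mG2 : measurable_fun setT (fun p : d.-tuple R * d.-tuple R => G p.2).
  by apply: (measurableT_comp mG); exact: measurable_snd.
have mC : measurable_fun setT C.
  apply: (@measurable_Rintegral_section _ _ _ _ _ (lebesgue d)
    (fun p : d.-tuple R * d.-tuple R => G p.2 * cos (dotp p.1 p.2))).
  by apply: measurable_funM => //; exact: (measurableT_comp (@measurable_cos R)).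
have mS : measurable_fun setT S.
  apply: (@measurable_Rintegral_section _ _ _ _ _ (lebesgue d)
    (fun p : d.-tuple R * d.-tuple R => G p.2 * sin (dotp p.1 p.2))).
  by apply: measurable_funM => //; exact: (measurableT_comp (@measurable_sin R)).
have mdu (u : d.-tuple R) : measurable_fun setT (dotp u).
  by apply: measurable_dotp => //; exact: measurable_cst.
have mcx u : measurable_fun setT (fun x : d.-tuple R => cos (dotp u x)) by exact: (measurableT_comp (@measurable_cos R)).
have msx u : measurable_fun setT (fun x : d.-tuple R => sin (dotp u x)) by exact: (measurableT_comp (@measurable_sin R)).
have CB u : `|C u| <= B by apply: normr_Rintegral_kernel_le => // x; exact: normr_cos_le1.
have SB u : `|S u| <= B by apply: normr_Rintegral_kernel_le => // x; exact: normr_sin_le1.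
have CN u : C (topp u) = C u by apply: eq_Rintegral => x _; rewrite dotpNl cosN.
have SN u : S (topp u) = - S u.
  rewrite /S -mulN1r -RintegralZl//; last first.
    by apply: (integrable_mulr_bounded (C := 1)) => // x; exact: normr_sin_le1.
  by apply: eq_Rintegral => x _; rewrite dotpNl sinN; ring.
have mc := measurable_cos_dotp s; have ms := measurable_sin_dotp s.
have bnd (a b c e : R) : `|a| <= 1 -> `|b| <= B -> `|c| <= 1 -> `|e| <= B -> `|a * b + c * e| <= B + B.
  move=> a1 b1 c1 e1; rewrite (le_trans (ler_normD _ _))// !normrM lerD//.
    by rewrite -[leRHS]mul1r ler_pM.
  by rewrite -[leRHS]mul1r ler_pM.
have odd1 : \int[lebesgue d]_(u in cube A) (cos (dotp u s) * S u - sin (dotp u s) * C u) = 0.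
  apply: (@Rintegral_cube_odd _ _ A _ (B + B)).
  - by apply: measurable_funB; exact: measurable_funM.
  - by move=> u; rewrite -mulrN; apply: bnd; rewrite ?normrN ?normr_cos_le1 ?normr_sin_le1.
  - by move=> u; rewrite dotpNl cosN sinN SN CN; ring.
have odd2 : \int[lebesgue d]_(u in cube A) (cos (dotp u s) * S u + sin (dotp u s) * C u) = 0.
  apply: (@Rintegral_cube_odd _ _ A _ (B + B)).
  - by apply: measurable_funD; exact: measurable_funM.
  - by move=> u; apply: bnd; rewrite ?normr_cos_le1 ?normr_sin_le1.
  - by move=> u; rewrite dotpNl cosN sinN SN CN; ring.
split => //.
(* The vanishing odd integral is added to the right-hand side to complete the product of the two
   Hartley factors. *)
rewrite /trunc; congr (_ * _); rewrite Rintegral_cube -[RHS]addr0 -odd2 Rintegral_cube -RintegralD//; last 2 first.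
- apply: (integrable_indic_mul (C := B + B)); [exact: measurable_cube|exact: lebesgue_cube_lty| |].
    by apply: measurable_funD; exact: measurable_funM.
  by move=> u; apply: bnd; rewrite ?normr_cos_le1 ?normr_sin_le1.
- apply: (integrable_indic_mul (C := B + B)); [exact: measurable_cube|exact: lebesgue_cube_lty| |].
    by apply: measurable_funD; exact: measurable_funM.
  by move=> u; apply: bnd; rewrite ?normr_cos_le1 ?normr_sin_le1.
apply: eq_Rintegral => u _; rewrite /hartley_cut.
have -> : hartley G u = C u + S u.
  rewrite /C /S -RintegralD//; last 2 first.
  - by apply: (integrable_mulr_bounded (C := 1)) => // x; exact: normr_cos_le1.
  - by apply: (integrable_mulr_bounded (C := 1)) => // x; exact: normr_sin_le1.
  by apply: eq_Rintegral => x _; rewrite /cas mulrDr.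
by rewrite casC /cas; ring.
Qed.

(** By the convolution theorem the product of the two transforms is C + iS for the averaged
    function. Multiplied by e^(-i<u,s>) it has the real part cos C + sin S, which gives [trunc], and
    an odd imaginary part, which integrates to 0. *)
Lemma truncated_inverseE (R : realType) (d : nat) (dO : measure_display)
    (Omega : measurableType dO) (P : probability Omega R) (X : Omega -> d.-tuple R)
    (f : d.-tuple R -> R) (r : d.-tuple R) (A : R) (s : d.-tuple R) :
  let kap w := expR (dotp r (X w)) in
  let g x := expR (- dotp r x) * f x in
  measurable_fun setT X -> P.-integrable setT (EFin \o kap) ->
  (forall x, 0 <= f x) -> (lebesgue d).-integrable setT (EFin \o g) ->
  truncated_inverse P f X r A s = (trunc A (smear P X kap g) s)%:C.
Proof.
move=> kap g mX ikap f0 ig.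
have mkap : measurable_fun setT kap by apply/measurable_EFinP; exact: measurable_int ikap.
have mg : measurable_fun setT g by apply/measurable_EFinP; exact: measurable_int ig.
have kap0 w : 0 <= kap w by exact: expR_ge0.
have g0 x : 0 <= g x by rewrite mulr_ge0// expR_ge0.
have iG := integrable_smear mX mkap kap0 ikap g0 ig.
have [trE odd0] := trunc_trig A s iG.
have sm u := smear_trig mX mkap kap0 ikap u g0 ig.
pose kc u := \int[P]_w (kap w * cos (dotp u (X w))).
pose ks u := \int[P]_w (kap w * sin (dotp u (X w))).
pose gc u := \int[lebesgue d]_x (g x * cos (dotp u x)).
pose gs u := \int[lebesgue d]_x (g x * sin (dotp u x)).
have chE u : charfun P X (sub_ir u r) = kc u +i* ks u.
  by rewrite /charfun /cintegral; congr (_ +i* _); apply: eq_Rintegral => w _; rewrite cexp_sub_ir.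
have foE u : fourier f (ir_sub r u) = gc u -i* gs u.
  rewrite /fourier /cintegral; congr (_ +i* _).
    by apply: eq_Rintegral => x _; rewrite cexp_ir_sub/= /g; ring.
  rewrite /gs -mulN1r -RintegralZl//; last first.
    apply: (integrable_mulr_bounded (C := 1)) => //; last by move=> x; exact: normr_sin_le1.
    apply: (measurableT_comp (@measurable_sin R)).
    by apply: measurable_dotp => //; exact: measurable_cst.
  by apply: eq_Rintegral => x _; rewrite cexp_ir_sub/= /g; ring.
rewrite /truncated_inverse /cintegral.
have -> : \int[lebesgue d]_(u in cube A) complex.Re (cexp (- 'i%C * (dotp u s)%:C) *
    charfun P X (sub_ir u r) * fourier f (ir_sub r u)) =
    \int[lebesgue d]_(u in cube A) (cos (dotp u s) * (\int[lebesgue d]_x (smear P X kap g x * cos (dotp u x))) +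
      sin (dotp u s) * (\int[lebesgue d]_x (smear P X kap g x * sin (dotp u x)))).
  apply: eq_Rintegral => u _; rewrite cexp_Ni chE foE (sm u).1 (sm u).2 -/(kc u) -/(ks u) -/(gc u) -/(gs u) /=.
  ring.
have -> : \int[lebesgue d]_(u in cube A) complex.Im (cexp (- 'i%C * (dotp u s)%:C) *
    charfun P X (sub_ir u r) * fourier f (ir_sub r u)) =
    \int[lebesgue d]_(u in cube A) (cos (dotp u s) * (\int[lebesgue d]_x (smear P X kap g x * sin (dotp u x))) -
      sin (dotp u s) * (\int[lebesgue d]_x (smear P X kap g x * cos (dotp u x)))).
  apply: eq_Rintegral => u _; rewrite cexp_Ni chE foE (sm u).1 (sm u).2 -/(kc u) -/(ks u) -/(gc u) -/(gs u) /=.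
  ring.
rewrite odd0 trE; apply/eqP; rewrite eq_complex/=; apply/andP; split; apply/eqP; ring.
Qed.

(** * L^2 norms of real functions, and the conclusion *)

Lemma cLnorm2_real (R : realType) d (T : measurableType d) (mu : {measure set T -> \bar R})
    (h : T -> R) :
  mu.-integrable setT (EFin \o (fun x => h x ^+ 2)) ->
  cLnorm2 mu (fun x => (h x)%:C) = (Num.sqrt (\int[mu]_x (h x ^+ 2)))%:E.
Proof.
move=> ih; rewrite /cLnorm2 unlock.
have -> : (\int[mu]_x (`|(Normc.normc ((h x)%:C))%:E| `^ 2) = (\int[mu]_x (h x ^+ 2))%:E)%E.
  rewrite (EFin_Rintegral ih); apply: eq_integral => x _.
  have -> : Normc.normc (h x)%:C = `|h x| by rewrite /Normc.normc /= expr0n addr0 sqrtr_sqr.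
  rewrite gee0_abs ?lee_fin// poweR_EFin; congr EFin.
  by rewrite powR_mulrn// real_normK// num_real.
rewrite poweR_EFin powR12_sqrt//; apply: Rintegral_ge0 => x _; exact: sqr_ge0.
Qed.

Lemma cL2_real (R : realType) d (T : measurableType d) (mu : {measure set T -> \bar R})
    (h : T -> R) : measurable_fun setT h ->
  mu.-integrable setT (EFin \o (fun x => h x ^+ 2)) -> cL2 mu (fun x => (h x)%:C).
Proof.
by move=> mh ih; split => //=; rewrite cLnorm2_real// ltry.
Qed.

(** The limit is written with [fine], which sends an infinite price to 0. The first conjunct ensures
    that this happens only on a null set, so the L^2 class is that of e^(<R,s>) V(s). *)
Theorem theorem3p4 (R : realType) (d : nat) (hd : (0 < d)%N)
    (dO : measure_display) (Omega : measurableType dO)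
    (P : probability Omega R) (T : R) (hT : 0 <= T)
    (F : R -> set (set Omega)) (hF : stochastic_basis T F)
    (H : R -> Omega -> d.-tuple R)
    (hH : forall j, semimartingale P T F (fun t w => tnth (H t w) j))
    (S0 : d.-tuple R) (hS0 : forall j, 0 < tnth S0 j)
    (S : R -> Omega -> d.-tuple R)
    (hS_init : forall w, S 0 w = S0)
    (hS : forall (t : R) w j, 0 <= t <= T ->
       tnth (S t w) j = tnth S0 j * expR (tnth (H t w) j))
    (hS_mart : forall j, local_martingale P T F (fun t w => tnth (S t w) j))
    (Psi : (R -> d.-tuple R) -> d.-tuple R)
    (hPsi : measurable_functional T Psi)
    (X : Omega -> d.-tuple R) (hX : forall w, X w = Psi (H ^~ w))
    (mX : forall B, measurable B -> F T (X @^-1` B))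
    (f : d.-tuple R -> R) (f_ge0 : forall x, 0 <= f x)
    (mf : measurable_fun setT f)
    (r : d.-tuple R)
    (hg1 : (fun x => expR (- dotp r x) * f x) \in Lfun (lebesgue d) 1%E)
    (hg2 : (fun x => expR (- dotp r x) * f x) \in Lfun (lebesgue d) 2%:E)
    (hM : (mgf P X r < +oo)%E) :
  {ae lebesgue d, forall s, (price P f X s < +oo)%E} /\
  cL2_cvg (lebesgue d) (truncated_inverse P f X r)
    (fun s => (expR (dotp r s) * fine (price P f X s))%:C).
Proof.
(* [F T] is the whole sigma-algebra, by the last clause of the stochastic basis. *)
have mX' : measurable_fun setT X.
  by move=> _ B mB; rewrite setTI; have [_ _ _ <-] := hF; exact: mX.
pose kap w := expR (dotp r (X w)).
pose g x := expR (- dotp r x) * f x.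
have ig : (lebesgue d).-integrable setT (EFin \o g) by apply/Lfun1_integrable.
have ig2 : (lebesgue d).-integrable setT (EFin \o (fun x => g x ^+ 2)) by exact: Lfun2_integrable_sqr.
have g0 x : 0 <= g x by rewrite mulr_ge0// expR_ge0.
have mg : measurable_fun setT g by apply/measurable_EFinP; exact: measurable_int ig.
have mkap : measurable_fun setT kap.
  apply: (measurableT_comp (@measurable_expR R)).
  by apply: measurable_dotp => //; exact: measurable_cst.
have kap0 w : 0 <= kap w by exact: expR_ge0.
have ikap : P.-integrable setT (EFin \o kap).
  apply/integrableP; split; first exact/measurable_EFinP.
  under eq_integral do rewrite /= ger0_norm//.
  by move: hM; rewrite /mgf unlock.
(* Tilting: e^(<r,X>) e^(-<r,X - s>) = e^(<r,s>) no longer depends on w. *)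
have pt s w : kap w * g (tsub (X w) s) = f (tsub (X w) s) * expR (dotp r s).
  rewrite /kap /g mulrA -expRD mulrC dotpDtsubr; congr (_ * expR _); ring.
have mfs s : measurable_fun setT (fun w => f (tsub (X w) s)).
  by apply: (measurableT_comp mf); apply: measurable_tsub => //; exact: measurable_cst.
set G := smear P X kap g.
(* The identity holds at every s: where the price is infinite, both sides are 0. *)
have GE s : expR (dotp r s) * fine (price P f X s) = G s.
  rewrite /price unlock mulrC -[LHS]ge0_RintegralZr//.
  by apply: eq_Rintegral => w _; rewrite pt.
have iG := integrable_smear mX' mkap kap0 ikap g0 ig.
have iG2 := integrable_smear_sqr mX' mkap kap0 ikap g0 ig ig2.
have G0 s : 0 <= G s by apply: Rintegral_ge0 => w _; rewrite mulr_ge0.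
have mG : measurable_fun setT G by apply/measurable_EFinP; exact: measurable_int iG.
have tE A : truncated_inverse P f X r A = fun s => (trunc A G s)%:C.
  by apply/funext => s; exact: truncated_inverseE.
have mtr A : measurable_fun setT (trunc A G).
  apply: measurable_funM => //; apply: measurable_hartley.
  by apply/measurable_EFinP; exact: measurable_int (integrable_hartley_cut A iG).
split.
  have := ae_smear_lty mX' mkap kap0 ikap g0 ig; apply: filterS => s.
  under eq_integral do rewrite pt EFinM.
  rewrite ge0_integralZr//; last 2 first.
  - exact/measurable_EFinP.
  - by move=> w _; rewrite lee_fin.
  (* An infinite price times the positive number e^(<r,s>) would stay infinite. *)
  rewrite /price unlock; case: (\int[P]_x _)%E => [y _|+|_]; rewrite ?ltry ?ltNyy//.
  by rewrite gt0_mulye// lte_fin expR_gt0.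
have -> : (fun s => (expR (dotp r s) * fine (price P f X s))%:C) = (fun s => (G s)%:C).
  by apply/funext => s; rewrite GE.
split.
- by move=> A; rewrite tE; apply: cL2_real => //; case: (trunc_error A iG iG2).
- exact: cL2_real.
have E A : cLnorm2 (lebesgue d) (fun x => truncated_inverse P f X r A x - (G x)%:C) =
    (Num.sqrt (\int[lebesgue d]_s ((trunc A G s - G s) ^+ 2)))%:E.
  rewrite tE -cLnorm2_real; last by have [_ []] := trunc_error A iG iG2.
  by congr cLnorm2; apply/funext => x; rewrite -rmorphB.
under eq_fun do rewrite E.
apply/fine_cvgP; split; first by near=> A.
apply/cvgrPdist_le => /= e e0.
(* The error estimate concerns the squared norm, hence the tolerance e^2. *)
have e20 : 0 < e ^+ 2 by rewrite exprn_gt0.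
have := near_trunc_error e20 iG iG2 G0; apply: filterS => A hA.
rewrite sub0r normrN ger0_norm ?sqrtr_ge0//.
by rewrite -[leRHS](ger0_norm (ltW e0)) -sqrtr_sqr ler_wsqrtr.
Unshelve. all: by end_near. Qed.
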